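(* Let $g\in\mathcal{D}$ and let $\omega(\sigma)=\sigma\,(1+\log(1/\sigma))$ for $0<\sigma\le1$. The Volterra operator $T_g$ is bounded on $\mathrm{Bloch}(\mathbb{C}_+)\cap\mathcal{D}$ if and only if $g\in\mathrm{Bloch}_\omega(\mathbb{C}_+)$.
   Context: Notation: $\mathbb{C}_\theta=\{s\in\mathbb{C}:\mathrm{Re}(s)>\theta\}$, $\mathbb{C}_+=\mathbb{C}_0$. $\mathcal{D}$ is the set of Dirichlet series $\sum_{n\ge1}a_nn^{-s}$ converging in some half-plane; a Dirichlet series is said to belong to a space of analytic functions on a half-plane if its analytic extension does. $\mathrm{Bloch}(\mathbb{C}_+)$ is the space of analytic $f$ on $\mathbb{C}_+$ with norm $\|f\|_{\mathrm{Bloch}(\mathbb{C}_+)}=\sup_{\sigma>0,\,t\in\mathbb{R}}\sigma|f'(\sigma+it)|+|f(1)|<\infty$. For a weight $\omega:(0,1]\to(0,\infty)$, $\mathrm{Bloch}_\omega(\mathbb{C}_+)$ is the space of analytic $f$ on $\mathbb{C}_+$ with $$\operatorname*{ess\,sup}_{0<\sigma\le1,\ t\in\mathbb{R}}\omega(\sigma)|f'(\sigma+it)|+\sup_{s\in\mathbb{C}_1}|f(s)|<\infty .$$ For $g\in\mathcal{D}$ and a convergent Dirichlet series $f$, $T_gf(s)=-\int_s^\infty f(w)g'(w)\,dw$ (integration along the horizontal half-line, $\mathrm{Re}(s)$ large), again a convergent Dirichlet series. $T_g$ is bounded on a space $X$ if $T_gf\in X$ for all $f\in X$ and $\|T_gf\|_X\lesssim\|f\|_X$.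 *)

(* Defs.v *)
(* Complex analysis is Coquelicot's; the essential supremum, Lebesgue measure
   and extended reals are those of mathcomp-analysis, taken at Stdlib's R. *)
From Stdlib Require Import Reals.
From mathcomp Require Import boot.ssreflect boot.ssrbool algebra.ssralg order.order.
From mathcomp Require Import boolp classical_sets functions reals.
From mathcomp Require Import constructive_ereal ereal.
From mathcomp Require Import measure lebesgue_measure measurable_realfun.
From mathcomp Require Import lebesgue_integral ess_sup_inf.
From mathcomp Require Import Rstruct Rstruct_topology.
From Coquelicot Require Import Coquelicot.

Local Open Scope classical_set_scope.
Local Open Scope ring_scope.
Local Open Scope R_scope.

Definition half_plane (theta : R) : set C := [set s : C | theta < Re s].

Definition holomorphic_on (U : set C) (F : C -> C) : Prop :=
  forall s : C, U s -> ex_derive (K := C_AbsRing) (V := C_NormedModule) F s.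

Definition Cexp (z : C) : C := (exp (Re z) * cos (Im z), exp (Re z) * sin (Im z)).

(* A Dirichlet series sum_(n >= 1) a_n n^(-s) is given by its coefficients
   a : nat -> C.  Coquelicot's series start at 0, so the n-th term is
   a_(n+1) (n+1)^(-s); the value a 0 is never used. *)
Definition dirichlet_term (a : nat -> C) (s : C) (n : nat) : C :=
  (a (S n) * Cexp (- (s * RtoC (ln (INR (S n))))))%C.

(* Junk value where the series diverges. *)
Definition dirichlet_sum (a : nat -> C) (s : C) : C :=
  (Series (fun n => Re (dirichlet_term a s n)),
   Series (fun n => Im (dirichlet_term a s n))).

Definition in_D (a : nat -> C) : Prop :=
  exists theta : R, forall s : C, half_plane theta s ->
    ex_series (K := C_AbsRing) (V := C_NormedModule) (dirichlet_term a s).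

Definition eq_far_right (F G : C -> C) : Prop :=
  exists theta : R, forall s : C, half_plane theta s -> F s = G s.

(* F is the analytic extension to C_+ of the series with coefficients a.  It is
   enough to ask for agreement far to the right, by the identity theorem. *)
Definition analytic_extension (a : nat -> C) (F : C -> C) : Prop :=
  holomorphic_on (half_plane 0) F /\ eq_far_right F (dirichlet_sum a).

Definition weighted_derivative (w : R -> R) (F : C -> C) (s : C) : R :=
  w (Re s) * Cmod (C_derive F s).

Definition bloch_norm (F : C -> C) : \bar R :=
  (ereal_sup [set (weighted_derivative (fun sigma => sigma) F s)%:E | s in half_plane 0]
   + (Cmod (F (RtoC 1)))%:E)%E.

Definition in_bloch (F : C -> C) : Prop :=
  holomorphic_on (half_plane 0) F /\ (bloch_norm F < +oo)%E.

(* Lebesgue measure on C, which Coquelicot defines as R * R. *)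
Definition lebesgue_C :
    {measure set (measurableTypeR R * measurableTypeR R) -> \bar (R : realType)} :=
  (@lebesgue_measure R \x @lebesgue_measure R)%E.

Definition unit_strip : set C := [set s : C | 0 < Re s <= 1].

(* Only the values of the weight w on (0, 1] matter.  The function inside
   ess_sup is nonnegative, so extending it by 0 off the strip (which is what \_
   does) yields the essential supremum over the strip. *)
Definition bloch_weight_norm (w : R -> R) (F : C -> C) : \bar R :=
  (ess_sup lebesgue_C
     ((fun s : C => (weighted_derivative w F s)%:E) \_ unit_strip)
   + ereal_sup [set (Cmod (F s))%:E | s in half_plane 1])%E.

Definition in_bloch_weight (w : R -> R) (F : C -> C) : Prop :=
  holomorphic_on (half_plane 0) F /\ (bloch_weight_norm w F < +oo)%E.

(* The integral of h from s to infinity along the horizontal half-line. *)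
Definition integral_right (h : C -> C) (s : C) : C :=
  RInt_gen (V := C_R_CompleteNormedModule) (fun x : R => h (Cplus s (RtoC x)))
    (at_point 0) (Rbar_locally p_infty).

(* T_g f, where b and a are the coefficients of g and f; meaningful for Re s
   large. *)
Definition volterra (b a : nat -> C) (s : C) : C :=
  (- integral_right
       (fun w => dirichlet_sum a w * C_derive (dirichlet_sum b) w) s)%C.

(* The series with coefficients a belongs to Bloch(C_+), with extension F. *)
Definition bloch_dirichlet (a : nat -> C) (F : C -> C) : Prop :=
  in_D a /\ analytic_extension a F /\ in_bloch F.

Definition volterra_bounded (b : nat -> C) : Prop :=
  exists M : R, forall (a : nat -> C) (F : C -> C), bloch_dirichlet a F ->
    exists (c : nat -> C) (H : C -> C),
      bloch_dirichlet c H /\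
      eq_far_right (dirichlet_sum c) (volterra b a) /\
      (bloch_norm H <= M%:E * bloch_norm F)%E.

Definition log_weight (sigma : R) : R := sigma * (1 + ln (1 / sigma)).

(* Main.v *)
(* The derivative of T_g f is f g'.  A Bloch Dirichlet series F grows at most like 1 + log (1 / Re s) at the
   boundary, uniformly in Im s: on Re s >= 1 Phragmén–Lindelöf applied to F' 2^s gives |F'| <= 2 ||F|| 2^(-Re s),
   so F is O(||F||) there, and |F'| <= ||F|| / Re s is integrated on the strip.  Hence the weighted condition on G'
   bounds Re s |F G'|, and a primitive of F G' on C_+ is the extension of T_g f.  Conversely T_g 1 extends g to C_+,
   and the vertical translates of sum n^(-1-s) / log n, uniformly bounded in the Bloch norm, grow like log (1 / Re s)
   on a horizontal line; the identity (T_g f)' = f g' persists on C_+ by the identity theorem and yields the weighted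
   bound for g'. *)
Require Import Defs.
From Stdlib Require Import Reals Lra Lia Psatz ClassicalEpsilon.
From mathcomp Require boot.ssreflect boot.ssrbool algebra.ssralg order.order.
From mathcomp Require boolp classical_sets functions reals constructive_ereal ereal interval.
From mathcomp Require measure lebesgue_measure measurable_realfun lebesgue_integral ess_sup_inf.
From mathcomp Require Rstruct Rstruct_topology.
From Coquelicot Require Import Coquelicot.

Local Open Scope R_scope.

(** * Complex derivatives and curve integrals *)

(** The bound for T_g must be linear in the norm of F. Far to the right F' decays like 2^(-Re s) by
    absolute convergence, but with a constant that the Bloch norm does not control.
    Phragmén-Lindelöf uses this only as a qualitative bound and replaces the constant by the bound
    on Re s = 1. For the fixed series g such a constant is harmless. The weight says nothing about
    Re s > 1. There G' is bounded by a Cauchy estimate, since G is bounded, and decays because its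
    series has no constant term; this controls Re s |F G'| for large Re s, and the value of T_g f at
    1. The Cauchy theory lives on rectangles, and the integral of 1/(w - z) is never evaluated: it
    is enough that it is nonzero, has zero derivative in z, and has modulus at least 1 for a square
    centred at z. The essential supremum bounds every point of the strip, because by continuity a
    strict excess at one point spreads to a square of positive measure. In the converse the test
    functions only reach log(1/Re s) - 3; the missing multiple of Re s |G'| is paid by the Bloch
    bound for T_g 1. *)

(** An epsilon-delta form equivalent to [is_derive] for both normed-module structures of C over
    itself, so that rules stated for either one apply. *)
Definition cderiv (f : C -> C) (z d : C) : Prop :=
  forall eps, 0 < eps -> exists del, 0 < del /\ forall w, Cmod (w - z) < del ->
    Cmod (f w - f z - d * (w - z)) <= eps * Cmod (w - z).

Definition ccont (f : C -> C) (z : C) : Prop :=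
  forall eps, 0 < eps -> exists del, 0 < del /\ forall w, Cmod (w - z) < del ->
    Cmod (f w - f z) <= eps.

Lemma Rlt_Rmin (x a b : R) : x < Rmin a b -> x < a /\ x < b.
Proof. apply Rmin_Rgt. Qed.

Lemma common_upper_bound (a b c d : R) : exists m, a <= m /\ b <= m /\ c <= m /\ d <= m.
Proof.
  exists (Rmax (Rmax a b) (Rmax c d)).
  generalize (Rmax_l a b) (Rmax_r a b) (Rmax_l c d) (Rmax_r c d)
    (Rmax_l (Rmax a b) (Rmax c d)) (Rmax_r (Rmax a b) (Rmax c d)). lra.
Qed.

Lemma nonincreasing_of_derivative (G g : R -> R) (a b : R) : a <= b ->
  (forall t, a <= t <= b -> is_derive G t (g t)) -> (forall t, a <= t <= b -> g t <= 0) -> G b <= G a.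
Proof.
  intros Hab HG Hg.
  destruct (MVT_gen G a b g) as [t [Ht E]]; rewrite Rmin_left, Rmax_right in * by lra.
  - intros t Ht. apply HG. lra.
  - intros t Ht. apply derivable_continuous_pt. exists (g t). apply is_derive_Reals. now apply HG.
  - specialize (Hg t Ht). nra.
Qed.

Lemma Cmod_triangle_sub (x y : C) : Cmod (x - y) <= Cmod x + Cmod y.
Proof.
  replace (x - y)%C with (x + (- y))%C by ring.
  rewrite <- (Cmod_opp y). apply Cmod_triangle.
Qed.

Lemma Cmod_sub_sym (x y : C) : Cmod (x - y) = Cmod (y - x).
Proof. rewrite <- Cmod_opp. f_equal. ring. Qed.

Lemma Cmod_sub_rev (x y : C) : Cmod x - Cmod y <= Cmod (x - y).
Proof.
  generalize (Cmod_triangle (x - y) y). replace (x - y + y)%C with x by ring. lra.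
Qed.

Lemma im_le_Cmod (c : C) : Rabs (Im c) <= Cmod c.
Proof.
  eapply Rle_trans; [| apply Rmax_Cmod]. apply Rmax_r.
Qed.

Lemma Cmod_le_abs_sum (x y : R) : Cmod (x, y) <= Rabs x + Rabs y.
Proof.
  replace (x, y) with (RtoC x + Ci * RtoC y)%C
    by (unfold RtoC, Ci, Cplus, Cmult; simpl; f_equal; ring).
  eapply Rle_trans; [apply Cmod_triangle|].
  rewrite Cmod_mult, Cmod_Ci, !Cmod_R. lra.
Qed.

(** Reduces the estimate of a complex modulus to that of a real part; u is the conjugate of D
    divided by |D|. *)
Lemma unit_phase (D : C) : exists u, Cmod u <= 1 /\ Re (u * D) = Cmod D.
Proof.
  destruct (Req_dec (Cmod D) 0) as [E|E].
  - exists 1. rewrite Cmod_1, E, (Cmod_eq_0 D E). simpl. lra.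
  - assert (Hm : 0 < Cmod D) by (generalize (Cmod_ge_0 D); lra).
    assert (Hn : RtoC (Cmod D) <> 0) by (intros K%RtoC_inj; lra).
    exists (Cconj D * / Cmod D)%C. split.
    + rewrite Cmod_mult, Cmod_conj, Cmod_inv, Cmod_R, Rabs_pos_eq by (auto; lra).
      right. field. lra.
    + replace (Cconj D * / Cmod D * D)%C with (D * Cconj D * / Cmod D)%C by ring.
      rewrite <- Cmod2_conj, <- RtoC_inv, <- RtoC_mult by lra. simpl. field. lra.
Qed.

Lemma is_derive_cderiv (f : C -> C) (z d : C) :
  is_derive (K := C_AbsRing) (V := C_NormedModule) f z d <-> cderiv f z d.
Proof.
  split.
  - intros [_ H] eps Heps.
    destruct (H z (fun P HP => HP) (mkposreal eps Heps)) as [del Hdel].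
    exists del. split; [apply cond_pos|].
    intros w Hw. specialize (Hdel w Hw).
    replace (f w - f z - d * (w - z))%C with (f w - f z - (w - z) * d)%C by ring.
    exact Hdel.
  - intros H. split.
    + apply (is_linear_scal_l (K := C_AbsRing) (V := C_NormedModule) d).
    + intros x Hx eps.
      apply (is_filter_lim_locally_unique (K := C_AbsRing) (V := AbsRing_NormedModule C_AbsRing)) in Hx.
      subst x.
      destruct (H eps (cond_pos eps)) as [del [Hdel Hd]].
      exists (mkposreal _ Hdel). intros y Hy.
      specialize (Hd y Hy).
      replace (f y - f z - d * (y - z))%C with (f y - f z - (y - z) * d)%C in Hd by ring.
      exact Hd.
Qed.

Lemma is_derive_ring_cderiv (f : C -> C) (z d : C) :
  is_derive (K := C_AbsRing) (V := AbsRing_NormedModule C_AbsRing) f z d <-> cderiv f z d.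
Proof.
  rewrite <- is_derive_cderiv. split; intros [_ H];
  (split; [apply is_linear_scal_l | exact H]).
Qed.

Lemma continuous_ccont (f : C -> C) (z : C) :
  continuous (T := AbsRing_UniformSpace C_AbsRing) (U := AbsRing_UniformSpace C_AbsRing) f z <-> ccont f z.
Proof.
  split.
  - intros H eps Heps.
    destruct (proj1 (filterlim_locally _ _) H (mkposreal eps Heps)) as [del Hd].
    exists del. split; [apply cond_pos|]. intros w Hw. left. exact (Hd w Hw).
  - intros H. apply filterlim_locally. intros eps.
    destruct (H (eps / 2)) as [del [Hdel Hd]]; [generalize (cond_pos eps); lra|].
    exists (mkposreal del Hdel). intros w Hw.
    apply Rle_lt_trans with (eps / 2); [exact (Hd w Hw) | generalize (cond_pos eps); lra].
Qed.

Lemma cderiv_ccont f z d : cderiv f z d -> ccont f z.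
Proof.
  intros H%is_derive_ring_cderiv. apply continuous_ccont.
  apply (ex_derive_continuous (K := C_AbsRing) (V := AbsRing_NormedModule C_AbsRing)). now exists d.
Qed.

Lemma cderiv_ext_near (f g : C -> C) z d :
  (exists r, 0 < r /\ forall w, Cmod (w - z) < r -> f w = g w) ->
  cderiv f z d -> cderiv g z d.
Proof.
  intros [r [Hr E]] H eps Heps.
  destruct (H eps Heps) as [del [Hdel Hd]].
  exists (Rmin del r). split; [now apply Rmin_glb_lt|].
  intros w Hw.
  rewrite <- (E w), <- (E z).
  - apply Hd. eapply Rlt_le_trans; [apply Hw | apply Rmin_l].
  - replace (z - z)%C with (RtoC 0) by ring. now rewrite Cmod_0.
  - eapply Rlt_le_trans; [apply Hw | apply Rmin_r].
Qed.

Lemma cderiv_ext (f g : C -> C) z d : (forall w, f w = g w) -> cderiv f z d -> cderiv g z d.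
Proof. intros E. apply cderiv_ext_near. exists 1. split; [lra | auto]. Qed.

Lemma cderiv_unique f z d e : cderiv f z d -> cderiv f z e -> d = e.
Proof.
  intros H1%is_derive_cderiv H2%is_derive_cderiv.
  apply is_C_derive_unique in H1. apply is_C_derive_unique in H2. congruence.
Qed.

Lemma cderiv_const (c z : C) : cderiv (fun _ => c) z 0.
Proof.
  intros eps Heps. exists 1. split; [lra|]. intros w _.
  replace (c - c - 0 * (w - z))%C with (RtoC 0) by ring. rewrite Cmod_0.
  generalize (Cmod_ge_0 (w - z)). nra.
Qed.

Lemma cderiv_id (z : C) : cderiv (fun w => w) z 1.
Proof.
  intros eps Heps. exists 1. split; [lra|]. intros w _.
  replace (w - z - 1 * (w - z))%C with (RtoC 0) by ring. rewrite Cmod_0.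
  generalize (Cmod_ge_0 (w - z)). nra.
Qed.

Lemma cderiv_plus f g z d e :
  cderiv f z d -> cderiv g z e -> cderiv (fun w => f w + g w)%C z (d + e).
Proof.
  intros Hf%is_derive_cderiv Hg%is_derive_cderiv. apply is_derive_cderiv.
  now apply (is_derive_plus (K := C_AbsRing) (V := C_NormedModule) f g).
Qed.

Lemma cderiv_minus f g z d e :
  cderiv f z d -> cderiv g z e -> cderiv (fun w => f w - g w)%C z (d - e).
Proof.
  intros Hf%is_derive_cderiv Hg%is_derive_cderiv. apply is_derive_cderiv.
  now apply (is_derive_minus (K := C_AbsRing) (V := C_NormedModule) f g).
Qed.

Lemma cderiv_mult f g z d e :
  cderiv f z d -> cderiv g z e -> cderiv (fun w => f w * g w)%C z (d * g z + f z * e).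
Proof.
  intros Hf%is_derive_ring_cderiv Hg%is_derive_ring_cderiv. apply is_derive_ring_cderiv.
  apply (is_derive_mult (K := C_AbsRing) f g); [exact Hf | exact Hg | exact Cmult_comm].
Qed.

Lemma cderiv_scal (c : C) f z d : cderiv f z d -> cderiv (fun w => c * f w)%C z (c * d).
Proof.
  intros H. replace (c * d)%C with (0 * f z + c * d)%C by ring.
  apply (cderiv_mult (fun _ => c) f); [apply cderiv_const | exact H].
Qed.

Lemma cderiv_comp f g z d e :
  cderiv f z d -> cderiv g (f z) e -> cderiv (fun w => g (f w)) z (e * d).
Proof.
  intros Hf%is_derive_ring_cderiv Hg%is_derive_cderiv. apply is_derive_cderiv.
  rewrite Cmult_comm. apply (is_derive_comp (K := C_AbsRing) (V := C_NormedModule) g f); assumption.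
Qed.

Lemma C_sub_neq_0 (x y : C) : x <> y -> (x - y)%C <> 0.
Proof. intros H E. apply H. replace x with ((x - y) + y)%C by ring. rewrite E. ring. Qed.

Lemma cderiv_Cinv (z : C) : z <> 0 -> cderiv Cinv z (- / (z * z)).
Proof.
  intros Hz eps Heps.
  assert (Hm : 0 < Cmod z) by now apply Cmod_gt_0.
  set (m := Cmod z) in *.
  (* The remainder is (w - z)^2 / (z^2 w). The first radius gives |w| > m/2, and then the second
     gives |w - z| <= eps m^2 |w|. *)
  exists (Rmin (m / 2) (eps * m * m * m / 2)). split.
  { apply Rmin_glb_lt; [lra|]. repeat apply Rmult_lt_0_compat; lra. }
  intros w Hw.
  destruct (Rlt_Rmin _ _ _ Hw) as [A1 A2].
  assert (Hw2 : m / 2 < Cmod w).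
  { rewrite Cmod_sub_sym in A1. generalize (Cmod_sub_rev z w). fold m. lra. }
  assert (Hw0 : w <> 0) by (apply Cmod_gt_0; lra).
  replace (/ w - / z - - / (z * z) * (w - z))%C
    with ((w - z) * ((w - z) * / (z * z * w)))%C by (field; auto).
  rewrite !Cmod_mult, Cmod_inv, !Cmod_mult by (repeat apply Cmult_neq_0; auto). fold m.
  rewrite Rmult_comm. apply Rmult_le_compat_r; [apply Cmod_ge_0|].
  apply Rle_trans with ((eps * m * m * m / 2) * / (m * m * Cmod w)).
  { apply Rmult_le_compat_r; [|lra].
    left. apply Rinv_0_lt_compat. repeat apply Rmult_lt_0_compat; lra. }
  apply Rmult_le_reg_r with (m * m * Cmod w); [repeat apply Rmult_lt_0_compat; lra|].
  rewrite Rmult_assoc, Rinv_l by (apply Rgt_not_eq; repeat apply Rmult_lt_0_compat; lra).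
  assert (0 < eps * m * m) by (repeat apply Rmult_lt_0_compat; lra). nra.
Qed.

Lemma cderiv_inv f z d :
  cderiv f z d -> f z <> 0 -> cderiv (fun w => / f w)%C z (- / (f z * f z) * d).
Proof. intros H Hz. apply (cderiv_comp f Cinv); [exact H | now apply cderiv_Cinv]. Qed.

Lemma cderiv_pow f z d (n : nat) :
  cderiv f z d -> exists e, cderiv (fun w => f w ^ n)%C z e.
Proof.
  intros H. induction n as [|n [e IH]].
  - exists (RtoC 0). apply (cderiv_const 1).
  - eexists. apply (cderiv_mult f (fun w => f w ^ n)%C); eassumption.
Qed.

Lemma ccont_minus f g z : ccont f z -> ccont g z -> ccont (fun w => f w - g w)%C z.
Proof.
  intros Hf%continuous_ccont Hg%continuous_ccont. apply continuous_ccont.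
  now apply (continuous_minus (U := AbsRing_UniformSpace C_AbsRing) (V := AbsRing_NormedModule C_AbsRing) f g).
Qed.

Lemma ccont_mult f g z : ccont f z -> ccont g z -> ccont (fun w => f w * g w)%C z.
Proof.
  intros Hf%continuous_ccont Hg%continuous_ccont. apply continuous_ccont.
  now apply (continuous_mult (U := AbsRing_UniformSpace C_AbsRing) (K := C_AbsRing) f g).
Qed.

Lemma ccont_const (c z : C) : ccont (fun _ => c) z.
Proof. eapply cderiv_ccont, cderiv_const. Qed.

(** * Integrals of complex functions of a real variable *)

Definition RIntC (f : R -> C) (a b : R) : C := RInt (V := C_R_CompleteNormedModule) f a b.

Notation ccurve f := (continuous (T := R_UniformSpace) (U := C_R_NormedModule) f).
Notation ex_RIntC f a b := (ex_RInt (V := C_R_NormedModule) f a b).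

Lemma ccurve_line (f : C -> C) (z v : C) (t : R) :
  ccont f (z + t * v) -> ccurve (fun t : R => f (z + RtoC t * v)%C) t.
Proof.
  intros H. apply filterlim_locally. intros eps.
  destruct (H (eps / 2)) as [del [Hdel Hd]]; [generalize (cond_pos eps); lra|].
  pose proof (Cmod_ge_0 v) as Mv.
  (* Dividing by 1 + |v| instead of |v| allows v = 0. *)
  assert (Hp : 0 < del / (1 + Cmod v)) by (apply Rdiv_lt_0_compat; lra).
  exists (mkposreal _ Hp). intros u Hu.
  change (Rabs (u - t) < del / (1 + Cmod v)) in Hu.
  apply C_NormedModule_mixin_compat1.
  apply Rle_lt_trans with (eps / 2); [|generalize (cond_pos eps); lra].
  apply Hd.
  replace (z + u * v - (z + t * v))%C with (RtoC (u - t) * v)%C by (rewrite RtoC_minus; ring).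
  rewrite Cmod_mult, Cmod_R.
  apply Rle_lt_trans with (Rabs (u - t) * (1 + Cmod v)).
  - apply Rmult_le_compat_l; [apply Rabs_pos | lra].
  - apply Rlt_le_trans with (del / (1 + Cmod v) * (1 + Cmod v)).
    + apply Rmult_lt_compat_r; lra.
    + right. field. lra.
Qed.

Lemma RtoC_pair (x y : R) : (x, y) = (RtoC x + RtoC y * Ci)%C.
Proof. unfold RtoC, Ci, Cplus, Cmult. simpl. f_equal; ring. Qed.

Lemma horizontal_line (t y : R) : ((0, y) + t * 1)%C = (t, y).
Proof. unfold Cplus, Cmult, RtoC; simpl. f_equal; ring. Qed.

Lemma vertical_line (x t : R) : ((x, 0) + t * Ci)%C = (x, t).
Proof. unfold Cplus, Cmult, RtoC, Ci; simpl. f_equal; ring. Qed.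

Lemma ccurve_h (f : C -> C) (x y : R) : ccont f (x, y) -> ccurve (fun t : R => f (t, y)) x.
Proof.
  intros H. apply (continuous_ext (fun t : R => f ((0, y) + RtoC t * 1)%C)).
  - intros t. now rewrite horizontal_line.
  - apply ccurve_line. now rewrite horizontal_line.
Qed.

Lemma ccurve_v (f : C -> C) (x y : R) : ccont f (x, y) -> ccurve (fun t : R => f (x, t)) y.
Proof.
  intros H. apply (continuous_ext (fun t : R => f ((x, 0) + RtoC t * Ci)%C)).
  - intros t. now rewrite vertical_line.
  - apply ccurve_line. now rewrite vertical_line.
Qed.

Lemma cderiv_line (f : C -> C) (z v d : C) (t : R) :
  cderiv f (z + t * v) d ->
  is_derive (K := R_AbsRing) (V := C_R_NormedModule) (fun t : R => f (z + RtoC t * v)%C) t (d * v)%C.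
Proof.
  intros H. split.
  - apply (is_linear_scal_l (K := R_AbsRing) (V := C_R_NormedModule)).
  - intros u Hu eps.
    apply (is_filter_lim_locally_unique (K := R_AbsRing) (V := R_NormedModule)) in Hu. subst u.
    pose proof (Cmod_ge_0 v) as Mv.
    assert (He : 0 < eps / (1 + Cmod v)) by (apply Rdiv_lt_0_compat; [apply cond_pos | lra]).
    destruct (H _ He) as [del [Hdel Hd]].
    assert (Hp : 0 < del / (1 + Cmod v)) by (apply Rdiv_lt_0_compat; lra).
    exists (mkposreal _ Hp). intros u Hu.
    change (Rabs (u - t) < del / (1 + Cmod v)) in Hu.
    change (norm (minus u t)) with (Rabs (u - t)).
    match goal with |- norm ?X <= _ =>
      replace (norm X) with (Cmod X) by apply Cmod_norm end.
    assert (Es : scal (K := R_AbsRing) (V := C_R_NormedModule) (minus u t) (d * v)%C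
      = (RtoC (u - t) * (d * v))%C).
    { unfold scal, minus; simpl. unfold prod_scal, scal, plus, opp; simpl.
      unfold mult; simpl. unfold Cmult, RtoC; simpl. f_equal; ring. }
    match goal with |- Cmod ?X <= _ => replace X
      with (f (z + u * v) - f (z + t * v) - d * ((z + u * v) - (z + t * v)))%C end.
    2:{ transitivity (f (z + u * v) - f (z + t * v) - RtoC (u - t) * (d * v))%C.
        - rewrite RtoC_minus. ring.
        - rewrite <- Es. reflexivity. }
    assert (Q : Cmod ((z + u * v) - (z + t * v)) <= Rabs (u - t) * (1 + Cmod v)).
    { replace (z + u * v - (z + t * v))%C with (RtoC (u - t) * v)%C by (rewrite RtoC_minus; ring).
      rewrite Cmod_mult, Cmod_R. apply Rmult_le_compat_l; [apply Rabs_pos | lra]. }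
    eapply Rle_trans; [apply Hd|].
    + eapply Rle_lt_trans; [apply Q|].
      apply Rlt_le_trans with (del / (1 + Cmod v) * (1 + Cmod v)).
      * apply Rmult_lt_compat_r; lra.
      * right. field. lra.
    + apply Rle_trans with (eps / (1 + Cmod v) * (Rabs (u - t) * (1 + Cmod v))).
      * apply Rmult_le_compat_l; lra.
      * right. field. lra.
Qed.

Lemma RIntC_unique (f : R -> C) (a b : R) (l : C) :
  is_RInt (V := C_R_NormedModule) f a b l -> RIntC f a b = l.
Proof. apply (is_RInt_unique (V := C_R_CompleteNormedModule)). Qed.

Lemma RIntC_correct (f : R -> C) (a b : R) :
  ex_RIntC f a b -> is_RInt (V := C_R_NormedModule) f a b (RIntC f a b).
Proof. apply (RInt_correct (V := C_R_CompleteNormedModule)). Qed.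

Lemma ex_RIntC_ccurve (f : R -> C) (a b : R) :
  a <= b -> (forall t, a <= t <= b -> ccurve f t) -> ex_RIntC f a b.
Proof.
  intros Hab H. apply (ex_RInt_continuous (V := C_R_CompleteNormedModule)).
  rewrite Rmin_left, Rmax_right by lra. exact H.
Qed.

Lemma RIntC_plus (f g : R -> C) (a b : R) : ex_RIntC f a b -> ex_RIntC g a b ->
  RIntC (fun t => f t + g t)%C a b = (RIntC f a b + RIntC g a b)%C.
Proof.
  intros Hf Hg. apply RIntC_unique.
  apply (is_RInt_plus (V := C_R_NormedModule)); now apply RIntC_correct.
Qed.

(** The integral is taken in C as a real normed module, which only knows real scalars, so a complex
    factor is treated on components. *)
Lemma is_RIntC_scal (f : R -> C) (c : C) (a b : R) (l : C) :
  is_RInt (V := C_R_NormedModule) f a b l ->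
  is_RInt (V := C_R_NormedModule) (fun t => c * f t)%C a b (c * l)%C.
Proof.
  intros H.
  pose proof (is_RInt_fct_extend_fst (U := R_NormedModule) (V := R_NormedModule) f a b l H) as H1.
  pose proof (is_RInt_fct_extend_snd (U := R_NormedModule) (V := R_NormedModule) f a b l H) as H2.
  apply (is_RInt_fct_extend_pair (U := R_NormedModule) (V := R_NormedModule)
           (fun t => c * f t)%C a b); simpl.
  - apply (is_RInt_minus (V := R_NormedModule)); now apply (is_RInt_scal (V := R_NormedModule)).
  - apply (is_RInt_plus (V := R_NormedModule)); now apply (is_RInt_scal (V := R_NormedModule)).
Qed.

Lemma RIntC_scal (f : R -> C) (c : C) (a b : R) : ex_RIntC f a b ->
  RIntC (fun t => c * f t)%C a b = (c * RIntC f a b)%C.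
Proof. intros Hf. now apply RIntC_unique, is_RIntC_scal, RIntC_correct. Qed.

Lemma RIntC_Chasles (f : R -> C) (a b c : R) : ex_RIntC f a b -> ex_RIntC f b c ->
  (RIntC f a b + RIntC f b c)%C = RIntC f a c.
Proof.
  intros H1 H2. symmetry. apply RIntC_unique.
  apply (is_RInt_Chasles (V := C_R_NormedModule) f a b c); now apply RIntC_correct.
Qed.

Lemma RIntC_norm (f : R -> C) (a b M : R) : a <= b -> ex_RIntC f a b ->
  (forall t, a <= t <= b -> Cmod (f t) <= M) -> Cmod (RIntC f a b) <= M * (b - a).
Proof.
  intros Hab Hf HM. rewrite Cmod_norm, Rmult_comm.
  apply (norm_RInt_le_const (V := C_R_NormedModule) f a b); [exact Hab | | now apply RIntC_correct].
  intros t Ht. change (norm (f t)) with (norm (K := R_AbsRing) (V := C_R_NormedModule) (f t)).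
  eapply Rle_trans; [right; symmetry; apply Cmod_norm | auto].
Qed.

Lemma RIntC_ext (f g : R -> C) (a b : R) : a <= b ->
  (forall t, a <= t <= b -> f t = g t) -> RIntC f a b = RIntC g a b.
Proof.
  intros Hab H. apply (RInt_ext (V := C_R_CompleteNormedModule)).
  intros t. rewrite Rmin_left, Rmax_right by lra. intros Ht. apply H. lra.
Qed.

Lemma RIntC_im (f : R -> C) (a b : R) : ex_RIntC f a b ->
  is_RInt (V := R_NormedModule) (fun t => Im (f t)) a b (Im (RIntC f a b)).
Proof.
  intros H.
  apply (is_RInt_fct_extend_snd (U := R_NormedModule) (V := R_NormedModule) f a b).
  now apply RIntC_correct.
Qed.

(** * Contour integrals over rectangles *)

Definition bdry (a b c d : R) (z : C) : Prop :=
  (a <= Re z <= b /\ (Im z = c \/ Im z = d)) \/ ((Re z = a \/ Re z = b) /\ c <= Im z <= d).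

Definition rect (a b c d : R) (z : C) : Prop := a <= Re z <= b /\ c <= Im z <= d.

(** The counterclockwise contour integral over the boundary of [a, b] x [c, d]; the factor [Ci] is
    dz = i dt on the vertical sides. *)
Definition rint (a b c d : R) (f : C -> C) : C :=
  (RIntC (fun t => f (t, c)) a b - RIntC (fun t => f (t, d)) a b
   + Ci * (RIntC (fun t => f (b, t)) c d - RIntC (fun t => f (a, t)) c d))%C.

Section RectangleIntegral.
Variables (a b c d : R).
Hypotheses (Hab : a <= b) (Hcd : c <= d).

Lemma bdry_rect z : bdry a b c d z -> rect a b c d z.
Proof. unfold bdry, rect. intuition lra. Qed.

Lemma sides_ex (f : C -> C) : (forall z, bdry a b c d z -> ccont f z) ->
  ex_RIntC (fun t => f (t, c)) a b /\ ex_RIntC (fun t => f (t, d)) a b /\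
  ex_RIntC (fun t => f (b, t)) c d /\ ex_RIntC (fun t => f (a, t)) c d.
Proof.
  intros H. repeat split; apply ex_RIntC_ccurve; auto; intros t Ht;
    (apply ccurve_h || apply ccurve_v); apply H; unfold bdry; simpl; intuition lra.
Qed.

Lemma rint_plus f g :
  (forall z, bdry a b c d z -> ccont f z) -> (forall z, bdry a b c d z -> ccont g z) ->
  rint a b c d (fun z => f z + g z)%C = (rint a b c d f + rint a b c d g)%C.
Proof.
  intros Hf%sides_ex Hg%sides_ex. unfold rint.
  rewrite !RIntC_plus by intuition. ring.
Qed.

Lemma rint_scal f (k : C) :
  (forall z, bdry a b c d z -> ccont f z) ->
  rint a b c d (fun z => k * f z)%C = (k * rint a b c d f)%C.
Proof.
  intros Hf%sides_ex. unfold rint.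
  rewrite !RIntC_scal by intuition. ring.
Qed.

Lemma rint_ext f g :
  (forall z, bdry a b c d z -> f z = g z) -> rint a b c d f = rint a b c d g.
Proof.
  intros H. unfold rint.
  rewrite (RIntC_ext (fun t => f (t, c)) (fun t => g (t, c)) a b),
    (RIntC_ext (fun t => f (t, d)) (fun t => g (t, d)) a b),
    (RIntC_ext (fun t => f (a, t)) (fun t => g (a, t)) c d),
    (RIntC_ext (fun t => f (b, t)) (fun t => g (b, t)) c d); auto;
  intros t Ht; apply H; unfold bdry; simpl; intuition lra.
Qed.

Lemma rint_minus f g :
  (forall z, bdry a b c d z -> ccont f z) -> (forall z, bdry a b c d z -> ccont g z) ->
  rint a b c d (fun z => f z - g z)%C = (rint a b c d f - rint a b c d g)%C.
Proof.
  intros Hf Hg.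
  rewrite (rint_ext _ (fun z => f z + (- (1)) * g z)%C) by (intros; ring).
  rewrite rint_plus, rint_scal; auto; [ring|].
  intros z Hz. apply ccont_mult; [apply ccont_const | auto].
Qed.

Lemma rint_norm f (M : R) :
  (forall z, bdry a b c d z -> ccont f z) -> (forall z, bdry a b c d z -> Cmod (f z) <= M) ->
  Cmod (rint a b c d f) <= M * (2 * (b - a + (d - c))).
Proof.
  intros Hf%sides_ex HM. unfold rint.
  eapply Rle_trans; [apply Cmod_triangle|]. rewrite Cmod_mult, Cmod_Ci, Rmult_1_l.
  pose proof (Cmod_triangle_sub (RIntC (fun t => f (t, c)) a b) (RIntC (fun t => f (t, d)) a b)).
  pose proof (Cmod_triangle_sub (RIntC (fun t => f (b, t)) c d) (RIntC (fun t => f (a, t)) c d)).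
  assert (Cmod (RIntC (fun t => f (t, c)) a b) <= M * (b - a) /\
    Cmod (RIntC (fun t => f (t, d)) a b) <= M * (b - a) /\
    Cmod (RIntC (fun t => f (b, t)) c d) <= M * (d - c) /\
    Cmod (RIntC (fun t => f (a, t)) c d) <= M * (d - c)); [|lra].
  repeat split; apply RIntC_norm; intuition; apply HM; unfold bdry; simpl; intuition lra.
Qed.

Lemma RIntC_FTC_h (F f : C -> C) (y : R) :
  (forall t, a <= t <= b -> cderiv F (t, y) (f (t, y))) ->
  (forall t, a <= t <= b -> ccont f (t, y)) ->
  RIntC (fun t => f (t, y)) a b = (F (b, y) - F (a, y))%C.
Proof.
  intros HF Hf. apply RIntC_unique.
  apply (is_RInt_derive (V := C_R_CompleteNormedModule) (fun t => F (t, y)) (fun t => f (t, y)) a b);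
  rewrite Rmin_left, Rmax_right by lra; intros t Ht.
  - apply (is_derive_ext (fun t : R => F ((0, y) + RtoC t * 1)%C)).
    { intros u. now rewrite horizontal_line. }
    replace (f (t, y)) with (f (t, y) * 1)%C by ring.
    apply cderiv_line. rewrite horizontal_line. auto.
  - apply ccurve_h. auto.
Qed.

Lemma RIntC_FTC_v (F f : C -> C) (x : R) :
  (forall t, c <= t <= d -> cderiv F (x, t) (f (x, t))) ->
  (forall t, c <= t <= d -> ccont f (x, t)) ->
  (Ci * RIntC (fun t => f (x, t)) c d)%C = (F (x, d) - F (x, c))%C.
Proof.
  intros HF Hf. rewrite <- RIntC_scal.
  2:{ apply ex_RIntC_ccurve; [auto|]. intros t Ht. apply ccurve_v. auto. }
  apply RIntC_unique.
  apply (is_RInt_derive (V := C_R_CompleteNormedModule) (fun t => F (x, t)) (fun t => Ci * f (x, t))%C c d);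
  rewrite Rmin_left, Rmax_right by lra; intros t Ht.
  - apply (is_derive_ext (fun t : R => F ((x, 0) + RtoC t * Ci)%C)).
    { intros u. now rewrite vertical_line. }
    replace (Ci * f (x, t))%C with (f (x, t) * Ci)%C by ring.
    apply cderiv_line. rewrite vertical_line. auto.
  - apply (ccurve_v (fun z => Ci * f z)%C). apply ccont_mult; [apply ccont_const | auto].
Qed.

(** Each side gives a difference of values of F at two corners, and every corner occurs once with
    each sign. *)
Lemma rint_FTC (F f : C -> C) :
  (forall z, bdry a b c d z -> cderiv F z (f z)) ->
  (forall z, bdry a b c d z -> ccont f z) -> rint a b c d f = 0.
Proof.
  intros HF Hf. unfold rint.
  replace (Ci * (RIntC (fun t => f (b, t)) c d - RIntC (fun t => f (a, t)) c d))%C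
    with (Ci * RIntC (fun t => f (b, t)) c d - Ci * RIntC (fun t => f (a, t)) c d)%C by ring.
  rewrite (RIntC_FTC_h F f c), (RIntC_FTC_h F f d), (RIntC_FTC_v F f b), (RIntC_FTC_v F f a).
  { ring. }
  all: intros t Ht; first [apply HF | apply Hf]; unfold bdry; simpl; intuition lra.
Qed.

End RectangleIntegral.

Lemma rint_split_h (a m b c d : R) f : a <= m <= b -> c <= d ->
  (forall z, rect a b c d z -> ccont f z) ->
  rint a b c d f = (rint a m c d f + rint m b c d f)%C.
Proof.
  intros Hm Hcd Hf. unfold rint.
  rewrite <- (RIntC_Chasles (fun t => f (t, c)) a m b), <- (RIntC_Chasles (fun t => f (t, d)) a m b).
  { ring. }
  all: apply ex_RIntC_ccurve; [lra|]; intros t Ht; apply ccurve_h, Hf; unfold rect; simpl; lra.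
Qed.

Lemma rint_split_v (a b c m d : R) f : a <= b -> c <= m <= d ->
  (forall z, rect a b c d z -> ccont f z) ->
  rint a b c d f = (rint a b c m f + rint a b m d f)%C.
Proof.
  intros Hab Hm Hf. unfold rint.
  rewrite <- (RIntC_Chasles (fun t => f (a, t)) c m d), <- (RIntC_Chasles (fun t => f (b, t)) c m d).
  { ring. }
  all: apply ex_RIntC_ccurve; [lra|]; intros t Ht; apply ccurve_v, Hf; unfold rect; simpl; lra.
Qed.

Definition differentiable_on_rect (f : C -> C) (a b c d : R) : Prop :=
  forall z, rect a b c d z -> exists l, cderiv f z l.

Lemma differentiable_ccont f a b c d z : differentiable_on_rect f a b c d -> rect a b c d z -> ccont f z.
Proof. intros H [l Hl]%H. eapply cderiv_ccont, Hl. Qed.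

Lemma differentiable_ccont_bdry f a b c d : a <= b -> c <= d -> differentiable_on_rect f a b c d ->
  forall z, bdry a b c d z -> ccont f z.
Proof. intros Hab Hcd H z Hz. apply (differentiable_ccont f a b c d); auto. now apply bdry_rect. Qed.

(** * Goursat's theorem and Cauchy's formula on rectangles *)

(** Runs the bisection in Goursat's theorem: P is the invariant of the k-th rectangle and Q relates
    it to the next one. The invariant travels in the subtype, so that each choice may use it. *)
Lemma dependent_choice_seq (X : Type) (P : nat -> X -> Prop) (Q : nat -> X -> X -> Prop) (x0 : X) :
  P O x0 -> (forall k x, P k x -> exists y, P (S k) y /\ Q k x y) ->
  exists u : nat -> X, forall k, P k (u k) /\ Q k (u k) (u (S k)).
Proof.
  intros H0 H.
  pose (next := fun k (t : {x | P k x}) =>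
    let (y, Hy) := constructive_indefinite_description _ (H k (proj1_sig t) (proj2_sig t)) in
    exist (fun y => P (S k) y) y (proj1 Hy)).
  pose (v := fix v k : {x | P k x} :=
    match k with O => exist _ x0 H0 | S k => next k (v k) end).
  exists (fun k => proj1_sig (v k)). intros k. split; [apply proj2_sig|].
  simpl. unfold next at 1.
  destruct (constructive_indefinite_description _ _) as [y [H1 H2]]. exact H2.
Qed.

Lemma half_pow_pos (k : nat) : 0 < (/ 2) ^ k.
Proof. apply pow_lt. lra. Qed.

Lemma goursat_affine (k l p : C) (a b c d : R) : a <= b -> c <= d ->
  rint a b c d (fun z => k + l * (z - p))%C = 0.
Proof.
  intros Hab Hcd.
  assert (D : forall z, cderiv (fun z => k + l * (z - p))%C z (0 + l * (1 - 0))).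
  { intros z. apply cderiv_plus; [apply cderiv_const|]. apply cderiv_scal.
    apply cderiv_minus; [apply cderiv_id | apply cderiv_const]. }
  apply (rint_FTC a b c d Hab Hcd
    (fun z => k * z + l * / 2 * ((z - p) * (z - p)))%C).
  - intros z _.
    replace (k + l * (z - p))%C
      with (k * 1 + l * / 2 * ((1 - 0) * (z - p) + (z - p) * (1 - 0)))%C.
    2:{ field. }
    apply cderiv_plus; apply cderiv_scal; [apply cderiv_id|].
    apply (cderiv_mult (fun z => z - p)%C (fun z => z - p)%C); (apply cderiv_minus; [apply cderiv_id | apply cderiv_const]).
  - intros z _. eapply cderiv_ccont. apply D.
Qed.

(** The affine part of f integrates to 0. The rest is at most eps times the half-perimeter, which
    bounds |z - p|, on a contour of twice that length. *)
Lemma rint_local_bound (f : C -> C) (p l : C) (a b c d eps : R) : a <= b -> c <= d ->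
  rect a b c d p ->
  (forall z, rect a b c d z -> ccont f z) ->
  (forall z, rect a b c d z -> Cmod (f z - f p - l * (z - p)) <= eps * Cmod (z - p)) ->
  0 <= eps ->
  Cmod (rint a b c d f) <= 2 * eps * (b - a + (d - c)) ^ 2.
Proof.
  intros Hab Hcd [[Hp1 Hp2] [Hp3 Hp4]] Hf He Heps.
  set (S := b - a + (d - c)).
  pose (r := fun z => (f z - (f p + l * (z - p)))%C).
  assert (Caff : forall z, ccont (fun z => f p + l * (z - p))%C z).
  { intros z. eapply cderiv_ccont. apply cderiv_plus; [apply cderiv_const|].
    apply cderiv_scal. apply cderiv_minus; [apply cderiv_id | apply cderiv_const]. }
  assert (E : rint a b c d f = rint a b c d r).
  { unfold r. rewrite rint_minus; auto.
    - rewrite goursat_affine by auto. ring.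
    - intros z Hz. apply Hf. now apply bdry_rect. }
  rewrite E.
  replace (2 * eps * S ^ 2) with (eps * S * (2 * S)) by ring.
  apply rint_norm; auto.
  - intros z Hz. apply ccont_minus; [|apply Caff]. apply Hf. now apply bdry_rect.
  - intros z Hz. apply bdry_rect in Hz; [|lra|lra]. unfold r.
    replace (f z - (f p + l * (z - p)))%C with (f z - f p - l * (z - p))%C by ring.
    eapply Rle_trans; [now apply He|]. apply Rmult_le_compat_l; [auto|].
    destruct z as [x y], p as [p q]. destruct Hz as [Hx Hy]. simpl in *.
    eapply Rle_trans; [apply Cmod_le_abs_sum|]. simpl.
    assert (Rabs (x + - p) <= b - a) by (apply Rabs_le; lra).
    assert (Rabs (y + - q) <= d - c) by (apply Rabs_le; lra).
    unfold S. lra.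
Qed.

Lemma Cmod_sum4 (m : R) (z1 z2 z3 z4 : C) : 4 * m <= Cmod (z1 + z2 + (z3 + z4)) ->
  m <= Cmod z1 \/ m <= Cmod z2 \/ m <= Cmod z3 \/ m <= Cmod z4.
Proof.
  intros H. pose proof (Cmod_triangle (z1 + z2) (z3 + z4)).
  pose proof (Cmod_triangle z1 z2). pose proof (Cmod_triangle z3 z4).
  destruct (Rle_dec m (Cmod z1)); [auto|]. destruct (Rle_dec m (Cmod z2)); [auto|].
  destruct (Rle_dec m (Cmod z3)); [auto|]. right. right. right. lra.
Qed.

Lemma goursat (f : C -> C) (a b c d : R) : a <= b -> c <= d ->
  differentiable_on_rect f a b c d -> rint a b c d f = 0.
Proof.
  intros Hab Hcd Hf.
  pose proof (fun z => differentiable_ccont f a b c d z Hf) as Cf.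
  destruct (excluded_middle_informative (rint a b c d f = 0)) as [|Hne]; [assumption|exfalso].
  apply Cmod_gt_0 in Hne. set (m := Cmod (rint a b c d f)) in *.
  set (A := b - a). set (B := d - c).
  assert (HA : 0 <= A) by (unfold A; lra). assert (HB : 0 <= B) by (unfold B; lra).
  (* The pair is the lower left corner of a rectangle with sides A/2^k and B/2^k, whose integral
     keeps at least the share m/4^k. *)
  pose (P := fun k (p : R * R) => let (x, y) := p in
    a <= x /\ x + A * (/2)^k <= b /\ c <= y /\ y + B * (/2)^k <= d /\
    m * (/4)^k <= Cmod (rint x (x + A * (/2)^k) y (y + B * (/2)^k) f)).
  pose (Q := fun (k : nat) (p q : R * R) =>
    fst p <= fst q /\ fst q + A * (/2)^(S k) <= fst p + A * (/2)^k /\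
    snd p <= snd q /\ snd q + B * (/2)^(S k) <= snd p + B * (/2)^k).
  destruct (dependent_choice_seq _ P Q (a, c)) as [u Hu].
  { simpl. rewrite !Rmult_1_r. replace (a + A) with b by (unfold A; ring).
    replace (c + B) with d by (unfold B; ring). fold m. lra. }
  { intros k [x y] [Hx1 [Hx2 [Hy1 [Hy2 Hm]]]].
    pose proof (half_pow_pos (S k)) as Hh. set (h := (/2)^(S k)) in *.
    assert (Ek : (/2)^k = 2 * h) by (unfold h; simpl; field).
    assert (Em : m * (/4)^k = 4 * (m * (/4)^(S k))) by (simpl; field).
    set (m' := m * (/4)^(S k)) in *.
    assert (HAh : 0 <= A * h) by (apply Rmult_le_pos; lra).
    assert (HBh : 0 <= B * h) by (apply Rmult_le_pos; lra).
    rewrite Ek in *.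
    assert (E : rint x (x + A * (2 * h)) y (y + B * (2 * h)) f =
      (rint x (x + A * h) y (y + B * h) f
       + rint x (x + A * h) (y + B * h) (y + B * h + B * h) f
       + (rint (x + A * h) (x + A * h + A * h) y (y + B * h) f
       + rint (x + A * h) (x + A * h + A * h) (y + B * h) (y + B * h + B * h) f))%C).
    { replace (x + A * (2 * h)) with (x + A * h + A * h) in * by ring.
      replace (y + B * (2 * h)) with (y + B * h + B * h) in * by ring.
      rewrite (rint_split_h x (x + A * h)), (rint_split_v x _ y (y + B * h)),
        (rint_split_v (x + A * h) _ y (y + B * h)); try lra; try reflexivity;
      intros z Hz; apply Cf; destruct Hz; split; lra. }
    rewrite E in Hm.
    set (x' := x + A * h) in *. set (y' := y + B * h) in *.
    rewrite Em in Hm. apply Cmod_sum4 in Hm.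
    destruct Hm as [H1|[H1|[H1|H1]]];
    [exists (x, y) | exists (x, y') | exists (x', y) | exists (x', y')];
    unfold P, Q; cbv beta iota delta [fst snd]; rewrite Ek; fold h; fold m';
    unfold x', y' in *; repeat split; auto; lra. }
  (* Nested intervals, used once for each coordinate: the supremum of the left endpoints lies in all
     of them. *)
  assert (N : forall (v : nat -> R) (L : R), 0 <= L ->
    (forall k, v k <= v (S k) /\ v (S k) + L * (/2)^(S k) <= v k + L * (/2)^k) ->
    exists p, forall k, v k <= p <= v k + L * (/2)^k).
  { intros v L HL Hv.
    assert (I : forall k j, v k <= v (k + j)%nat /\
      v (k + j)%nat + L * (/2)^(k + j) <= v k + L * (/2)^k).
    { intros k j. induction j as [|j IH].
      - rewrite Nat.add_0_r. lra.
      - rewrite Nat.add_succ_r. specialize (Hv (k + j)%nat). lra. }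
    assert (B1 : forall k j, v j <= v k + L * (/2)^k).
    { intros k j.
      assert (0 <= L * (/2)^k) by (apply Rmult_le_pos; [auto | left; apply half_pow_pos]).
      assert (0 <= L * (/2)^j) by (apply Rmult_le_pos; [auto | left; apply half_pow_pos]).
      destruct (Nat.le_ge_cases k j) as [Hle|Hle].
      - specialize (I k (j - k)%nat). replace (k + (j - k))%nat with j in I by lia. lra.
      - specialize (I j (k - j)%nat). replace (j + (k - j))%nat with k in I by lia. lra. }
    destruct (completeness (fun t => exists k, t = v k)) as [p [Hp1 Hp2]].
    { exists (v O + L * (/2)^O). intros t [k ->]. apply B1. }
    { exists (v O), O. reflexivity. }
    exists p. intros k. split.
    - apply Hp1. now exists k.
    - apply Hp2. intros t [j ->]. apply B1. }
  destruct (N (fun k => fst (u k)) A HA) as [p Hp].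
  { intros k. destruct (Hu k) as [_ [H1 [H2 _]]]. auto. }
  destruct (N (fun k => snd (u k)) B HB) as [q Hq].
  { intros k. destruct (Hu k) as [_ [_ [_ [H1 H2]]]]. auto. }
  clear N.
  assert (Hr : forall k, a <= fst (u k) /\ fst (u k) + A * (/2)^k <= b /\
     c <= snd (u k) /\ snd (u k) + B * (/2)^k <= d /\
     m * (/4)^k <= Cmod (rint (fst (u k)) (fst (u k) + A * (/2)^k) (snd (u k)) (snd (u k) + B * (/2)^k) f)).
  { intros k. destruct (Hu k) as [H _]. destruct (u k). exact H. }
  destruct (Hf (p, q)) as [l Hl].
  { generalize (Hr O) (Hp O) (Hq O). unfold rect; simpl. lra. }
  set (L := A + B).
  (* Chosen so that 2 eps L^2 < m, which contradicts m/4^k <= 2 eps L^2 / 4^k; the summand 1 covers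
     L = 0. *)
  set (eps := m / (4 * (L ^ 2 + 1))).
  assert (HL2 : 0 <= L ^ 2) by apply pow2_ge_0.
  assert (Heps : 0 < eps) by (apply Rdiv_lt_0_compat; lra).
  destruct (Hl eps Heps) as [del [Hdel Hd]].
  destruct (pow_lt_1_zero (/2)) with (y := del / (L + 1)) as [k Hk].
  { rewrite Rabs_pos_eq; lra. }
  { apply Rdiv_lt_0_compat; unfold L; lra. }
  specialize (Hk k (le_n k)). rewrite Rabs_pos_eq in Hk by (left; apply half_pow_pos).
  pose proof (half_pow_pos k) as Hh. set (h := (/2)^k) in *.
  specialize (Hr k). specialize (Hp k). specialize (Hq k). fold h in Hr, Hp, Hq.
  destruct Hr as [H1 [H2 [H3 [H4 H5]]]].
  assert (HLh : L * h < del).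
  { apply Rlt_le_trans with ((L + 1) * (del / (L + 1))).
    - apply Rle_lt_trans with ((L + 1) * h); [nra|]. apply Rmult_lt_compat_l; [unfold L; lra | exact Hk].
    - right. field. unfold L; lra. }
  assert (HAh : 0 <= A * h) by (apply Rmult_le_pos; lra).
  assert (HBh : 0 <= B * h) by (apply Rmult_le_pos; lra).
  set (x := fst (u k)) in *. set (y := snd (u k)) in *.
  assert (X : Cmod (rint x (x + A * h) y (y + B * h) f)
     <= 2 * eps * ((x + A * h) - x + ((y + B * h) - y)) ^ 2).
  { apply (rint_local_bound f (p, q) l); try lra.
    - unfold rect; simpl; lra.
    - intros z Hz. apply Cf. destruct Hz; split; lra.
    - intros z Hz. apply Hd.
      destruct z as [x1 y1]. destruct Hz as [Hz1 Hz2]. simpl in *.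
      eapply Rle_lt_trans; [apply Cmod_le_abs_sum|]. simpl.
      assert (Rabs (x1 + - p) <= A * h) by (apply Rabs_le; lra).
      assert (Rabs (y1 + - q) <= B * h) by (apply Rabs_le; lra).
      unfold L in HLh. lra. }
  replace (2 * eps * ((x + A * h) - x + ((y + B * h) - y)) ^ 2) with (2 * eps * L ^ 2 * (h * h)) in X
    by (unfold L; ring).
  assert (E4 : (/4)^k = h * h).
  { unfold h. rewrite <- Rpow_mult_distr. f_equal. lra. }
  rewrite E4 in H5.
  assert (Hhh : 0 < h * h) by (apply Rmult_lt_0_compat; auto).
  assert (2 * eps * L ^ 2 < m).
  { assert (eps * (4 * (L ^ 2 + 1)) = m) by (unfold eps; field; lra). nra. }
  nra.
Qed.

(** Cut out a square of half-side t about p. The four rectangles around it contribute 0, and the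
    square contributes at most 8 t M, where M bounds f near p; t is arbitrarily small. *)
Lemma goursat_punctured (f : C -> C) (a b c d : R) (p : C) :
  a < Re p < b -> c < Im p < d ->
  (forall z, rect a b c d z -> ccont f z) ->
  (forall z, rect a b c d z -> z <> p -> exists l, cderiv f z l) ->
  rint a b c d f = 0.
Proof.
  intros Hx Hy Cf Df. set (x := Re p) in *. set (y := Im p) in *.
  assert (Cp : ccont f p) by (apply Cf; unfold rect; fold x y; lra).
  destruct (Cp 1 Rlt_0_1) as [r [Hr Hb]].
  set (M := Cmod (f p) + 1).
  assert (HM : 0 < M) by (generalize (Cmod_ge_0 (f p)); unfold M; lra).
  assert (BM : forall z, Cmod (z - p) < r -> Cmod (f z) <= M).
  { intros z Hz. specialize (Hb z Hz). generalize (Cmod_sub_rev (f z) (f p)). unfold M. lra. }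
  assert (K : forall t, 0 < t -> t < x - a -> t < b - x -> t < y - c -> t < d - y -> 2 * t < r ->
    Cmod (rint a b c d f) <= M * (8 * t)).
  { intros t Ht H1 H2 H3 H4 H5.
    rewrite (rint_split_h a (x - t) b), (rint_split_h (x - t) (x + t) b),
     (rint_split_v (x - t) (x + t) c (y - t) d), (rint_split_v (x - t) (x + t) (y - t) (y + t) d);
     try lra; try (intros z Hz; apply Cf; destruct Hz; split; lra).
    rewrite (goursat f a (x - t)), (goursat f (x + t) b), (goursat f (x - t) (x + t) c (y - t)),
      (goursat f (x - t) (x + t) (y + t) d); try lra;
      try (intros z Hz; apply Df; [destruct Hz; split; lra |
        intros ->; destruct Hz as [G1 G2]; fold x in G1; fold y in G2; lra]).
    replace (0 + (0 + (rint (x - t) (x + t) (y - t) (y + t) f + 0) + 0))%C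
      with (rint (x - t) (x + t) (y - t) (y + t) f) by ring.
    match goal with |- Cmod ?X <= _ => replace X with (rint (x - t) (x + t) (y - t) (y + t) f) by ring end.
    replace (8 * t) with (2 * ((x + t) - (x - t) + ((y + t) - (y - t)))) by ring.
    apply rint_norm; try lra.
    - intros z Hz. apply bdry_rect in Hz; [|lra|lra]. apply Cf. destruct Hz; split; lra.
    - intros z Hz. apply bdry_rect in Hz; [|lra|lra]. apply BM.
      destruct z as [x1 y1], p as [px py]. destruct Hz as [G1 G2]. unfold x, y in *; simpl in *.
      eapply Rle_lt_trans; [apply Cmod_le_abs_sum|]. simpl.
      assert (Rabs (x1 + - px) <= t) by (apply Rabs_le; lra).
      assert (Rabs (y1 + - py) <= t) by (apply Rabs_le; lra).
      lra. }
  destruct (Req_dec (Cmod (rint a b c d f)) 0) as [E|E]; [now apply Cmod_eq_0|exfalso].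
  assert (Hm : 0 < Cmod (rint a b c d f)) by (generalize (Cmod_ge_0 (rint a b c d f)); lra).
  set (m := Cmod (rint a b c d f)) in *.
  (* The square fits into the rectangle and into the disc where M is a bound, and 8 t M <= m/2 <
     m. *)
  set (t := Rmin (Rmin (Rmin (x - a) (b - x)) (Rmin (y - c) (d - y))) (Rmin r (m / (4 * M))) / 4).
  assert (Hmm : 0 < m / (4 * M)) by (apply Rdiv_lt_0_compat; lra).
  assert (T : 0 < t /\ 4 * t <= x - a /\ 4 * t <= b - x /\ 4 * t <= y - c /\ 4 * t <= d - y /\
    4 * t <= r /\ 4 * t <= m / (4 * M)).
  { unfold t.
    generalize (Rmin_l (x - a) (b - x)) (Rmin_r (x - a) (b - x))
      (Rmin_l (y - c) (d - y)) (Rmin_r (y - c) (d - y)) (Rmin_l r (m / (4 * M))) (Rmin_r r (m / (4 * M)))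
      (Rmin_glb_lt (x - a) (b - x) 0) (Rmin_glb_lt (y - c) (d - y) 0) (Rmin_glb_lt r (m / (4 * M)) 0).
    set (u := Rmin (x - a) (b - x)). set (v := Rmin (y - c) (d - y)). set (w := Rmin r (m / (4 * M))).
    intros. generalize (Rmin_l u v) (Rmin_r u v) (Rmin_l (Rmin u v) w) (Rmin_r (Rmin u v) w)
      (Rmin_glb_lt u v 0) (Rmin_glb_lt (Rmin u v) w 0). lra. }
  assert (m <= M * (8 * t)) by (apply K; lra).
  assert (M * (4 * t) <= m / 4).
  { replace (m / 4) with (M * (m / (4 * M))) by (field; lra). apply Rmult_le_compat_l; lra. }
  lra.
Qed.

(** * Cauchy's formula and the maximum principle *)

Definition inside (a b c d : R) (z : C) : Prop := a < Re z < b /\ c < Im z < d.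

Lemma inside_le a b c d z : inside a b c d z -> a <= b /\ c <= d.
Proof. unfold inside. lra. Qed.

Lemma Re_sub_le (w z : C) : - Cmod (w - z) <= Re w - Re z <= Cmod (w - z).
Proof. apply Rabs_le_between. exact (re_le_Cmod (w - z)). Qed.

Lemma Im_sub_le (w z : C) : - Cmod (w - z) <= Im w - Im z <= Cmod (w - z).
Proof. apply Rabs_le_between. exact (im_le_Cmod (w - z)). Qed.

Lemma bdry_dist_ge a b c d z w r : bdry a b c d w ->
  r <= Re z - a -> r <= b - Re z -> r <= Im z - c -> r <= d - Im z -> r <= Cmod (w - z).
Proof.
  intros Hw H1 H2 H3 H4. pose proof (Re_sub_le w z). pose proof (Im_sub_le w z).
  destruct Hw as [[_ [E|E]]|[[E|E] _]]; rewrite E in *; lra.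
Qed.

Lemma inside_margin a b c d z : inside a b c d z ->
  exists r, 0 < r /\ r <= Re z - a /\ r <= b - Re z /\ r <= Im z - c /\ r <= d - Im z.
Proof.
  intros [[H1 H2] [H3 H4]].
  set (u := Rmin (Re z - a) (b - Re z)). set (v := Rmin (Im z - c) (d - Im z)).
  exists (Rmin u v). split; [repeat apply Rmin_glb_lt; lra|].
  generalize (Rmin_l (Re z - a) (b - Re z)) (Rmin_r (Re z - a) (b - Re z))
    (Rmin_l (Im z - c) (d - Im z)) (Rmin_r (Im z - c) (d - Im z)) (Rmin_l u v) (Rmin_r u v).
  fold u v. lra.
Qed.

Lemma inside_bdry_dist a b c d z : inside a b c d z ->
  exists r, 0 < r /\ forall w, bdry a b c d w -> r <= Cmod (w - z).
Proof.
  intros [r [Hr [H1 [H2 [H3 H4]]]]]%inside_margin.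
  exists r. split; [auto|]. intros w Hw. now apply (bdry_dist_ge a b c d).
Qed.

Lemma bdry_neq a b c d z w : inside a b c d z -> bdry a b c d w -> (w - z)%C <> 0.
Proof.
  intros Hz Hw. destruct (inside_bdry_dist _ _ _ _ _ Hz) as [r [Hr H]].
  apply Cmod_gt_0. specialize (H w Hw). lra.
Qed.

Lemma cderiv_Cinv_sub (z w : C) : (w - z)%C <> 0 ->
  cderiv (fun w => / (w - z))%C w (- / ((w - z) * (w - z)))%C.
Proof.
  intros H.
  replace (- / ((w - z) * (w - z)))%C with (- / ((w - z) * (w - z)) * (1 - 0))%C by ring.
  apply (cderiv_inv (fun w => w - z)%C); [|exact H].
  apply cderiv_minus; [apply cderiv_id | apply cderiv_const].
Qed.

Lemma ccont_Cinv_sub (z w : C) : (w - z)%C <> 0 -> ccont (fun w => / (w - z))%C w.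
Proof. intros H. eapply cderiv_ccont, cderiv_Cinv_sub, H. Qed.

Lemma RIntC_re (f : R -> C) (a b : R) : ex_RIntC f a b ->
  is_RInt (V := R_NormedModule) (fun t => Re (f t)) a b (Re (RIntC f a b)).
Proof.
  intros H.
  apply (is_RInt_fct_extend_fst (U := R_NormedModule) (V := R_NormedModule) f a b).
  now apply RIntC_correct.
Qed.

Lemma is_RInt_lower (g : R -> R) (a b l m : R) : a <= b -> is_RInt g a b l ->
  (forall t, a <= t <= b -> m <= g t) -> m * (b - a) <= l.
Proof.
  intros Hab Hg Hm.
  assert (Hc : is_RInt (fun _ => m) a b (scal (b - a) m)) by apply (is_RInt_const (V := R_NormedModule)).
  pose proof (is_RInt_le (fun _ => m) g a b _ _ Hab Hc Hg) as H.
  unfold scal in H; simpl in H; unfold mult in H; simpl in H.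
  rewrite Rmult_comm. apply H. intros t Ht. apply Hm. lra.
Qed.

Lemma is_RInt_upper (g : R -> R) (a b l m : R) : a <= b -> is_RInt g a b l ->
  (forall t, a <= t <= b -> g t <= m) -> l <= m * (b - a).
Proof.
  intros Hab Hg Hm. apply (is_RInt_opp (V := R_NormedModule)) in Hg.
  assert (H : - m * (b - a) <= - l); [|lra].
  apply (is_RInt_lower _ _ _ _ _ Hab Hg). intros t Ht. now apply Ropp_le_contravar, Hm.
Qed.

(** For z inside this is 2 pi i. Only a lower bound for its imaginary part and the vanishing of its
    derivative in z are ever used. *)
Definition cauchy_kernel (a b c d : R) (z : C) : C := rint a b c d (fun w => / (w - z))%C.

(** On each side the integrand contributes the distance of z to that side divided by |w - z|^2,
    which is at most the squared diagonal D. The distances to opposite sides add up to a side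
    length, so each pair of sides gives (b - a)(d - c)/D. *)
Lemma cauchy_kernel_im a b c d z : inside a b c d z ->
  2 * (b - a) * (d - c) / ((b - a) ^ 2 + (d - c) ^ 2) <= Im (cauchy_kernel a b c d z).
Proof.
  intros Hz.
  destruct (inside_le _ _ _ _ _ Hz) as [Hab Hcd].
  destruct (sides_ex a b c d Hab Hcd (fun w => / (w - z))%C) as [E1 [E2 [E3 E4]]].
  { intros w Hw. apply ccont_Cinv_sub. eapply bdry_neq; eauto. }
  unfold cauchy_kernel, rint.
  apply RIntC_im in E1, E2. apply RIntC_re in E3, E4.
  set (I1 := RIntC (fun t => / ((t, c) - z))%C a b) in *.
  set (I2 := RIntC (fun t => / ((t, d) - z))%C a b) in *.
  set (I3 := RIntC (fun t => / ((b, t) - z))%C c d) in *.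
  set (I4 := RIntC (fun t => / ((a, t) - z))%C c d) in *.
  clearbody I1 I2 I3 I4.
  replace (Im (I1 - I2 + Ci * (I3 - I4))) with (Im I1 - Im I2 + (Re I3 - Re I4)).
  2:{ destruct I1, I2, I3, I4. simpl. ring. }
  destruct z as [x y]. destruct Hz as [[Hx1 Hx2] [Hy1 Hy2]]. simpl in *.
  set (D := (b - a) ^ 2 + (d - c) ^ 2).
  assert (HD : 0 < D) by (unfold D; nra).
  assert (K : forall u v, Rabs u <= b - a -> Rabs v <= d - c -> (u <> 0 \/ v <> 0) ->
     / D <= / (u ^ 2 + v ^ 2)).
  { intros u v Hu Hv Hne.
    assert (Hp : 0 < u ^ 2 + v ^ 2).
    { pose proof (pow2_ge_0 u). pose proof (pow2_ge_0 v).
      destruct Hne as [Hn|Hn]; apply (pow_nonzero _ 2) in Hn; lra. }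
    apply Rinv_le_contravar; [auto|]. unfold D.
    apply Rplus_le_compat; rewrite <- Rsqr_pow2, <- Rsqr_pow2; apply Rsqr_le_abs_1;
    [rewrite (Rabs_pos_eq (b - a)) by lra | rewrite (Rabs_pos_eq (d - c)) by lra]; auto. }
  assert (L1 : (y - c) * / D * (b - a) <= Im I1).
  { eapply is_RInt_lower; [lra | apply E1|]. intros t Ht. simpl.
    replace (- (c + - y) / ((t + - x) * ((t + - x) * 1) + (c + - y) * ((c + - y) * 1)))
      with ((y - c) * / ((t - x) ^ 2 + (c - y) ^ 2)) by (unfold Rdiv; f_equal; ring).
    apply Rmult_le_compat_l; [lra|]. apply K; [apply Rabs_le; lra | apply Rabs_le; lra | lra]. }
  assert (L2 : Im I2 <= - ((d - y) * / D) * (b - a)).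
  { eapply is_RInt_upper; [lra | apply E2|]. intros t Ht. simpl.
    replace (- (d + - y) / ((t + - x) * ((t + - x) * 1) + (d + - y) * ((d + - y) * 1)))
      with (- ((d - y) * / ((t - x) ^ 2 + (d - y) ^ 2))).
    2:{ rewrite Ropp_mult_distr_l. unfold Rdiv; f_equal; ring. }
    apply Ropp_le_contravar.
    apply Rmult_le_compat_l; [lra|]. apply K; [apply Rabs_le; lra | apply Rabs_le; lra | lra]. }
  assert (L3 : (b - x) * / D * (d - c) <= Re I3).
  { eapply is_RInt_lower; [lra | apply E3|]. intros t Ht. simpl.
    replace ((b + - x) / ((b + - x) * ((b + - x) * 1) + (t + - y) * ((t + - y) * 1)))
      with ((b - x) * / ((b - x) ^ 2 + (t - y) ^ 2)) by reflexivity.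
    apply Rmult_le_compat_l; [lra|]. apply K; [apply Rabs_le; lra | apply Rabs_le; lra | lra]. }
  assert (L4 : Re I4 <= - ((x - a) * / D) * (d - c)).
  { eapply is_RInt_upper; [lra | apply E4|]. intros t Ht. simpl.
    replace ((a + - x) / ((a + - x) * ((a + - x) * 1) + (t + - y) * ((t + - y) * 1)))
      with (- ((x - a) * / ((a - x) ^ 2 + (t - y) ^ 2))).
    2:{ rewrite Ropp_mult_distr_l. unfold Rdiv; f_equal; ring. }
    apply Ropp_le_contravar.
    apply Rmult_le_compat_l; [lra|]. apply K; [apply Rabs_le; lra | apply Rabs_le; lra | lra]. }
  change (2 * (b - a) * (d - c) / D <= Im I1 - Im I2 + (Re I3 - Re I4)).
  replace (2 * (b - a) * (d - c) / D) with
   ((y - c) * / D * (b - a) - - ((d - y) * / D) * (b - a)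
    + ((b - x) * / D * (d - c) - - ((x - a) * / D) * (d - c))) by (field; lra).
  lra.
Qed.

Lemma cauchy_kernel_neq_0 a b c d z : inside a b c d z -> cauchy_kernel a b c d z <> 0.
Proof.
  intros Hz E. pose proof (cauchy_kernel_im _ _ _ _ _ Hz) as H.
  rewrite E in H. change (Im (RtoC 0)) with 0 in H. destruct Hz as [H1 H2].
  assert (0 < 2 * (b - a) * (d - c) / ((b - a) ^ 2 + (d - c) ^ 2)).
  { apply Rdiv_lt_0_compat; [repeat apply Rmult_lt_0_compat; lra|]. nra. }
  lra.
Qed.

(** The difference quotient of f at z, completed by the derivative, is continuous at z and
    differentiable elsewhere, so its contour integral vanishes by [goursat_punctured]. *)
Lemma cauchy_formula f a b c d z : inside a b c d z -> differentiable_on_rect f a b c d ->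
  rint a b c d (fun w => f w * / (w - z))%C = (f z * cauchy_kernel a b c d z)%C.
Proof.
  intros Hz Hf.
  destruct (inside_le _ _ _ _ _ Hz) as [Hab Hcd].
  assert (Rz : rect a b c d z) by (destruct Hz; split; lra).
  destruct (Hf z Rz) as [l Hl].
  pose (q := fun w => if excluded_middle_informative (w = z) then l
                      else ((f w - f z) * / (w - z))%C).
  assert (qz : q z = l) by (unfold q; now destruct (excluded_middle_informative (z = z))).
  assert (qE : forall w, w <> z -> q w = ((f w - f z) * / (w - z))%C).
  { intros w Hw. unfold q. now destruct (excluded_middle_informative (w = z)). }
  assert (qD : forall w, rect a b c d w -> w <> z -> exists k, cderiv q w k).
  { intros w Hw Hne. destruct (Hf w Hw) as [k Hk]. eexists.
    apply (cderiv_ext_near (fun w => (f w - f z) * / (w - z))%C).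
    - exists (Cmod (w - z)). split; [apply Cmod_gt_0, C_sub_neq_0, Hne|].
      intros u Hu. symmetry. apply qE. intros ->. rewrite Cmod_sub_sym in Hu. lra.
    - apply (cderiv_mult (fun w => f w - f z)%C (fun w => / (w - z))%C).
      + apply cderiv_minus; [exact Hk | apply cderiv_const].
      + apply cderiv_Cinv_sub, C_sub_neq_0, Hne. }
  assert (J0 : rint a b c d q = 0).
  { apply (goursat_punctured q a b c d z); [apply Hz | apply Hz | | exact qD].
    intros w Hw. destruct (excluded_middle_informative (w = z)) as [->|Hne].
    - intros eps Heps. destruct (Hl eps Heps) as [del [Hdel Hd]].
      exists del. split; [auto|]. intros w Hw'.
      rewrite qz.
      destruct (excluded_middle_informative (w = z)) as [->|Hne].
      + rewrite qz.
        replace (l - l)%C with (RtoC 0) by ring. rewrite Cmod_0. lra.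
      + rewrite qE by auto. specialize (Hd w Hw').
        assert (Hn : (w - z)%C <> 0) by now apply C_sub_neq_0.
        replace ((f w - f z) * / (w - z) - l)%C with ((f w - f z - l * (w - z)) * / (w - z))%C
          by (field; auto).
        assert (0 < Cmod (w - z)) by now apply Cmod_gt_0.
        rewrite Cmod_mult, Cmod_inv by auto.
        apply Rmult_le_reg_r with (Cmod (w - z)); [auto|].
        rewrite Rmult_assoc, Rinv_l; lra.
    - destruct (qD w Hw Hne) as [k Hk]. eapply cderiv_ccont, Hk. }
  rewrite (rint_ext a b c d Hab Hcd q
     (fun w => f w * / (w - z) - f z * / (w - z))%C) in J0.
  2:{ intros w Hw. rewrite qE; [ring|]. intros ->.
      apply (bdry_neq _ _ _ _ _ _ Hz Hw). ring. }
  pose proof (differentiable_ccont_bdry f a b c d Hab Hcd Hf) as Cf.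
  assert (Ck : forall w, bdry a b c d w -> ccont (fun w => / (w - z))%C w).
  { intros w Hw. apply ccont_Cinv_sub. eapply bdry_neq; eauto. }
  rewrite rint_minus, rint_scal in J0; auto.
  - fold (cauchy_kernel a b c d z) in J0.
    replace (f z * cauchy_kernel a b c d z)%C with (0 + f z * cauchy_kernel a b c d z)%C by ring.
    rewrite <- J0. ring.
  - intros w Hw. apply (ccont_mult f); auto.
  - intros w Hw. apply (ccont_mult (fun _ => f z)); auto. apply ccont_const.
Qed.

(** Removes a constant factor by taking n-th roots: if x > y > 0, then (x/y)^n exceeds K by
    Bernoulli's inequality. For y = 0 the case n = 1 decides. *)
Lemma pow_le_scal_le (x y K : R) : 0 <= x -> 0 <= y -> (forall n, x ^ n <= K * y ^ n) -> x <= y.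
Proof.
  intros Hx Hy H. destruct (Rle_lt_dec x y) as [|Hlt]; [assumption|exfalso].
  destruct (Rle_lt_or_eq_dec 0 y Hy) as [Hp|E].
  - set (h := x / y - 1).
    assert (Hh : 0 < h).
    { unfold h. apply Rlt_0_minus. apply Rmult_lt_reg_r with y; [auto|].
      unfold Rdiv. rewrite Rmult_assoc, Rinv_l; lra. }
    destruct (INR_unbounded (K / h)) as [n Hn].
    assert (H1 : (1 + h) ^ n <= K).
    { replace (1 + h) with (x / y) by (unfold h; ring).
      unfold Rdiv. rewrite Rpow_mult_distr, pow_inv.
      assert (0 < y ^ n) by now apply pow_lt.
      apply Rmult_le_reg_r with (y ^ n); [auto|].
      rewrite Rmult_assoc, Rinv_l by lra. specialize (H n). lra. }
    pose proof (poly n h Hh).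
    assert (K < INR n * h).
    { apply Rmult_lt_compat_r with (r := h) in Hn; [|auto].
      unfold Rdiv in Hn. rewrite Rmult_assoc, Rinv_l in Hn by lra. lra. }
    lra.
  - specialize (H 1%nat). rewrite <- E in H. simpl in H. lra.
Qed.

(* Landau: Cauchy's formula for [f ^ n] bounds [|f z|^n] by a constant times [M^n];
   the constant disappears on taking n-th roots. *)
Lemma max_modulus f a b c d z M : inside a b c d z -> differentiable_on_rect f a b c d ->
  (forall w, bdry a b c d w -> Cmod (f w) <= M) -> Cmod (f z) <= M.
Proof.
  intros Hz Hf HM.
  destruct (inside_le _ _ _ _ _ Hz) as [Hab Hcd].
  assert (HM0 : 0 <= M).
  { eapply Rle_trans; [apply Cmod_ge_0 | apply (HM (a, c))]. left; simpl; lra. }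
  destruct (inside_bdry_dist _ _ _ _ _ Hz) as [r [Hr Hd]].
  pose proof (cauchy_kernel_neq_0 _ _ _ _ _ Hz) as Hk. apply Cmod_gt_0 in Hk.
  set (k := Cmod (cauchy_kernel a b c d z)) in *.
  apply pow_le_scal_le with (K := / r * (2 * (b - a + (d - c))) / k); [apply Cmod_ge_0 | auto|].
  intros n.
  assert (Dn : differentiable_on_rect (fun w => f w ^ n)%C a b c d).
  { intros w Hw. destruct (Hf w Hw) as [l Hl]. eapply cderiv_pow, Hl. }
  pose proof (cauchy_formula _ _ _ _ _ _ Hz Dn) as E.
  apply (f_equal Cmod) in E. rewrite Cmod_mult, Cmod_pow in E. fold k in E.
  assert (B : Cmod (rint a b c d (fun w => f w ^ n * / (w - z))%C) <= M ^ n * / r * (2 * (b - a + (d - c)))).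
  { apply rint_norm; auto.
    - intros w Hw. apply (ccont_mult (fun w => f w ^ n)%C).
      + now apply (differentiable_ccont_bdry _ a b c d).
      + apply ccont_Cinv_sub. eapply bdry_neq; eauto.
    - intros w Hw. rewrite Cmod_mult, Cmod_pow, Cmod_inv by (eapply bdry_neq; eauto).
      specialize (Hd w Hw).
      apply Rmult_le_compat.
      + apply pow_le, Cmod_ge_0.
      + left. apply Rinv_0_lt_compat. lra.
      + apply pow_incr. split; [apply Cmod_ge_0 | auto].
      + apply Rinv_le_contravar; lra. }
  apply Rmult_le_reg_r with k; [auto|]. rewrite <- E.
  replace (/ r * (2 * (b - a + (d - c))) / k * M ^ n * k) with (M ^ n * / r * (2 * (b - a + (d - c)))) by (field; lra).
  exact B.
Qed.

Lemma ccurve_bounded (f : R -> C) (a b : R) : (forall t, a <= t <= b -> ccurve f t) ->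
  exists M, forall t, a <= t <= b -> Cmod (f t) <= M.
Proof.
  intros H. destruct (bounded_continuity (V := C_R_NormedModule) f a b H) as [M HM].
  exists M. intros t Ht. rewrite Cmod_norm. left. exact (HM t Ht).
Qed.

Lemma ccont_bounded_bdry (f : C -> C) (a b c d : R) : a <= b -> c <= d ->
  (forall z, bdry a b c d z -> ccont f z) ->
  exists M, 0 <= M /\ forall z, bdry a b c d z -> Cmod (f z) <= M.
Proof.
  intros Hab Hcd Hf.
  destruct (ccurve_bounded (fun t => f (t, c)) a b) as [M1 H1].
  { intros t Ht. apply ccurve_h, Hf. left; simpl; lra. }
  destruct (ccurve_bounded (fun t => f (t, d)) a b) as [M2 H2].
  { intros t Ht. apply ccurve_h, Hf. left; simpl; lra. }
  destruct (ccurve_bounded (fun t => f (a, t)) c d) as [M3 H3].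
  { intros t Ht. apply ccurve_v, Hf. right; simpl; lra. }
  destruct (ccurve_bounded (fun t => f (b, t)) c d) as [M4 H4].
  { intros t Ht. apply ccurve_v, Hf. right; simpl; lra. }
  exists (Rabs M1 + Rabs M2 + Rabs M3 + Rabs M4).
  generalize (Rle_abs M1) (Rle_abs M2) (Rle_abs M3) (Rle_abs M4)
    (Rabs_pos M1) (Rabs_pos M2) (Rabs_pos M3) (Rabs_pos M4). intros. split; [lra|].
  intros [x y] Hz. unfold bdry in Hz; simpl in Hz.
  destruct Hz as [[Hx [->| ->]]|[[->| ->] Hy]];
   [specialize (H1 x Hx) | specialize (H2 x Hx) | specialize (H3 y Hy) | specialize (H4 y Hy)]; lra.
Qed.

(** Differentiation under the integral sign. A remainder that is quadratic in z - z0, uniformly on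
    the contour, stays quadratic after integration. *)
Lemma rint_param_deriv a b c d (k : C -> C -> C) (k' : C -> C) (z0 : C) (r B : R) :
  a <= b -> c <= d -> 0 < r -> 0 <= B ->
  (forall z, Cmod (z - z0) < r -> forall w, bdry a b c d w -> ccont (k z) w) ->
  (forall w, bdry a b c d w -> ccont k' w) ->
  (forall z, Cmod (z - z0) < r -> forall w, bdry a b c d w ->
     Cmod (k z w - k z0 w - k' w * (z - z0)) <= B * Cmod (z - z0) ^ 2) ->
  cderiv (fun z => rint a b c d (k z)) z0 (rint a b c d k').
Proof.
  intros Hab Hcd Hr HB Hk Hk' Hb eps Heps.
  set (P := 2 * (b - a + (d - c))).
  assert (HP : 0 <= P) by (unfold P; lra).
  assert (HBP : 0 <= B * P) by now apply Rmult_le_pos.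
  exists (Rmin r (eps / (B * P + 1))). split.
  { apply Rmin_glb_lt; [auto|]. apply Rdiv_lt_0_compat; lra. }
  intros z Hz.
  destruct (Rlt_Rmin _ _ _ Hz) as [H1 H2].
  assert (H0 : Cmod (z0 - z0) < r).
  { replace (z0 - z0)%C with (RtoC 0) by ring. now rewrite Cmod_0. }
  set (h := (z - z0)%C) in *.
  assert (Ch : forall w, bdry a b c d w -> ccont (fun w => h * k' w)%C w).
  { intros w Hw. apply ccont_mult; [apply ccont_const | auto]. }
  replace (rint a b c d (k z) - rint a b c d (k z0) - rint a b c d k' * h)%C
    with (rint a b c d (fun w => k z w - k z0 w - h * k' w)%C).
  2:{ rewrite (rint_minus a b c d Hab Hcd (fun w => k z w - k z0 w)%C), rint_minus, rint_scal; auto.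
      - ring.
      - intros w Hw. apply ccont_minus; auto. }
  eapply Rle_trans; [apply rint_norm with (M := B * Cmod h ^ 2); auto|].
  - intros w Hw. apply (ccont_minus (fun w => k z w - k z0 w)%C); auto. apply ccont_minus; auto.
  - intros w Hw. rewrite (Cmult_comm h). auto.
  - fold P. pose proof (Cmod_ge_0 h).
    replace (B * Cmod h ^ 2 * P) with (B * P * Cmod h * Cmod h) by ring.
    apply Rmult_le_compat_r; [auto|].
    apply Rle_trans with (B * P * (eps / (B * P + 1))); [apply Rmult_le_compat_l; lra|].
    apply Rle_trans with ((B * P + 1) * (eps / (B * P + 1))).
    + apply Rmult_le_compat_r; [|lra]. left. apply Rdiv_lt_0_compat; lra.
    + right. field. lra.
Qed.

Lemma Cinv_le (u : C) (r : R) : 0 < r -> r <= Cmod u -> u <> 0 /\ Cmod (/ u) <= / r.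
Proof.
  intros Hr Hu. assert (u <> 0) by (apply Cmod_gt_0; lra). split; [auto|].
  rewrite Cmod_inv by auto. apply Rinv_le_contravar; auto.
Qed.

Section CauchyTransform.
Variables (a b c d : R) (f : C -> C).
Hypotheses (Hab : a <= b) (Hcd : c <= d) (Hf : forall w, bdry a b c d w -> ccont f w).

Lemma inside_far z0 : inside a b c d z0 ->
  exists r, 0 < r /\ forall w, bdry a b c d w -> r <= Cmod (w - z0) /\
    forall z, Cmod (z - z0) < r / 2 -> r / 2 <= Cmod (w - z).
Proof.
  intros [r [Hr H]]%inside_bdry_dist. exists r. split; [auto|].
  intros w Hw. specialize (H w Hw). split; [auto|]. intros z Hz.
  replace (w - z)%C with ((w - z0) - (z - z0))%C by ring.
  eapply Rle_trans; [|apply Cmod_sub_rev]. lra.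
Qed.

Lemma ccont_cauchy_1 z w : (w - z)%C <> 0 -> ccont f w -> ccont (fun w => f w * / (w - z))%C w.
Proof. intros H Hw. apply (ccont_mult f); [auto | now apply ccont_Cinv_sub]. Qed.

Lemma ccont_cauchy_2 z w : (w - z)%C <> 0 -> ccont f w ->
  ccont (fun w => f w * (/ (w - z) * / (w - z)))%C w.
Proof.
  intros H Hw. apply (ccont_mult f); [auto|].
  apply (ccont_mult (fun w => / (w - z))%C); now apply ccont_Cinv_sub.
Qed.

Lemma cauchy_transform_deriv z0 : inside a b c d z0 ->
  cderiv (fun z => rint a b c d (fun w => f w * / (w - z))%C) z0
    (rint a b c d (fun w => f w * (/ (w - z0) * / (w - z0)))%C).
Proof.
  intros Hz. destruct (inside_far z0 Hz) as [r [Hr Hd]].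
  destruct (ccont_bounded_bdry f a b c d Hab Hcd Hf) as [M [HM0 HM]].
  assert (Hr' : 0 < / r) by now apply Rinv_0_lt_compat.
  (* The remainder of the kernel is (z - z0)^2 / ((w - z)(w - z0)^2), with |w - z| >= r/2 and |w -
     z0| >= r on the contour. *)
  apply (rint_param_deriv a b c d (fun z w => f w * / (w - z))%C
    (fun w => f w * (/ (w - z0) * / (w - z0)))%C z0 (r / 2) (M * (2 * / r * / r * / r))); auto.
  - lra.
  - apply Rmult_le_pos; [auto|]. repeat apply Rmult_le_pos; lra.
  - intros z Hz' w Hw. destruct (Hd w Hw) as [_ H2]. apply ccont_cauchy_1; auto.
    apply (Cinv_le _ (r / 2)); [lra | auto].
  - intros w Hw. destruct (Hd w Hw) as [H1 _]. apply ccont_cauchy_2; auto.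
    apply (Cinv_le _ r); auto.
  - intros z Hz' w Hw. destruct (Hd w Hw) as [H1 H2]. specialize (H2 z Hz').
    apply (Cinv_le _ r) in H1; [|auto]. destruct H1 as [N1 H1].
    apply (Cinv_le _ (r / 2)) in H2; [|lra]. destruct H2 as [N2 H2].
    replace (/ (r / 2)) with (2 * / r) in H2 by (field; lra).
    replace (f w * / (w - z) - f w * / (w - z0) - f w * (/ (w - z0) * / (w - z0)) * (z - z0))%C
      with (f w * (/ (w - z) * / (w - z0) * / (w - z0)) * ((z - z0) * (z - z0)))%C
      by (field; auto).
    rewrite !Cmod_mult. replace (Cmod (z - z0) ^ 2) with (Cmod (z - z0) * Cmod (z - z0)) by ring.
    apply Rmult_le_compat_r; [apply Rmult_le_pos; apply Cmod_ge_0|].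
    apply Rmult_le_compat; auto using Cmod_ge_0; repeat apply Rmult_le_pos; auto using Cmod_ge_0.
    repeat apply Rmult_le_compat; auto using Cmod_ge_0; repeat apply Rmult_le_pos; auto using Cmod_ge_0.
Qed.

Lemma cauchy_transform_deriv2 z0 : inside a b c d z0 ->
  cderiv (fun z => rint a b c d (fun w => f w * (/ (w - z) * / (w - z)))%C) z0
    (rint a b c d (fun w => f w * (2 * (/ (w - z0) * / (w - z0) * / (w - z0))))%C).
Proof.
  intros Hz. destruct (inside_far z0 Hz) as [r [Hr Hd]].
  destruct (ccont_bounded_bdry f a b c d Hab Hcd Hf) as [M [HM0 HM]].
  assert (Hr' : 0 < / r) by now apply Rinv_0_lt_compat.
  (* The 5 bounds the factor 3 - 2 (z - z0)/(w - z0) of the remainder, as |z - z0| <= |w - z0|. *)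
  apply (rint_param_deriv a b c d (fun z w => f w * (/ (w - z) * / (w - z)))%C
    (fun w => f w * (2 * (/ (w - z0) * / (w - z0) * / (w - z0))))%C z0 (r / 2)
    (M * (5 * (2 * / r * (2 * / r) * / r * / r)))); auto.
  - lra.
  - apply Rmult_le_pos; [auto|]. repeat apply Rmult_le_pos; lra.
  - intros z Hz' w Hw. destruct (Hd w Hw) as [_ H2]. apply ccont_cauchy_2; auto.
    apply (Cinv_le _ (r / 2)); [lra | auto].
  - intros w Hw. destruct (Hd w Hw) as [H1 _].
    apply (Cinv_le _ r) in H1; [|auto]. destruct H1 as [N1 H1].
    apply (ccont_mult f); auto. apply (ccont_mult (fun _ => 2)); [apply ccont_const|].
    apply (ccont_mult (fun w => / (w - z0) * / (w - z0))%C); [|now apply ccont_Cinv_sub].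
    apply (ccont_mult (fun w => / (w - z0))%C); now apply ccont_Cinv_sub.
  - intros z Hz' w Hw. destruct (Hd w Hw) as [H1 H2]. specialize (H2 z Hz').
    apply (Cinv_le _ r) in H1 as H1'; [|auto]. destruct H1' as [N1 G1].
    apply (Cinv_le _ (r / 2)) in H2; [|lra]. destruct H2 as [N2 H2].
    replace (/ (r / 2)) with (2 * / r) in H2 by (field; lra).
    replace (f w * (/ (w - z) * / (w - z)) - f w * (/ (w - z0) * / (w - z0))
       - f w * (2 * (/ (w - z0) * / (w - z0) * / (w - z0))) * (z - z0))%C
      with (f w * ((3 - 2 * ((z - z0) * / (w - z0))) *
         (/ (w - z) * / (w - z) * / (w - z0) * / (w - z0))) * ((z - z0) * (z - z0)))%C
      by (field; auto).
    assert (H5 : Cmod (3 - 2 * ((z - z0) * / (w - z0))) <= 5).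
    { eapply Rle_trans; [apply Cmod_triangle_sub|]. rewrite !Cmod_mult, Cmod_inv, !Cmod_R by auto.
      rewrite !Rabs_pos_eq by lra.
      assert (Cmod (z - z0) * / Cmod (w - z0) <= 1); [|lra].
      apply Rmult_le_reg_r with (Cmod (w - z0)); [lra|].
      rewrite Rmult_assoc, Rinv_l by lra. lra. }
    rewrite Cmod_mult, (Cmod_mult (z - z0) (z - z0)).
    replace (Cmod (z - z0) ^ 2) with (Cmod (z - z0) * Cmod (z - z0)) by ring.
    apply Rmult_le_compat_r; [apply Rmult_le_pos; apply Cmod_ge_0|].
    rewrite Cmod_mult. apply Rmult_le_compat; auto using Cmod_ge_0.
    rewrite Cmod_mult. apply Rmult_le_compat; auto using Cmod_ge_0.
    rewrite !Cmod_mult.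
    repeat apply Rmult_le_compat; auto using Cmod_ge_0; repeat apply Rmult_le_pos; auto using Cmod_ge_0.
Qed.

End CauchyTransform.

Lemma inside_open a b c d z0 : inside a b c d z0 ->
  exists r, 0 < r /\ forall z, Cmod (z - z0) < r -> inside a b c d z.
Proof.
  intros [r [Hr H]]%inside_margin. exists r. split; [auto|].
  intros z Hz. pose proof (Re_sub_le z z0). pose proof (Im_sub_le z z0). split; lra.
Qed.

Lemma cderiv_C_derive f z l : cderiv f z l -> C_derive f z = l.
Proof. intros H%is_derive_cderiv. now apply is_C_derive_unique. Qed.

(* Differentiating [f z * kernel z = transform z], where the kernel has zero derivative. *)
Lemma cauchy_formula_deriv f a b c d z : inside a b c d z -> differentiable_on_rect f a b c d ->
  (C_derive f z * cauchy_kernel a b c d z)%C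
    = rint a b c d (fun w => f w * (/ (w - z) * / (w - z)))%C.
Proof.
  intros Hz Hf.
  destruct (inside_le _ _ _ _ _ Hz) as [Hab Hcd].
  pose proof (differentiable_ccont_bdry f a b c d Hab Hcd Hf) as Cf.
  destruct (Hf z) as [l Hl]; [destruct Hz; split; lra|].
  (* The derivative of the kernel is the contour integral of 1/(w - z)^2, which has the primitive
     -1/(w - z) along the contour. *)
  assert (K2 : cderiv (cauchy_kernel a b c d) z 0).
  { pose proof (cauchy_transform_deriv a b c d (fun _ => 1) Hab Hcd (fun w _ => ccont_const 1 w) z Hz) as H.
    rewrite (rint_FTC a b c d Hab Hcd (fun w => - (1) * / (w - z))%C) in H.
    - eapply cderiv_ext_near; [|exact H]. exists 1. split; [lra|]. intros u _.
      apply rint_ext; auto. intros; ring.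
    - intros w Hw. assert (Hn : (w - z)%C <> 0) by (eapply bdry_neq; eauto).
      replace (1 * (/ (w - z) * / (w - z)))%C with (- (1) * (- / ((w - z) * (w - z))))%C by (field; auto).
      apply cderiv_scal. now apply cderiv_Cinv_sub.
    - intros w Hw. apply (ccont_cauchy_2 (fun _ => 1)); [eapply bdry_neq; eauto | apply ccont_const]. }
  pose proof (cderiv_mult _ _ _ _ _ Hl K2) as H.
  apply (cderiv_ext_near _ (fun z => rint a b c d (fun w => f w * / (w - z))%C)) in H.
  - rewrite (cderiv_C_derive f z l Hl).
    rewrite <- (cderiv_unique _ _ _ _ H (cauchy_transform_deriv a b c d f Hab Hcd Cf z Hz)). ring.
  - destruct (inside_open _ _ _ _ _ Hz) as [r [Hr Ho]]. exists r. split; [auto|].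
    intros w Hw. symmetry. apply cauchy_formula; auto.
Qed.

(** Near z the derivative is a quotient of two Cauchy transforms, both differentiable, with nonzero
    denominator. *)
Lemma cderiv_of_C_derive f a b c d z : inside a b c d z -> differentiable_on_rect f a b c d ->
  exists l, cderiv (C_derive f) z l.
Proof.
  intros Hz Hf.
  destruct (inside_le _ _ _ _ _ Hz) as [Hab Hcd].
  pose proof (differentiable_ccont_bdry f a b c d Hab Hcd Hf) as Cf.
  eexists.
  apply (cderiv_ext_near (fun z => rint a b c d (fun w => f w * (/ (w - z) * / (w - z)))%C * / cauchy_kernel a b c d z)%C).
  - destruct (inside_open _ _ _ _ _ Hz) as [r [Hr Ho]]. exists r. split; [auto|].
    intros w Hw. rewrite <- cauchy_formula_deriv; auto. field. apply cauchy_kernel_neq_0; auto.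
  - apply (cderiv_mult (fun z => rint a b c d (fun w => f w * (/ (w - z) * / (w - z)))%C)
      (fun z => / cauchy_kernel a b c d z)%C).
    + apply cauchy_transform_deriv2; auto.
    + apply cderiv_inv; [|now apply cauchy_kernel_neq_0].
      apply (cderiv_ext (fun z => rint a b c d (fun w => 1 * / (w - z))%C)).
      * intros u. apply rint_ext; auto. intros; ring.
      * apply (cauchy_transform_deriv a b c d (fun _ => 1)); auto. intros; apply ccont_const.
Qed.

(** For a square of half-side r about z the lower bound of [cauchy_kernel_im] is exactly 1, and the
    contour has length 8 r, with |w - z| >= r on it. *)
Lemma cauchy_estimate f (z : C) (r M : R) : 0 < r ->
  differentiable_on_rect f (Re z - r) (Re z + r) (Im z - r) (Im z + r) ->
  (forall w, rect (Re z - r) (Re z + r) (Im z - r) (Im z + r) w -> Cmod (f w) <= M) ->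
  Cmod (C_derive f z) <= 8 * M / r.
Proof.
  intros Hr Hf HM.
  set (a := Re z - r) in *. set (b := Re z + r) in *. set (c := Im z - r) in *. set (d := Im z + r) in *.
  assert (Hz : inside a b c d z) by (unfold inside, a, b, c, d; lra).
  destruct (inside_le _ _ _ _ _ Hz) as [Hab Hcd].
  pose proof (cauchy_formula_deriv _ _ _ _ _ _ Hz Hf) as E.
  apply (f_equal Cmod) in E. rewrite Cmod_mult in E.
  assert (K : 1 <= Cmod (cauchy_kernel a b c d z)).
  { pose proof (cauchy_kernel_im _ _ _ _ _ Hz) as H.
    replace (2 * (b - a) * (d - c) / ((b - a) ^ 2 + (d - c) ^ 2)) with 1 in H.
    2:{ unfold a, b, c, d. field. nra. }
    pose proof (im_le_Cmod (cauchy_kernel a b c d z)). pose proof (Rle_abs (Im (cauchy_kernel a b c d z))). lra. }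
  assert (D : forall w, bdry a b c d w -> r <= Cmod (w - z)).
  { intros w Hw. apply (bdry_dist_ge a b c d); auto; unfold a, b, c, d; lra. }
  assert (B : Cmod (rint a b c d (fun w => f w * (/ (w - z) * / (w - z)))%C)
    <= M * (/ r * / r) * (2 * (b - a + (d - c)))).
  { apply rint_norm; auto.
    - intros w Hw. apply ccont_cauchy_2; [eapply bdry_neq; eauto|].
      now apply (differentiable_ccont_bdry _ a b c d).
    - intros w Hw. destruct (Cinv_le _ _ Hr (D w Hw)) as [_ Hi]. rewrite !Cmod_mult.
      apply Rmult_le_compat; auto using Cmod_ge_0.
      + apply Rmult_le_pos; apply Cmod_ge_0.
      + apply HM. now apply bdry_rect.
      + apply Rmult_le_compat; auto using Cmod_ge_0. }
  replace (M * (/ r * / r) * (2 * (b - a + (d - c)))) with (8 * M / r) in B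
    by (unfold a, b, c, d; field; lra).
  pose proof (Cmod_ge_0 (C_derive f z)). nra.
Qed.

(** * Holomorphic functions on half-planes *)

Definition hol (theta : R) (f : C -> C) : Prop :=
  forall s, theta < Re s -> exists l, cderiv f s l.

Lemma hol_mono theta theta' f : theta <= theta' -> hol theta f -> hol theta' f.
Proof. intros Hle H s Hs. apply H. lra. Qed.

Lemma hol_rect theta f a b c d : theta < a -> hol theta f -> differentiable_on_rect f a b c d.
Proof. intros Ha H z [Hz _]. apply H. lra. Qed.

Lemma hol_cderiv theta f s : hol theta f -> theta < Re s -> cderiv f s (C_derive f s).
Proof.
  intros H Hs. destruct (H s Hs) as [l Hl]. now rewrite (cderiv_C_derive f s l Hl).
Qed.

Lemma hol_ccont theta f s : hol theta f -> theta < Re s -> ccont f s.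
Proof. intros H Hs. eapply cderiv_ccont, hol_cderiv; eauto. Qed.

Lemma hol_C_derive theta f : hol theta f -> hol theta (C_derive f).
Proof.
  intros H s Hs.
  apply (cderiv_of_C_derive f ((Re s + theta) / 2) (Re s + 1) (Im s - 1) (Im s + 1)).
  - unfold inside. lra.
  - apply (hol_rect theta); [lra | exact H].
Qed.

Lemma hol_minus theta f g : hol theta f -> hol theta g -> hol theta (fun s => f s - g s)%C.
Proof.
  intros Hf Hg s Hs. destruct (Hf s Hs) as [l Hl]. destruct (Hg s Hs) as [k Hk].
  eexists. apply cderiv_minus; eauto.
Qed.

Lemma hol_mult theta f g : hol theta f -> hol theta g -> hol theta (fun s => f s * g s)%C.
Proof.
  intros Hf Hg s Hs. destruct (Hf s Hs) as [l Hl]. destruct (Hg s Hs) as [k Hk].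
  eexists. apply cderiv_mult; eauto.
Qed.

Lemma hol_const theta (k : C) : hol theta (fun _ => k).
Proof. intros s _. eexists. apply cderiv_const. Qed.

Lemma re_near (s w : C) (r : R) : Cmod (w - s) < r -> Re s - r < Re w.
Proof. intros H. pose proof (Re_sub_le w s). lra. Qed.

Lemma C_derive_ext theta f g s : theta < Re s -> hol theta f ->
  (forall w, theta < Re w -> f w = g w) -> C_derive f s = C_derive g s.
Proof.
  intros Hs Hf E. symmetry. apply cderiv_C_derive.
  apply (cderiv_ext_near f); [|now apply (hol_cderiv theta)].
  exists (Re s - theta). split; [lra|]. intros w Hw. apply E.
  apply re_near in Hw. lra.
Qed.

Lemma is_derive_Re (g : R -> C) (t : R) (l : C) :
  is_derive (K := R_AbsRing) (V := C_R_NormedModule) g t l ->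
  is_derive (K := R_AbsRing) (V := R_NormedModule) (fun t => Re (g t)) t (Re l).
Proof.
  intros [_ H]. split; [apply (is_linear_scal_l (K := R_AbsRing) (V := R_NormedModule))|].
  intros x Hx eps. specialize (H x Hx eps). revert H. apply filter_imp. intros u Hu.
  eapply Rle_trans; [|apply Hu].
  match goal with |- _ <= norm ?X => replace (norm X) with (Cmod X) by apply Cmod_norm;
    apply (re_le_Cmod X) end.
Qed.

(* Applied to the real part of [f] times the unit complex number that makes the increment real. *)
Lemma cderiv_increment_le (f d : C -> C) (psi psi' : R -> R) (z v : C) (a b : R) : a <= b ->
  (forall t, a <= t <= b -> cderiv f (z + t * v) (d (z + t * v)%C)) ->
  (forall t, a <= t <= b -> is_derive psi t (psi' t)) ->
  (forall t, a <= t <= b -> Cmod (d (z + t * v)%C * v) <= psi' t) ->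
  Cmod (f (z + b * v)%C - f (z + a * v)%C) <= psi b - psi a.
Proof.
  intros Hab Hf Hp Hle.
  set (D := (f (z + b * v) - f (z + a * v))%C).
  destruct (unit_phase D) as [u [Hu1 Hu2]].
  set (G := fun t : R => Re (u * f (z + RtoC t * v)%C) - psi t).
  assert (HG : forall t, a <= t <= b ->
    is_derive G t (Re (u * d (z + RtoC t * v)%C * v) - psi' t)).
  { intros t Ht. apply (is_derive_minus (V := R_NormedModule)); [|now apply Hp].
    apply (is_derive_Re (fun t : R => u * f (z + RtoC t * v)%C)%C).
    apply (cderiv_line (fun w => u * f w)%C). apply cderiv_scal. now apply Hf. }
  assert (N : forall t, a <= t <= b -> Re (u * d (z + RtoC t * v)%C * v) - psi' t <= 0).
  { intros t Ht.
    pose proof (re_le_Cmod (u * d (z + RtoC t * v)%C * v)) as K.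
    pose proof (Rle_abs (Re (u * d (z + RtoC t * v)%C * v))).
    replace (u * d (z + RtoC t * v)%C * v)%C with (u * (d (z + RtoC t * v)%C * v))%C in K at 2 by ring.
    rewrite Cmod_mult in K. specialize (Hle t Ht).
    pose proof (Cmod_ge_0 (d (z + RtoC t * v)%C * v)). nra. }
  pose proof (nonincreasing_of_derivative G _ a b Hab HG N) as M.
  assert (F : G b - G a = Cmod D - (psi b - psi a)).
  { unfold G. rewrite <- Hu2. unfold D.
    replace (u * (f (z + b * v) - f (z + a * v)))%C with (u * f (z + b * v)%C - u * f (z + a * v)%C)%C by ring.
    change (Re (u * f (z + b * v)%C - u * f (z + a * v)%C)) with
      (Re (u * f (z + b * v)%C) + - Re (u * f (z + a * v)%C)). ring. }
  lra.
Qed.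

(** The majorant may vary along the segment: below, psi is a multiple of ln t, of 2^(-t) or of t. *)
Lemma hol_increment_horizontal theta f (psi psi' : R -> R) (a b y : R) : theta < a -> a <= b ->
  hol theta f ->
  (forall t, a <= t <= b -> is_derive psi t (psi' t)) ->
  (forall t, a <= t <= b -> Cmod (C_derive f (t, y)) <= psi' t) ->
  Cmod (f (b, y) - f (a, y)) <= psi b - psi a.
Proof.
  intros Ha Hab Hf Hp Hle.
  rewrite <- (horizontal_line a), <- (horizontal_line b).
  apply (cderiv_increment_le f (C_derive f) psi psi'); auto; intros t Ht; rewrite horizontal_line.
  - apply (hol_cderiv theta); simpl; auto; lra.
  - rewrite Cmult_1_r. auto.
Qed.

Lemma hol_increment_segment theta f (z w : C) (M : R) : theta < Re z -> theta < Re w ->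
  hol theta f ->
  (forall s, Rmin (Re z) (Re w) <= Re s -> Cmod (C_derive f s) <= M) ->
  Cmod (f w - f z) <= M * Cmod (w - z).
Proof.
  intros Hz Hw Hf HM.
  set (v := (w - z)%C).
  replace (f w) with (f (z + 1 * v)%C) by (f_equal; unfold v; ring).
  replace (f z) with (f (z + 0 * v)%C) by (f_equal; unfold v; ring).
  replace (M * Cmod v) with (M * Cmod v * 1 - M * Cmod v * 0) by ring.
  assert (L : forall t, 0 <= t <= 1 -> Rmin (Re z) (Re w) <= Re (z + t * v)).
  { intros t Ht. replace (Re (z + t * v)) with (Re z + t * (Re w - Re z))
      by (unfold v; destruct z, w; simpl; ring).
    unfold Rmin. destruct (Rle_dec (Re z) (Re w)); nra. }
  assert (L' : theta < Rmin (Re z) (Re w)) by now apply Rmin_glb_lt.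
  apply (cderiv_increment_le f (C_derive f) (fun t => M * Cmod v * t) (fun _ => M * Cmod v)); [lra| | |].
  - intros t Ht. apply (hol_cderiv theta); [auto|]. specialize (L t Ht). lra.
  - intros t _. auto_derive; [auto | ring].
  - intros t Ht. rewrite Cmod_mult. apply Rmult_le_compat_r; [apply Cmod_ge_0|]. auto.
Qed.

Lemma hol_zero_derivative_const theta f (z w : C) : theta < Re z -> theta < Re w ->
  hol theta f -> (forall s, theta < Re s -> C_derive f s = 0) -> f w = f z.
Proof.
  intros Hz Hw Hf H0.
  assert (L' : theta < Rmin (Re z) (Re w)) by now apply Rmin_glb_lt.
  assert (E : Cmod (f w - f z) <= 0 * Cmod (w - z)).
  { apply (hol_increment_segment theta); auto. intros s Hs. rewrite H0 by lra. rewrite Cmod_0. lra. }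
  assert (E0 : (f w - f z)%C = 0) by (apply Cmod_eq_0; generalize (Cmod_ge_0 (f w - f z)); lra).
  replace (f w) with ((f w - f z) + f z)%C by ring. rewrite E0. ring.
Qed.

Lemma ex_RIntC_ccurve_gen (f : R -> C) (a b : R) :
  (forall t, Rmin a b <= t <= Rmax a b -> ccurve f t) -> ex_RIntC f a b.
Proof. apply (ex_RInt_continuous (V := C_R_CompleteNormedModule)). Qed.

Lemma hol_ex_RIntC_h theta f u v y : hol theta f -> theta < u -> theta < v ->
  ex_RIntC (fun t => f (t, y)) u v.
Proof.
  intros Hf Hu Hv. apply ex_RIntC_ccurve_gen. intros t [Ht _]. apply ccurve_h, (hol_ccont theta); auto.
  simpl. eapply Rlt_le_trans; [|apply Ht]. now apply Rmin_glb_lt.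
Qed.

Lemma hol_ex_RIntC_v theta f u v x : hol theta f -> theta < x -> ex_RIntC (fun t => f (x, t)) u v.
Proof.
  intros Hf Hx. apply ex_RIntC_ccurve_gen. intros t Ht. apply ccurve_v, (hol_ccont theta); auto.
Qed.

Lemma RIntC_swap (f : R -> C) (a b : R) : ex_RIntC f a b -> RIntC f b a = (- RIntC f a b)%C.
Proof.
  intros H. apply RIntC_unique. apply (is_RInt_swap (V := C_R_NormedModule)). now apply RIntC_correct.
Qed.

Lemma RIntC_approx (f : R -> C) (a b M : R) (k : C) :
  (forall t, Rmin a b <= t <= Rmax a b -> ccurve f t) ->
  (forall t, Rmin a b <= t <= Rmax a b -> Cmod (f t - k) <= M) ->
  Cmod (RIntC f a b - k * (b - a)) <= M * Rabs (b - a).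
Proof.
  assert (G : forall a b, a <= b -> (forall t, a <= t <= b -> ccurve f t) ->
    (forall t, a <= t <= b -> Cmod (f t - k) <= M) ->
    Cmod (RIntC f a b - k * (b - a)) <= M * (b - a)).
  { clear a b. intros a b Hab Hf HM.
    assert (Ck : forall t, ccurve (fun _ : R => (- (1) * k)%C) t) by (intros; apply continuous_const).
    assert (E : is_RInt (V := C_R_NormedModule) (fun _ : R => k) a b (k * (b - a))%C).
    { replace (k * (b - a))%C with (scal (K := R_AbsRing) (V := C_R_NormedModule) (b - a) k).
      - apply (is_RInt_const (V := C_R_NormedModule)).
      - rewrite <- RtoC_minus. unfold scal; simpl. unfold prod_scal, scal; simpl. unfold mult; simpl.
        destruct k; unfold Cmult, RtoC; simpl. f_equal; ring. }
    replace (RIntC f a b - k * (b - a))%C with (RIntC (fun t => f t + - (1) * k)%C a b).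
    - apply RIntC_norm; auto.
      + apply ex_RIntC_ccurve; auto. intros t Ht.
        apply (continuous_plus (V := C_R_NormedModule)); auto.
      + intros t Ht. replace (f t + - (1) * k)%C with (f t - k)%C by ring. auto.
    - rewrite RIntC_plus; [| apply ex_RIntC_ccurve; auto | apply ex_RIntC_ccurve; auto].
      rewrite (RIntC_unique (fun _ => - (1) * k)%C a b (- (1) * (k * (b - a)))%C).
      + ring.
      + now apply is_RIntC_scal. }
  intros Hf HM. destruct (Rle_dec a b) as [Hab|Hab].
  - rewrite Rmin_left, Rmax_right in * by lra. rewrite Rabs_pos_eq by lra. auto.
  - rewrite Rmin_right, Rmax_left in * by lra. rewrite Rabs_left by lra.
    rewrite (RIntC_swap f b a) by (apply ex_RIntC_ccurve; [lra | auto]).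
    replace (- RIntC f b a - k * (b - a))%C with (- (RIntC f b a - k * (a - b)))%C by ring.
    rewrite Cmod_opp. replace (- (b - a)) with (a - b) by ring. apply G; auto. lra.
Qed.

(** Reversing a side changes the sign of its integrals, so the corners may come in any order. The
    primitive below is compared at points on all sides of a given one. *)
Lemma rint_zero_oriented f theta (a b c d : R) : hol theta f -> theta < a -> theta < b ->
  rint a b c d f = 0.
Proof.
  intros Hf Ha Hb.
  pose proof (fun u v y => hol_ex_RIntC_h theta f u v y Hf) as Ch.
  pose proof (fun u v x => hol_ex_RIntC_v theta f u v x Hf) as Cv.
  assert (G : forall a b c d, theta < a -> theta < b -> a <= b -> rint a b c d f = 0).
  { clear a b c d Ha Hb. intros a b c d Ha Hb Hab. destruct (Rle_dec c d) as [Hcd|Hcd].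
    - apply goursat; auto. now apply (hol_rect theta).
    - assert (E : rint a b d c f = 0) by (apply goursat; [auto | lra | now apply (hol_rect theta)]).
      unfold rint in *. rewrite (RIntC_swap (fun t => f (b, t)) d c), (RIntC_swap (fun t => f (a, t)) d c) by auto.
      match type of E with ?X = _ => match goal with |- ?Y = _ => replace Y with (- X)%C by ring end end.
      rewrite E. ring. }
  destruct (Rle_dec a b) as [Hab|Hab]; [auto|].
  assert (E : rint b a c d f = 0) by (apply G; auto; lra).
  unfold rint in *. rewrite (RIntC_swap (fun t => f (t, c)) b a), (RIntC_swap (fun t => f (t, d)) b a) by auto.
  match type of E with ?X = _ => match goal with |- ?Y = _ => replace Y with (- X)%C by ring end end.
  rewrite E. ring.
Qed.

(** P integrates f from theta + 1 along the real axis and then vertically. Its increments at (x, y)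
    are short integrals near (x, y), on which f is nearly constant. *)
Lemma half_plane_primitive theta f : hol theta f ->
  exists P, forall s, theta < Re s -> cderiv P s (f s).
Proof.
  intros Hf.
  pose proof (fun u v y => hol_ex_RIntC_h theta f u v y Hf) as Ch.
  pose proof (fun u v x => hol_ex_RIntC_v theta f u v x Hf) as Cv.
  pose (P := fun z : C => (RIntC (fun t => f (t, 0)) (theta + 1) (Re z)
              + Ci * RIntC (fun t => f (Re z, t)) 0 (Im z))%C).
  exists P. intros [x y] Hx. simpl in Hx.
  (* Goursat on the rectangle between heights 0 and y moves the horizontal piece from x to x' up to
     height y. *)
  assert (EP : forall x' y', theta < x' -> (P (x', y') - P (x, y))%C =
    (RIntC (fun t => f (t, y)) x x' + Ci * RIntC (fun t => f (x', t)) y y')%C).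
  { intros x' y' Hx'. unfold P; simpl.
    pose proof (rint_zero_oriented f theta x x' 0 y Hf Hx Hx') as E. unfold rint in E.
    rewrite <- (RIntC_Chasles (fun t => f (t, 0)) (theta + 1) x x') by (apply Ch; lra).
    rewrite <- (RIntC_Chasles (fun t => f (x', t)) 0 y y') by auto.
    match type of E with ?X = _ => match goal with |- ?L = ?R => replace L with (X + R)%C by ring end end.
    rewrite E. ring. }
  intros eps Heps.
  destruct (hol_ccont theta f (x, y) Hf Hx (eps / 2)) as [del [Hdel Hd]]; [lra|].
  exists (Rmin (del / 2) (x - theta)). split; [apply Rmin_glb_lt; lra|].
  intros [x' y'] Hw.
  destruct (Rlt_Rmin _ _ _ Hw) as [H1 H2].
  pose proof (re_near _ _ _ H2) as Hx'. simpl in Hx'.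
  rewrite EP by lra.
  pose proof (re_le_Cmod ((x', y') - (x, y))) as Ku. pose proof (im_le_Cmod ((x', y') - (x, y))) as Kv.
  change (Re ((x', y') - (x, y))) with (x' + - x) in Ku.
  change (Im ((x', y') - (x, y))) with (y' + - y) in Kv.
  set (m := Cmod ((x', y') - (x, y))) in *.
  replace ((x', y') - (x, y))%C with ((x' - x) + Ci * (y' - y))%C.
  2:{ rewrite (RtoC_pair x' y'), (RtoC_pair x y). ring. }
  replace (RIntC (fun t => f (t, y)) x x' + Ci * RIntC (fun t => f (x', t)) y y'
     - f (x, y) * (x' - x + Ci * (y' - y)))%C
   with ((RIntC (fun t => f (t, y)) x x' - f (x, y) * (x' - x))
      + Ci * (RIntC (fun t => f (x', t)) y y' - f (x, y) * (y' - y)))%C by ring.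
  eapply Rle_trans; [apply Cmod_triangle|]. rewrite Cmod_mult, Cmod_Ci, Rmult_1_l.
  assert (Bt : forall u v t, Rmin u v <= t <= Rmax u v -> Rabs (t - u) <= Rabs (v - u)).
  { intros u v t. unfold Rmin, Rmax. destruct (Rle_dec u v); intros Ht.
    - rewrite !Rabs_pos_eq; lra.
    - rewrite !Rabs_left1; lra. }
  assert (A1 : Cmod (RIntC (fun t => f (t, y)) x x' - f (x, y) * (x' - x)) <= eps / 2 * Rabs (x' - x)).
  { apply RIntC_approx.
    - intros t [Ht _]. apply ccurve_h, (hol_ccont theta); auto. simpl.
      eapply Rlt_le_trans; [|apply Ht]. apply Rmin_glb_lt; lra.
    - intros t Ht. apply Hd. eapply Rle_lt_trans; [apply Cmod_le_abs_sum|]. simpl.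
      apply Bt in Ht. unfold Rminus in Ht.
      replace (y + - y) with 0 by ring. rewrite Rabs_R0. lra. }
  assert (A2 : Cmod (RIntC (fun t => f (x', t)) y y' - f (x, y) * (y' - y)) <= eps / 2 * Rabs (y' - y)).
  { apply RIntC_approx.
    - intros t _. apply ccurve_v, (hol_ccont theta); auto. simpl. lra.
    - intros t Ht. apply Hd. eapply Rle_lt_trans; [apply Cmod_le_abs_sum|]. simpl.
      apply Bt in Ht. unfold Rminus in Ht. lra. }
  unfold Rminus in A1, A2.
  assert (eps / 2 * Rabs (x' + - x) <= eps / 2 * m) by (apply Rmult_le_compat_l; lra).
  assert (eps / 2 * Rabs (y' + - y) <= eps / 2 * m) by (apply Rmult_le_compat_l; lra).
  unfold Cminus in *. rewrite <- !RtoC_opp, <- !RtoC_plus in *. lra.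
Qed.

(* Maximum principle for [h s / (1 + e s)], which is small on the far sides of large squares; then [e -> 0]. *)
Lemma phragmen_lindelof h (B M : R) : hol 0 h -> 0 <= M ->
  (forall s, 1 <= Re s -> Cmod (h s) <= B) ->
  (forall s, Re s = 1 -> Cmod (h s) <= M) ->
  forall s, 1 <= Re s -> Cmod (h s) <= M.
Proof.
  intros Hh HM0 HB HM s Hs.
  destruct (Rle_lt_or_eq_dec _ _ Hs) as [Hs'|E]; [|now apply HM].
  assert (HB0 : 0 <= B) by (eapply Rle_trans; [apply Cmod_ge_0 | apply (HB s Hs)]).
  assert (Ne : forall e w, 0 < e -> 0 < Re w -> 1 + e * Re w <= Cmod (1 + e * w) /\ e * Rabs (Im w) <= Cmod (1 + e * w)).
  { intros e [x y] He Hw. simpl in Hw.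
    pose proof (re_le_Cmod (1 + e * (x, y))) as K1. pose proof (im_le_Cmod (1 + e * (x, y))) as K2.
    replace (Re (1 + e * (x, y))) with (1 + e * x) in K1 by (simpl; ring).
    replace (Im (1 + e * (x, y))) with (e * y) in K2 by (simpl; ring).
    rewrite Rabs_mult, (Rabs_pos_eq e) in K2 by lra. pose proof (Rle_abs (1 + e * x)). simpl. lra. }
  assert (K : forall e, 0 < e -> Cmod (h s) <= (M + e) * (1 + e * Cmod s)).
  { intros e He.
    pose proof (Cmod_ge_0 s) as Hm.
    (* On the sides of [1, 1 + X] x [-X, X] off the line Re w = 1, the quotient is at most B/(e X)
       <= e. The summand |s| puts s inside. *)
    set (X := 1 + Cmod s + B / (e * e)).
    assert (HBe : 0 <= B / (e * e)) by (apply Rdiv_le_0_compat; [auto | now apply Rmult_lt_0_compat]).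
    assert (BX : B * / (e * X) <= e).
    { apply Rmult_le_reg_r with (e * X); [apply Rmult_lt_0_compat; unfold X; lra|].
      rewrite Rmult_assoc, Rinv_l by (apply Rgt_not_eq, Rmult_lt_0_compat; unfold X; lra).
      unfold X. replace (e * (e * (1 + Cmod s + B / (e * e)))) with (e * e * (1 + Cmod s) + B) by (field; lra).
      assert (0 <= e * e * (1 + Cmod s)) by (repeat apply Rmult_le_pos; lra). lra. }
    pose proof (re_le_Cmod s) as R1. pose proof (im_le_Cmod s) as R2.
    pose proof (Rle_abs (Re s)). pose proof (Rle_abs (Im s)). pose proof (Rabs_maj2 (Im s)).
    assert (Hn : forall w, 0 < Re w -> (1 + e * w)%C <> 0).
    { intros w Hw. apply Cmod_gt_0. destruct (Ne e w He Hw).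
      assert (0 < e * Re w) by now apply Rmult_lt_0_compat. lra. }
    assert (F : Cmod (h s * / (1 + e * s)) <= M + e).
    { apply (max_modulus (fun w => h w * / (1 + e * w))%C 1 (1 + X) (- X) X).
      - unfold inside, X. lra.
      - intros w [Hw _]. destruct (Hh w) as [l Hl]; [lra|]. eexists.
        apply (cderiv_mult h (fun w => / (1 + e * w))%C); [exact Hl|].
        apply cderiv_inv; [|apply Hn; lra].
        apply cderiv_plus; [apply cderiv_const | apply cderiv_scal, cderiv_id].
      - intros w Hw.
        assert (Hw1 : 1 <= Re w) by (destruct Hw as [Hw|[[Hw|Hw] _]]; unfold X in *; lra).
        rewrite Cmod_mult, Cmod_inv by (apply Hn; lra).
        destruct (Ne e w He) as [N1 N2]; [lra|].
        assert (0 < e * Re w) by (apply Rmult_lt_0_compat; lra).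
        destruct (excluded_middle_informative (Re w = 1)) as [E1|E1].
        + assert (/ Cmod (1 + e * w) <= 1) by (apply Rle_trans with (/ 1); [apply Rinv_le_contravar; lra | lra]).
          assert (0 < / Cmod (1 + e * w)) by (apply Rinv_0_lt_compat; lra).
          pose proof (Cmod_ge_0 (h w)). specialize (HM w E1). nra.
        + assert (G : e * X <= Cmod (1 + e * w)).
          { destruct Hw as [[_ [E2|E2]]|[[E2|E2] _]].
            - rewrite E2, Rabs_Ropp, Rabs_pos_eq in N2 by (unfold X; lra). lra.
            - rewrite E2, Rabs_pos_eq in N2 by (unfold X; lra). lra.
            - lra.
            - rewrite E2 in N1. lra. }
          assert (0 < e * X) by (apply Rmult_lt_0_compat; unfold X; lra).
          apply Rle_trans with (B * / (e * X)); [|lra].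
          apply Rmult_le_compat; auto using Cmod_ge_0.
          * left. apply Rinv_0_lt_compat. lra.
          * apply Rinv_le_contravar; lra. }
    replace (h s) with (h s * / (1 + e * s) * (1 + e * s))%C.
    2:{ field. apply Hn. lra. }
    rewrite Cmod_mult. apply Rmult_le_compat; auto using Cmod_ge_0.
    eapply Rle_trans; [apply Cmod_triangle|]. rewrite Cmod_mult, Cmod_1, Cmod_R, Rabs_pos_eq; lra. }
  apply le_epsilon. intros eps Heps.
  pose proof (Cmod_ge_0 s) as Hm. set (m := Cmod s) in *.
  (* For e <= 1, (M + e)(1 + e m) <= M + e Q. *)
  set (Q := 1 + M * m + m).
  assert (HQ : 0 < Q) by (unfold Q; assert (0 <= M * m) by (apply Rmult_le_pos; lra); lra).
  set (e := Rmin 1 (eps / Q)).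
  assert (He : 0 < e) by (apply Rmin_glb_lt; [lra | apply Rdiv_lt_0_compat; lra]).
  assert (He1 : e <= 1) by apply Rmin_l.
  assert (He2 : e * Q <= eps).
  { apply Rle_trans with (eps / Q * Q); [apply Rmult_le_compat_r; [lra | apply Rmin_r] | right; field; lra]. }
  specialize (K e He).
  assert (e * (e * m) <= 1 * (e * m)) by (apply Rmult_le_compat_r; [apply Rmult_le_pos; lra | lra]).
  unfold Q in He2. nra.
Qed.

(* If [D] vanishes far to the right, [D w / (w - c)^n] is holomorphic for [c] far right; the maximum
   principle on a square centred at [c] then gives [|D z| <= M (|z - c| / rho)^n] for all [n]. *)
Lemma identity_far_right theta D : hol 0 D -> (forall s, theta < Re s -> D s = 0) ->
  forall s, 0 < Re s -> D s = 0.
Proof.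
  intros HD H0 z Hz.
  set (X := 1 + Rabs theta).
  assert (HX : 0 < X) by (generalize (Rabs_pos theta); unfold X; lra).
  (* With these choices |z - c| = X < rho, the left side of the square about c has real part Re z /
     2 > 0, and c lies where D vanishes. *)
  set (c := (z + X)%C). set (rho := X + Re z / 2).
  assert (Rc : Re c = Re z + X) by (destruct z; simpl; ring).
  assert (Ic : Im c = Im z) by (destruct z; simpl; ring).
  assert (Hc : theta < Re c) by (generalize (Rle_abs theta); unfold X in *; lra).
  assert (HI : inside (Re c - rho) (Re c + rho) (Im c - rho) (Im c + rho) z)
    by (unfold inside, rho; rewrite Rc, Ic; lra).
  destruct (ccont_bounded_bdry D (Re c - rho) (Re c + rho) (Im c - rho) (Im c + rho)) as [M [HM0 HM]].
  { unfold rho; lra. } { unfold rho; lra. }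
  { intros w Hw. apply bdry_rect in Hw; [|unfold rho; lra|unfold rho; lra].
    apply (hol_ccont 0); auto. destruct Hw. unfold rho in *. lra. }
  assert (K : forall n, Cmod (D z) * rho ^ n <= M * X ^ n).
  { intros n.
    assert (F : Cmod (D z * (/ (z - c)) ^ n) <= M * (/ rho) ^ n).
    { apply (max_modulus (fun w => D w * (/ (w - c)) ^ n)%C _ _ _ _ _ _ HI).
      - intros w [Hw _].
        (* Right of theta the product is identically 0, at c too, whatever the inverse of 0 is;
           elsewhere w differs from c. *)
        destruct (Rlt_le_dec theta (Re w)) as [Ht|Ht].
        + exists (RtoC 0). apply (cderiv_ext_near (fun _ => 0)); [|apply cderiv_const].
          exists (Re w - theta). split; [lra|]. intros u Hu. rewrite H0; [ring|].
          apply re_near in Hu. lra.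
        + destruct (HD w) as [l Hl]; [unfold rho in *; lra|].
          assert (Hne : (w - c)%C <> 0).
          { apply C_sub_neq_0. intros E. rewrite E in Ht. lra. }
          destruct (cderiv_pow _ _ _ n (cderiv_Cinv_sub c w Hne)) as [l' Hl'].
          eexists. apply (cderiv_mult D (fun w => (/ (w - c)) ^ n)%C); eassumption.
      - intros w Hw. rewrite Cmod_mult, Cmod_pow.
        apply Rmult_le_compat; auto using Cmod_ge_0.
        + apply pow_le, Cmod_ge_0.
        + apply pow_incr. split; [apply Cmod_ge_0|].
          apply Cinv_le; [unfold rho; lra|].
          apply (bdry_dist_ge _ _ _ _ _ _ _ Hw); lra. }
    replace (z - c)%C with (- RtoC X)%C in F by (unfold c; ring).
    rewrite Cmod_mult, Cmod_pow, Cmod_inv, Cmod_opp, Cmod_R, Rabs_pos_eq, !pow_inv in F.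
    2: lra. 2:{ apply Cmod_gt_0. rewrite Cmod_opp, Cmod_R, Rabs_pos_eq; lra. }
    assert (0 < X ^ n) by now apply pow_lt.
    assert (0 < rho ^ n) by (apply pow_lt; unfold rho; lra).
    apply Rmult_le_compat_r with (r := X ^ n * rho ^ n) in F; [|apply Rmult_le_pos; lra].
    replace (Cmod (D z) * / X ^ n * (X ^ n * rho ^ n)) with (Cmod (D z) * rho ^ n) in F by (field; lra).
    replace (M * / rho ^ n * (X ^ n * rho ^ n)) with (M * X ^ n) in F by (field; lra).
    exact F. }
  destruct (excluded_middle_informative (D z = 0)) as [|E]; [assumption|exfalso].
  apply Cmod_gt_0 in E.
  assert (rho <= X); [|unfold rho in *; lra].
  apply (pow_le_scal_le rho X (M / Cmod (D z))); [unfold rho; lra | lra |].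
  intros n. specialize (K n).
  apply Rmult_le_reg_r with (Cmod (D z)); [auto|].
  replace (M / Cmod (D z) * X ^ n * Cmod (D z)) with (M * X ^ n) by (field; lra). lra.
Qed.

(** * Dirichlet series *)

Lemma exp_nonneg (x : R) : 0 <= exp x.
Proof. left. apply exp_pos. Qed.

Lemma mult_exp_nonneg (u x : R) : 0 <= u -> 0 <= u * exp x.
Proof. intros H. apply Rmult_le_pos; [exact H | apply exp_nonneg]. Qed.

Lemma Cexp_plus (z w : C) : Cexp (z + w) = (Cexp z * Cexp w)%C.
Proof.
  destruct z as [x y], w as [u v]. unfold Cexp, Cmult; simpl.
  rewrite exp_plus, cos_plus, sin_plus. f_equal; ring.
Qed.

Lemma Cexp_0 : Cexp 0 = 1.
Proof. unfold Cexp; simpl. rewrite exp_0, cos_0, sin_0. unfold RtoC. f_equal; ring. Qed.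

Lemma Cmod_Cexp (z : C) : Cmod (Cexp z) = exp (Re z).
Proof.
  unfold Cexp, Cmod; simpl.
  replace (exp (Re z) * cos (Im z) * (exp (Re z) * cos (Im z) * 1) +
     exp (Re z) * sin (Im z) * (exp (Re z) * sin (Im z) * 1))
   with (Rsqr (exp (Re z)) * (Rsqr (sin (Im z)) + Rsqr (cos (Im z)))) by (unfold Rsqr; ring).
  rewrite sin2_cos2, Rmult_1_r. apply sqrt_Rsqr. apply exp_nonneg.
Qed.

Lemma is_derive_eps (f : R -> R) (x l eps : R) : is_derive f x l -> 0 < eps ->
  exists del, 0 < del /\ forall h, Rabs h < del -> Rabs (f (x + h) - f x - l * h) <= eps * Rabs h.
Proof.
  intros [_ H] Heps.
  destruct (H x (fun P HP => HP) (mkposreal eps Heps)) as [del Hdel].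
  exists del. split; [apply cond_pos|]. intros h Hh.
  assert (B : ball (M := AbsRing_UniformSpace R_AbsRing) x del (x + h)).
  { change (Rabs (x + h - x) < del). replace (x + h - x) with h by ring. exact Hh. }
  specialize (Hdel (x + h) B).
  change (Rabs (f (x + h) - f x - (x + h - x) * l) <= eps * Rabs (x + h - x)) in Hdel.
  replace (x + h - x) with h in Hdel by ring. rewrite (Rmult_comm h l) in Hdel. exact Hdel.
Qed.

Lemma cderiv_Cexp_0 : cderiv Cexp 0 1.
Proof.
  intros eps Heps.
  (* The four error terms below add up to at most 6 e |w|, and e <= 1 keeps exp x <= 2. *)
  set (e := Rmin 1 (eps / 8)).
  assert (He : 0 < e) by (unfold e; apply Rmin_glb_lt; lra).
  assert (He8 : 8 * e <= eps) by (generalize (Rmin_r 1 (eps / 8)); unfold e; lra).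
  assert (He1 : e <= 1) by apply Rmin_l.
  destruct (is_derive_eps exp 0 1 e) as [d1 [Hd1 H1]]; [|auto|].
  { pose proof (is_derive_exp 0) as K. rewrite exp_0 in K. exact K. }
  destruct (is_derive_eps cos 0 0 e) as [d2 [Hd2 H2]]; [|auto|].
  { pose proof (is_derive_cos 0) as K. rewrite sin_0, Ropp_0 in K. exact K. }
  destruct (is_derive_eps sin 0 1 e) as [d3 [Hd3 H3]]; [|auto|].
  { pose proof (is_derive_sin 0) as K. rewrite cos_0 in K. exact K. }
  exists (Rmin (Rmin d1 d2) (Rmin d3 (e / 2))). split; [repeat apply Rmin_glb_lt; lra|].
  intros [x y] Hw.
  replace ((x, y) - 0)%C with ((x, y) : C) in * by (unfold Cminus, Cplus, Copp, RtoC; simpl; f_equal; ring).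
  rewrite Cexp_0.
  pose proof (re_le_Cmod (x, y)) as Kx. pose proof (im_le_Cmod (x, y)) as Ky. simpl in Kx, Ky.
  set (m := Cmod (x, y)) in *.
  generalize (Rmin_l (Rmin d1 d2) (Rmin d3 (e / 2))) (Rmin_r (Rmin d1 d2) (Rmin d3 (e / 2)))
    (Rmin_l d1 d2) (Rmin_r d1 d2) (Rmin_l d3 (e / 2)) (Rmin_r d3 (e / 2)). intros.
  specialize (H1 x ltac:(lra)). specialize (H2 y ltac:(lra)). specialize (H3 y ltac:(lra)).
  rewrite Rplus_0_l, ?exp_0, ?cos_0, ?sin_0 in *.
  assert (E1 : Rabs (exp x - 1) <= e).
  { replace (exp x - 1) with ((exp x - 1 - 1 * x) + x) by ring.
    eapply Rle_trans; [apply Rabs_triang|].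
    assert (e * Rabs x <= 1 * Rabs x) by (apply Rmult_le_compat_r; [apply Rabs_pos | lra]). lra. }
  assert (E3 : 0 < exp x <= 2) by (split; [apply exp_pos | apply Rabs_le_between in E1; lra]).
  replace (Cexp (x, y) - 1 - 1 * (x, y))%C with
    ((exp x - 1 - 1 * x) + exp x * (cos y - 1 - 0 * y), (exp x - 1) * y + exp x * (sin y - 0 - 1 * y)).
  2:{ unfold Cexp, Cminus, Cplus, Copp, Cmult, RtoC; simpl. f_equal; ring. }
  eapply Rle_trans; [apply Cmod_le_abs_sum|].
  eapply Rle_trans; [apply Rplus_le_compat; apply Rabs_triang|].
  rewrite !Rabs_mult, (Rabs_pos_eq (exp x)) by lra.
  assert (Q1 : exp x * Rabs (cos y - 1 - 0 * y) <= 2 * (e * m)).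
  { apply Rmult_le_compat; [lra | apply Rabs_pos | lra |].
    eapply Rle_trans; [apply H2|]. apply Rmult_le_compat_l; lra. }
  assert (Q2 : exp x * Rabs (sin y - 0 - 1 * y) <= 2 * (e * m)).
  { apply Rmult_le_compat; [lra | apply Rabs_pos | lra |].
    eapply Rle_trans; [apply H3|]. apply Rmult_le_compat_l; lra. }
  assert (Q3 : Rabs (exp x - 1) * Rabs y <= e * m).
  { apply Rmult_le_compat; try apply Rabs_pos; lra. }
  assert (Q4 : e * Rabs x <= e * m) by (apply Rmult_le_compat_l; lra).
  assert (0 <= m) by apply Cmod_ge_0.
  assert (8 * e * m <= eps * m) by (apply Rmult_le_compat_r; lra).
  nra.
Qed.

Lemma cderiv_Cexp (z : C) : cderiv Cexp z (Cexp z).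
Proof.
  assert (H : cderiv (fun w => Cexp z * Cexp (w - z))%C z (Cexp z * (1 * (1 - 0)))%C).
  { apply cderiv_scal. apply (cderiv_comp (fun w => w - z)%C).
    - apply cderiv_minus; [apply cderiv_id | apply cderiv_const].
    - replace (z - z)%C with (RtoC 0) by ring. apply cderiv_Cexp_0. }
  replace (Cexp z * (1 * (1 - 0)))%C with (Cexp z) in H by ring.
  eapply cderiv_ext; [|exact H]. intros w. cbv beta. rewrite <- Cexp_plus. f_equal. ring.
Qed.

Lemma exp_le_mono (x y : R) : x <= y -> exp x <= exp y.
Proof. intros [H| ->]; [left; now apply exp_increasing | right; reflexivity]. Qed.

Lemma Cexp_bound_1 (h : C) (m : R) : Cmod h <= m -> Cmod (Cexp h - 1) <= Cmod h * exp m.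
Proof.
  intros Hm.
  assert (H : Cmod (Cexp (0 + 1 * h) - Cexp (0 + 0 * h)) <= Cmod h * exp m * 1 - Cmod h * exp m * 0).
  { apply (cderiv_increment_le Cexp Cexp (fun t => Cmod h * exp m * t) (fun _ => Cmod h * exp m)); [lra| | |].
    - intros t _. apply cderiv_Cexp.
    - intros t _. auto_derive; [auto | ring].
    - intros t Ht. rewrite Cmod_mult, Cmod_Cexp, Rmult_comm.
      apply Rmult_le_compat_l; [apply Cmod_ge_0|]. apply exp_le_mono.
      replace (Re (0 + t * h)) with (t * Re h) by (destruct h; simpl; ring).
      pose proof (re_le_Cmod h). pose proof (Rle_abs (Re h)). pose proof (Rabs_pos (Re h)). nra. }
  replace (0 + 1 * h)%C with h in H by ring.
  replace (0 + 0 * h)%C with (RtoC 0) in H by ring. rewrite Cexp_0 in H. lra.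
Qed.

(** The mean value inequality for [Cexp] minus the identity, whose derivative is controlled by
    [Cexp_bound_1]. It supplies the quadratic remainder for differentiating Dirichlet series term by
    term. *)
Lemma Cexp_bound_2 (h : C) : Cmod (Cexp h - 1 - h) <= Cmod h ^ 2 * exp (Cmod h).
Proof.
  set (m := Cmod h).
  assert (H : Cmod ((Cexp (0 + 1 * h) - (0 + 1 * h)) - (Cexp (0 + 0 * h) - (0 + 0 * h)))
     <= m ^ 2 * exp m * 1 - m ^ 2 * exp m * 0).
  { apply (cderiv_increment_le (fun w => Cexp w - w)%C (fun w => Cexp w - 1)%C
      (fun t => m ^ 2 * exp m * t) (fun _ => m ^ 2 * exp m)); [lra| | |].
    - intros t _. apply cderiv_minus; [apply cderiv_Cexp | apply cderiv_id].
    - intros t _. auto_derive; [auto | ring].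
    - intros t Ht. rewrite Cmod_mult. fold m.
      assert (0 <= m) by apply Cmod_ge_0.
      assert (Hth : Cmod (0 + t * h) <= m).
      { replace (0 + t * h)%C with (t * h)%C by ring. rewrite Cmod_mult, Cmod_R, Rabs_pos_eq by lra.
        fold m. nra. }
      pose proof (Cexp_bound_1 _ _ Hth) as K. pose proof (exp_pos m).
      assert (Cmod (0 + t * h) * exp m <= m * exp m) by (apply Rmult_le_compat_r; lra).
      replace (m ^ 2 * exp m) with (m * exp m * m) by ring.
      apply Rmult_le_compat_r; lra. }
  replace (0 + 1 * h)%C with h in H by ring.
  replace (0 + 0 * h)%C with (RtoC 0) in H by ring. rewrite Cexp_0 in H.
  replace (Cexp h - 1 - h)%C with ((Cexp h - h) - (1 - 0))%C by ring. lra.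
Qed.

(** * Series of complex numbers *)

Definition cseries (u : nat -> C) : C := (Series (fun n => Re (u n)), Series (fun n => Im (u n))).

Lemma ex_series_Re (u : nat -> C) : ex_series (fun n => Cmod (u n)) -> ex_series (fun n => Re (u n)).
Proof.
  apply (ex_series_le (K := R_AbsRing) (V := R_CompleteNormedModule)). intros n. apply (re_le_Cmod (u n)).
Qed.

Lemma ex_series_Im (u : nat -> C) : ex_series (fun n => Cmod (u n)) -> ex_series (fun n => Im (u n)).
Proof.
  apply (ex_series_le (K := R_AbsRing) (V := R_CompleteNormedModule)). intros n. apply (im_le_Cmod (u n)).
Qed.

Lemma ex_series_bound (a b : nat -> R) :
  (forall n, 0 <= a n <= b n) -> ex_series b -> ex_series a.
Proof.
  intros H. apply (ex_series_le (K := R_AbsRing) (V := R_CompleteNormedModule)).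
  intros n. change (Rabs (a n) <= b n). rewrite Rabs_pos_eq; apply H.
Qed.

Lemma ex_series_scal_R (k : R) (a : nat -> R) : ex_series a -> ex_series (fun n => k * a n).
Proof. apply (ex_series_scal (V := R_NormedModule)). Qed.

Lemma cseries_scal (k : C) (u : nat -> C) : ex_series (fun n => Cmod (u n)) ->
  cseries (fun n => k * u n)%C = (k * cseries u)%C.
Proof.
  intros H. pose proof (ex_series_Re u H) as H1. pose proof (ex_series_Im u H) as H2.
  unfold cseries, Cmult; simpl. f_equal.
  - rewrite <- !Series_scal_l, <- Series_minus; auto;
    now apply ex_series_scal_R.
  - rewrite <- !Series_scal_l, <- Series_plus; auto;
    now apply ex_series_scal_R.
Qed.

Lemma cseries_minus (u v : nat -> C) :
  ex_series (fun n => Cmod (u n)) -> ex_series (fun n => Cmod (v n)) ->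
  cseries (fun n => u n - v n)%C = (cseries u - cseries v)%C.
Proof.
  intros Hu Hv. unfold cseries, Cminus, Cplus, Copp; simpl. f_equal; apply Series_minus;
  (apply ex_series_Re || apply ex_series_Im); auto.
Qed.

Lemma cseries_ext (u v : nat -> C) : (forall n, u n = v n) -> cseries u = cseries v.
Proof. intros H. unfold cseries. f_equal; apply Series_ext; intros n; now rewrite H. Qed.

(** Rotating the sum onto the positive real axis by [unit_phase] leaves a comparison of real
    series. *)
Lemma cseries_bound (u : nat -> C) (b : nat -> R) :
  (forall n, Cmod (u n) <= b n) -> ex_series b -> Cmod (cseries u) <= Series b.
Proof.
  intros Hb Eb.
  assert (Hu : ex_series (fun n => Cmod (u n))).
  { apply ex_series_bound with b; auto. intros n. split; [apply Cmod_ge_0 | auto]. }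
  set (D := cseries u).
  destruct (unit_phase D) as [k [Hk E1]].
  rewrite <- E1. unfold D. rewrite <- cseries_scal by auto. simpl.
  assert (Hb' : forall n, Rabs (Re (k * u n)) <= b n).
  { intros n. eapply Rle_trans; [apply re_le_Cmod|].
    rewrite Cmod_mult. specialize (Hb n). generalize (Cmod_ge_0 (u n)). nra. }
  apply Rle_trans with (Series (fun n => Rabs (Re (k * u n)))).
  - eapply Rle_trans; [apply Rle_abs | apply Series_Rabs].
    apply ex_series_bound with b; auto. intros n. split; [apply Rabs_pos | auto].
  - apply Series_le; auto. intros n. split; [apply Rabs_pos | auto].
Qed.

Lemma sum_n_Re (u : nat -> C) (n : nat) :
  Re (sum_n (G := C_AbelianGroup) u n) = sum_n (fun n => Re (u n)) n.
Proof.
  induction n as [|n IH].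
  - now rewrite !sum_O.
  - rewrite !sum_Sn, <- IH. reflexivity.
Qed.

Lemma sum_n_Im (u : nat -> C) (n : nat) :
  Im (sum_n (G := C_AbelianGroup) u n) = sum_n (fun n => Im (u n)) n.
Proof.
  induction n as [|n IH].
  - now rewrite !sum_O.
  - rewrite !sum_Sn, <- IH. reflexivity.
Qed.

Lemma ex_series_C_of_abs (u : nat -> C) : ex_series (fun n => Cmod (u n)) ->
  ex_series (K := C_AbsRing) (V := C_NormedModule) u.
Proof.
  intros H. destruct (ex_series_Re u H) as [l1 H1]. destruct (ex_series_Im u H) as [l2 H2].
  exists (l1, l2). apply filterlim_locally. intros eps.
  pose proof (proj1 (filterlim_locally _ _) H1 eps) as G1.
  pose proof (proj1 (filterlim_locally _ _) H2 eps) as G2.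
  generalize (filter_and _ _ G1 G2). apply filter_imp. intros n [K1 K2].
  split; [rewrite <- sum_n_Re in K1; exact K1 | rewrite <- sum_n_Im in K2; exact K2].
Qed.

Lemma ex_series_C_Re (u : nat -> C) : ex_series (K := C_AbsRing) (V := C_NormedModule) u ->
  ex_series (fun n => Re (u n)) /\ ex_series (fun n => Im (u n)).
Proof.
  intros [[l1 l2] H]. split; [exists l1 | exists l2]; apply filterlim_locally; intros eps;
  generalize (proj1 (filterlim_locally _ _) H eps); apply filter_imp; intros n [K1 K2].
  - rewrite <- sum_n_Re. exact K1.
  - rewrite <- sum_n_Im. exact K2.
Qed.

Lemma ex_series_terms_bounded (u : nat -> R) : ex_series u -> exists B, forall n, Rabs (u n) <= B.
Proof.
  intros H%ex_series_lim_0.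
  destruct (filterlim_bounded (K := R_AbsRing) (V := R_NormedModule) u) as [B HB].
  - exists 0. exact H.
  - exists B. exact HB.
Qed.

Lemma ex_series_C_terms_bounded (u : nat -> C) :
  ex_series (K := C_AbsRing) (V := C_NormedModule) u -> exists B, forall n, Cmod (u n) <= B.
Proof.
  intros [H1 H2]%ex_series_C_Re.
  destruct (ex_series_terms_bounded _ H1) as [B1 HB1].
  destruct (ex_series_terms_bounded _ H2) as [B2 HB2].
  exists (B1 + B2). intros n. specialize (HB1 n). specialize (HB2 n).
  destruct (u n) as [x y]. eapply Rle_trans; [apply Cmod_le_abs_sum|]. simpl in *. lra.
Qed.

(** * Absolutely convergent Dirichlet series *)

Lemma dirichlet_sum_cseries (a : nat -> C) (s : C) : dirichlet_sum a s = cseries (dirichlet_term a s).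
Proof. reflexivity. Qed.

Lemma INR_S_ge_1 (n : nat) : 1 <= INR (S n).
Proof. change 1 with (INR 1). apply le_INR. lia. Qed.

Lemma ln_le_mono (x y : R) : 0 < x -> x <= y -> ln x <= ln y.
Proof. intros Hx [H| ->]; [left; now apply ln_increasing | right; reflexivity]. Qed.

Lemma ln_INR_S_ge_0 (n : nat) : 0 <= ln (INR (S n)).
Proof. rewrite <- ln_1. apply ln_le_mono; [lra | apply INR_S_ge_1]. Qed.

Lemma ln_INR_SS_ge (n : nat) : ln 2 <= ln (INR (S (S n))).
Proof. apply ln_le_mono; [lra|]. change 2 with (INR 2). apply le_INR. lia. Qed.

Lemma ln_2_pos : 0 < ln 2.
Proof. rewrite <- ln_1. apply ln_increasing; lra. Qed.

(** Absolute convergence on the line Re s = x, hence on Re s >= x. The series are only handled in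
    such half-planes, which every element of D has by [in_D_abs_conv]. *)
Definition abs_conv (a : nat -> C) (x : R) : Prop :=
  ex_series (fun n => Cmod (a (S n)) * exp (- (x * ln (INR (S n))))).

Lemma Cmod_dirichlet_term (a : nat -> C) (s : C) (n : nat) :
  Cmod (dirichlet_term a s n) = Cmod (a (S n)) * exp (- (Re s * ln (INR (S n)))).
Proof.
  unfold dirichlet_term. rewrite Cmod_mult, Cmod_Cexp. f_equal. f_equal.
  generalize (ln (INR (S n))). intros L. destruct s. simpl. ring.
Qed.

Lemma dirichlet_term_le (a : nat -> C) (s : C) (x : R) (n : nat) : x <= Re s ->
  Cmod (dirichlet_term a s n) <= Cmod (a (S n)) * exp (- (x * ln (INR (S n)))).
Proof.
  intros H. rewrite Cmod_dirichlet_term. apply Rmult_le_compat_l; [apply Cmod_ge_0|].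
  apply exp_le_mono. pose proof (ln_INR_S_ge_0 n). nra.
Qed.

Lemma abs_conv_term (a : nat -> C) (s : C) (x : R) : abs_conv a x -> x <= Re s ->
  ex_series (fun n => Cmod (dirichlet_term a s n)).
Proof.
  intros H Hs. eapply ex_series_bound; [|exact H]. intros n.
  split; [apply Cmod_ge_0 | now apply dirichlet_term_le].
Qed.

Lemma abs_conv_mono (a : nat -> C) (x y : R) : x <= y -> abs_conv a x -> abs_conv a y.
Proof.
  intros Hxy H.
  apply (ex_series_ext (fun n => Cmod (dirichlet_term a (RtoC y) n))).
  - intros n. apply Cmod_dirichlet_term.
  - now apply abs_conv_term with x.
Qed.

Lemma abs_conv_le (a b : nat -> C) (x K : R) : (forall n, Cmod (b (S n)) <= K * Cmod (a (S n))) ->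
  abs_conv a x -> abs_conv b x.
Proof.
  intros Hb H.
  apply ex_series_bound with (fun n => K * (Cmod (a (S n)) * exp (- (x * ln (INR (S n)))))).
  - intros n. pose proof (exp_pos (- (x * ln (INR (S n))))). split.
    + apply Rmult_le_pos; [apply Cmod_ge_0 | lra].
    + rewrite <- Rmult_assoc. apply Rmult_le_compat_r; [lra | auto].
  - now apply ex_series_scal_R.
Qed.

Lemma abs_conv_in_D (a : nat -> C) (x : R) : abs_conv a x -> in_D a.
Proof.
  intros H. exists x. intros s Hs. apply ex_series_C_of_abs. apply abs_conv_term with x; auto.
  left. exact Hs.
Qed.

(** The coefficients of the derivative of the series. *)
Definition dlog (a : nat -> C) (n : nat) : C := (- ln (INR n) * a n)%C.

Lemma Cmod_dlog (a : nat -> C) (n : nat) : Cmod (dlog a (S n)) = ln (INR (S n)) * Cmod (a (S n)).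
Proof.
  unfold dlog. rewrite Cmod_mult, Cmod_opp, Cmod_R, Rabs_pos_eq; [reflexivity | apply ln_INR_S_ge_0].
Qed.

Lemma dirichlet_term_dlog (a : nat -> C) (s : C) (n : nat) :
  dirichlet_term (dlog a) s n = (- ln (INR (S n)) * dirichlet_term a s n)%C.
Proof. unfold dirichlet_term, dlog. ring. Qed.

(** With L = ln n: a logarithm is absorbed by the power n^(-d), because 1 + d L <= exp (d L). *)
Lemma mult_exp_neg_le (L d : R) : 0 < d -> L * exp (- (d * L)) <= / d.
Proof.
  intros Hd. pose proof (exp_ineq1_le (d * L)).
  assert (E : exp (- (d * L)) * exp (d * L) = 1).
  { rewrite <- exp_plus. replace (- (d * L) + d * L) with 0 by ring. apply exp_0. }
  pose proof (exp_pos (- (d * L))).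
  apply Rmult_le_reg_l with d; [auto|]. rewrite Rinv_r by lra.
  nra.
Qed.

Lemma abs_conv_dlog (a : nat -> C) (x y : R) : x < y -> abs_conv a x -> abs_conv (dlog a) y.
Proof.
  intros Hxy H.
  apply ex_series_bound with (fun n => / (y - x) * (Cmod (a (S n)) * exp (- (x * ln (INR (S n)))))).
  - intros n. rewrite Cmod_dlog. pose proof (ln_INR_S_ge_0 n) as HL. pose proof (Cmod_ge_0 (a (S n))) as Ha.
    set (L := ln (INR (S n))) in *.
    split.
    + repeat apply Rmult_le_pos; auto. apply exp_nonneg.
    + replace (- (y * L)) with (- ((y - x) * L) + - (x * L)) by ring. rewrite exp_plus.
      pose proof (mult_exp_neg_le L (y - x)) as K.
      replace (L * Cmod (a (S n)) * (exp (- ((y - x) * L)) * exp (- (x * L))))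
        with (L * exp (- ((y - x) * L)) * (Cmod (a (S n)) * exp (- (x * L)))) by ring.
      apply Rmult_le_compat_r; [|apply K; lra].
      apply mult_exp_nonneg; auto using Cmod_ge_0.
  - now apply ex_series_scal_R.
Qed.

(** Each term is expanded by [Cexp_bound_2] at -h ln n, and the remainders are summed. The margin Re
    s - x = 2 d is spent on exp (d ln n), which bounds the exponential for |h| <= d, and, in two
    halves, on (ln n)^2. *)
Lemma cderiv_dirichlet_sum (a : nat -> C) (x : R) (s : C) : abs_conv a x -> x < Re s ->
  cderiv (dirichlet_sum a) s (dirichlet_sum (dlog a) s).
Proof.
  intros H Hs eps Heps.
  set (d := (Re s - x) / 2). assert (Hd : 0 < d) by (unfold d; lra).
  pose (b := fun n => Cmod (a (S n)) * exp (- (x * ln (INR (S n))))).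
  set (K := Series (fun n => / (d / 2) * / (d / 2) * b n)).
  assert (Eb : ex_series (fun n => / (d / 2) * / (d / 2) * b n))
    by now apply ex_series_scal_R.
  exists (Rmin d (eps / (1 + Rabs K))).
  assert (HK : 0 <= Rabs K) by apply Rabs_pos.
  split. { apply Rmin_glb_lt; [auto | apply Rdiv_lt_0_compat; lra]. }
  intros w Hw.
  destruct (Rlt_Rmin _ _ _ Hw) as [H1 H2].
  set (h := (w - s)%C) in *.
  pose proof (Cmod_ge_0 h) as Hh.
  assert (Hxw : x <= Re w) by (pose proof (re_near s w d H1); unfold d in *; lra).
  assert (T1 : ex_series (fun n => Cmod (dirichlet_term a w n))) by now apply abs_conv_term with x.
  assert (T2 : ex_series (fun n => Cmod (dirichlet_term a s n))) by (apply abs_conv_term with x; auto; lra).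
  assert (T3 : ex_series (fun n => Cmod (dirichlet_term (dlog a) s n))).
  { apply abs_conv_term with (x + d); [apply abs_conv_dlog with x; auto; lra | unfold d; lra]. }
  assert (T4 : ex_series (fun n => Cmod (h * dirichlet_term (dlog a) s n))).
  { apply (ex_series_ext (fun n => Cmod h * Cmod (dirichlet_term (dlog a) s n))).
    - intros n. now rewrite Cmod_mult.
    - now apply ex_series_scal_R. }
  assert (T5 : ex_series (fun n => Cmod (dirichlet_term a w n - dirichlet_term a s n))).
  { apply ex_series_bound with (fun n => Cmod (dirichlet_term a w n) + Cmod (dirichlet_term a s n)).
    - intros n. split; [apply Cmod_ge_0 | apply Cmod_triangle_sub].
    - now apply (ex_series_plus (V := R_NormedModule)). }
  replace (dirichlet_sum a w - dirichlet_sum a s - dirichlet_sum (dlog a) s * h)%C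
    with (cseries (fun n => dirichlet_term a w n - dirichlet_term a s n - h * dirichlet_term (dlog a) s n)%C).
  2:{ rewrite (cseries_minus (fun n => dirichlet_term a w n - dirichlet_term a s n)%C), cseries_minus,
        cseries_scal; auto. rewrite <- !dirichlet_sum_cseries. ring. }
  eapply Rle_trans.
  { apply cseries_bound with (b := fun n => Cmod h ^ 2 * (/ (d / 2) * / (d / 2) * b n)).
    - intros n. rewrite dirichlet_term_dlog.
      pose proof (ln_INR_S_ge_0 n) as HL. unfold b. set (L := ln (INR (S n))) in *.
      assert (E : dirichlet_term a w n = (dirichlet_term a s n * Cexp (- (h * L)))%C).
      { unfold dirichlet_term. fold L. rewrite <- Cmult_assoc, <- Cexp_plus. f_equal. f_equal.
        unfold h. ring. }
      rewrite E.
      replace (dirichlet_term a s n * Cexp (- (h * L)) - dirichlet_term a s n - h * (- L * dirichlet_term a s n))%C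
        with (dirichlet_term a s n * (Cexp (- (h * L)) - 1 - (- (h * L))))%C by ring.
      rewrite Cmod_mult, Cmod_dirichlet_term. fold L.
      pose proof (Cexp_bound_2 (- (h * L))) as B.
      rewrite Cmod_opp, Cmod_mult, Cmod_R, Rabs_pos_eq in B by auto.
      pose proof (Cmod_ge_0 (a (S n))) as Ha.
      apply Rle_trans with (Cmod (a (S n)) * exp (- (Re s * L)) * ((Cmod h * L) ^ 2 * exp (d * L))).
      { apply Rmult_le_compat_l; [apply mult_exp_nonneg; auto using Cmod_ge_0|].
        eapply Rle_trans; [apply B|]. apply Rmult_le_compat_l; [apply pow2_ge_0|].
        apply exp_le_mono. apply Rmult_le_compat_r; lra. }
      replace (- (Re s * L)) with (- (d / 2 * L) + (- (d / 2 * L) + (- (d * L) + - (x * L)))) by (unfold d; field).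
      rewrite !exp_plus.
      assert (Ed : exp (- (d * L)) * exp (d * L) = 1).
      { rewrite <- exp_plus. replace (- (d * L) + d * L) with 0 by ring. apply exp_0. }
      set (p := exp (- (d / 2 * L))).
      replace (Cmod (a (S n)) * (p * (p * (exp (- (d * L)) * exp (- (x * L))))) * ((Cmod h * L) ^ 2 * exp (d * L)))
        with (Cmod h ^ 2 * ((L * p) * (L * p) * (Cmod (a (S n)) * exp (- (x * L)))) * (exp (- (d * L)) * exp (d * L))) by ring.
      rewrite Ed, Rmult_1_r.
      apply Rmult_le_compat_l; [apply pow2_ge_0|].
      apply Rmult_le_compat_r; [apply mult_exp_nonneg; auto using Cmod_ge_0|].
      assert (P : 0 <= L * p <= / (d / 2)).
      { split; [apply mult_exp_nonneg; auto using Cmod_ge_0 | apply mult_exp_neg_le; lra]. }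
      apply Rmult_le_compat; lra.
    - now apply ex_series_scal_R. }
  rewrite Series_scal_l. fold K.
  pose proof (Rle_abs K).
  apply Rle_trans with (Cmod h * (1 + Rabs K) * Cmod h).
  - replace (Cmod h ^ 2 * K) with (Cmod h * K * Cmod h) by ring.
    apply Rmult_le_compat_r; [auto|]. apply Rmult_le_compat_l; lra.
  - apply Rmult_le_compat_r; [auto|].
    apply Rle_trans with (eps / (1 + Rabs K) * (1 + Rabs K)).
    + apply Rmult_le_compat_r; lra.
    + right. field. lra.
Qed.

Lemma hol_dirichlet_sum (a : nat -> C) (x : R) : abs_conv a x -> hol x (dirichlet_sum a).
Proof. intros H s Hs. eexists. now apply cderiv_dirichlet_sum with x. Qed.

Lemma C_derive_dirichlet_sum (a : nat -> C) (x : R) (s : C) : abs_conv a x -> x < Re s ->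
  C_derive (dirichlet_sum a) s = dirichlet_sum (dlog a) s.
Proof. intros H Hs. apply cderiv_C_derive. now apply cderiv_dirichlet_sum with x. Qed.

Lemma dirichlet_sum_bound (a : nat -> C) (s : C) (x : R) : abs_conv a x -> x <= Re s ->
  Cmod (dirichlet_sum a s) <= Series (fun n => Cmod (a (S n)) * exp (- (x * ln (INR (S n))))).
Proof. intros H Hs. apply cseries_bound; [intros n; now apply dirichlet_term_le | exact H]. Qed.

(** The power 2^(-x), the decay rate of a Dirichlet series without constant term. *)
Notation half_exp x := (exp (- (x * ln 2))).

(** Without the term n = 1, moving from real part x to Re s multiplies each term by n^(x - Re s) <=
    2^(x - Re s). *)
Lemma dirichlet_sum_decay (a : nat -> C) (x : R) : abs_conv a x -> a 1%nat = 0 ->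
  exists K, 0 <= K /\ forall s, x <= Re s ->
    Cmod (dirichlet_sum a s) <= K * half_exp (Re s).
Proof.
  intros H Ha.
  set (K := exp (x * ln 2) * Series (fun n => Cmod (a (S n)) * exp (- (x * ln (INR (S n)))))).
  exists K. split.
  { apply Rmult_le_pos; [apply exp_nonneg|].
    eapply Rle_trans; [apply Cmod_ge_0 | apply (dirichlet_sum_bound a (RtoC x) x)]; auto. simpl; lra. }
  intros s Hs. unfold K. rewrite Rmult_comm, <- Rmult_assoc, <- Series_scal_l.
  apply cseries_bound; [|now apply ex_series_scal_R].
  intros n. rewrite Cmod_dirichlet_term. destruct n as [|n].
  { rewrite Ha, Cmod_0. lra. }
  pose proof (ln_INR_SS_ge n) as HL. set (L := ln (INR (S (S n)))) in *.
  rewrite <- exp_plus, (Rmult_comm (exp _) (Cmod _ * _)), Rmult_assoc, <- exp_plus.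
  apply Rmult_le_compat_l; [apply Cmod_ge_0|]. apply exp_le_mono. nra.
Qed.

(** * The size of zeta near its pole *)

Lemma zeta_term_upper (sg : R) (n : nat) : 0 < sg ->
  sg * exp (- ((1 + sg) * ln (INR (S (S n))))) <=
  exp (- (sg * ln (INR (S n)))) - exp (- (sg * ln (INR (S (S n))))).
Proof.
  intros Hs. set (k := INR (S (S n))).
  assert (Ek : INR (S n) = k - 1) by (unfold k; rewrite (S_INR (S n)); ring).
  pose proof (INR_S_ge_1 n) as H1. rewrite Ek in *.
  assert (Hk : 2 <= k) by lra.
  set (L := ln k).
  (* This is ln (1 - 1/k) <= -1/k; with 1 + u <= exp u it compares sg k^(-1-sg) with (k-1)^(-sg) -
     k^(-sg). *)
  assert (HL : ln (k - 1) <= L - / k).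
  { replace (ln (k - 1)) with (L + ln (1 - / k)).
    - pose proof (exp_ineq1_le (- / k)).
      assert (/ k <= / 2) by (apply Rinv_le_contravar; lra).
      assert (ln (1 - / k) <= ln (exp (- / k))) by (apply ln_le_mono; lra).
      rewrite ln_exp in *. lra.
    - unfold L. rewrite <- ln_mult; [f_equal; field; lra | lra |].
      assert (/ k <= / 2) by (apply Rinv_le_contravar; lra). lra. }
  replace (- ((1 + sg) * L)) with (- (sg * L) + - L) by ring. rewrite exp_plus, (exp_Ropp L).
  unfold L at 2. rewrite exp_ln by lra.
  assert (E : exp (- (sg * L)) * (1 + sg * / k) <= exp (- (sg * ln (k - 1)))).
  { apply Rle_trans with (exp (- (sg * L)) * exp (sg * / k)).
    - apply Rmult_le_compat_l; [apply exp_nonneg | apply exp_ineq1_le].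
    - rewrite <- exp_plus. apply exp_le_mono. nra. }
  lra.
Qed.

Lemma zeta_term_lower (sg : R) (n : nat) : 0 < sg ->
  exp (- (sg * ln (INR (S (S n))))) - exp (- (sg * ln (INR (S (S (S n)))))) <=
  sg * exp (- ((1 + sg) * ln (INR (S (S n))))).
Proof.
  intros Hs. rewrite (S_INR (S (S n))). set (k := INR (S (S n))).
  assert (Hk : 1 <= k) by apply INR_S_ge_1.
  set (L := ln k).
  assert (Hik : 0 < / k) by (apply Rinv_0_lt_compat; lra).
  assert (HL : ln (k + 1) <= L + / k).
  { replace (ln (k + 1)) with (L + ln (1 + / k)).
    - pose proof (exp_ineq1_le (/ k)).
      assert (ln (1 + / k) <= ln (exp (/ k))) by (apply ln_le_mono; lra).
      rewrite ln_exp in *. lra.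
    - unfold L. rewrite <- ln_mult; [f_equal; field; lra | lra | lra]. }
  replace (- ((1 + sg) * L)) with (- (sg * L) + - L) by ring. rewrite exp_plus, (exp_Ropp L).
  unfold L at 3. rewrite exp_ln by lra.
  assert (E : exp (- (sg * L)) * (1 + - (sg * / k)) <= exp (- (sg * ln (k + 1)))).
  { apply Rle_trans with (exp (- (sg * L)) * exp (- (sg * / k))).
    - apply Rmult_le_compat_l; [apply exp_nonneg | apply exp_ineq1_le].
    - rewrite <- exp_plus. apply exp_le_mono. nra. }
  lra.
Qed.

Lemma power_decay (sg : R) : 0 < sg -> is_lim_seq (fun n => exp (- (sg * ln (INR (S n))))) 0.
Proof.
  intros Hs. apply is_lim_seq_spec. intros eps.
  destruct (INR_unbounded (exp (- ln eps / sg))) as [N HN].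
  exists N. intros n Hn. rewrite Rminus_0_r, Rabs_pos_eq by (apply exp_nonneg).
  assert (HN' : exp (- ln eps / sg) < INR (S n)).
  { eapply Rlt_le_trans; [apply HN|]. apply le_INR. lia. }
  apply ln_increasing in HN'; [|apply exp_pos]. rewrite ln_exp in HN'.
  rewrite <- (exp_ln eps) by apply cond_pos. apply exp_increasing.
  apply Rmult_lt_compat_l with (r := sg) in HN'; [|auto].
  replace (sg * (- ln eps / sg)) with (- ln eps) in HN' by (field; lra). lra.
Qed.

(** The terms of zeta(1 + sg) - 1: the index is shifted by two, so the first term is 2^(-1-sg). *)
Definition zeta_tail (sg : R) (n : nat) : R := exp (- ((1 + sg) * ln (INR (S (S n))))).

Lemma telescope_is_series (u : nat -> R) : is_lim_seq u 0 -> is_series (fun n => u n - u (S n)) (u O).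
Proof.
  intros H.
  assert (E : forall n, sum_n (fun n => u n - u (S n)) n = u O - u (S n)).
  { intros n. induction n as [|n IH]; [now rewrite sum_O|].
    rewrite sum_Sn, IH. unfold plus; simpl. ring. }
  assert (L : is_lim_seq (fun n => u O - u (S n)) (u O)).
  { replace (Finite (u O)) with (Finite (u O - 0)) by (f_equal; ring).
    apply is_lim_seq_minus'; [apply is_lim_seq_const | now apply is_lim_seq_incr_1 in H]. }
  apply (is_lim_seq_ext _ (sum_n (fun n => u n - u (S n)))) in L; [exact L|]. intros n. now rewrite E.
Qed.

(** The integral test in telescoped form: sg k^(-1-sg) lies between k^(-sg) - (k+1)^(-sg) and
    (k-1)^(-sg) - k^(-sg), and k runs from 2. *)
Lemma zeta_tail_bounds (sg : R) : 0 < sg ->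
  ex_series (zeta_tail sg) /\ half_exp sg / sg <= Series (zeta_tail sg) <= / sg.
Proof.
  intros Hs.
  pose (u := fun n => exp (- (sg * ln (INR (S n))))).
  assert (S1 : is_series (fun n => u n - u (S n)) (u O)) by (apply telescope_is_series, power_decay; auto).
  assert (S2 : is_series (fun n => u (S n) - u (S (S n))) (u 1%nat)).
  { apply (telescope_is_series (fun n => u (S n))). apply -> is_lim_seq_incr_1. now apply power_decay. }
  assert (U0 : u O = 1).
  { unfold u. simpl. rewrite ln_1, Rmult_0_r, Ropp_0. apply exp_0. }
  assert (U1 : u 1%nat = half_exp sg) by reflexivity.
  assert (B1 : forall n, 0 <= zeta_tail sg n <= / sg * (u n - u (S n))).
  { intros n. split; [apply exp_nonneg|].
    apply Rmult_le_reg_l with sg; [auto|]. rewrite <- Rmult_assoc, Rinv_r, Rmult_1_l by lra.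
    now apply zeta_term_upper. }
  assert (B2 : forall n, / sg * (u (S n) - u (S (S n))) <= zeta_tail sg n).
  { intros n. apply Rmult_le_reg_l with sg; [auto|]. rewrite <- Rmult_assoc, Rinv_r, Rmult_1_l by lra.
    now apply zeta_term_lower. }
  assert (E1 : ex_series (fun n => / sg * (u n - u (S n)))).
  { apply ex_series_scal_R. now exists (u O). }
  assert (E : ex_series (zeta_tail sg)) by exact (ex_series_bound _ _ B1 E1).
  split; [exact E|]. split.
  - unfold Rdiv. rewrite Rmult_comm, <- U1, <- (is_series_unique _ _ S2), <- Series_scal_l.
    apply Series_le; auto. intros n. split; [|auto].
    apply Rmult_le_pos; [left; now apply Rinv_0_lt_compat|].
    assert (u (S (S n)) <= u (S n)); [|lra]. unfold u. apply exp_le_mono.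
    apply Ropp_le_contravar. apply Rmult_le_compat_l; [lra|]. apply ln_le_mono.
    + pose proof (INR_S_ge_1 (S n)). lra.
    + apply le_INR. lia.
  - replace (/ sg) with (/ sg * u O) by (rewrite U0; ring).
    rewrite <- (is_series_unique _ _ S1), <- Series_scal_l. now apply Series_le.
Qed.

(** The terms are bounded where the series converges, and two units further to the right they gain
    the factor n^(-2). *)
Lemma in_D_abs_conv (a : nat -> C) : in_D a -> exists x, abs_conv a x.
Proof.
  intros [theta H].
  assert (Ht : half_plane theta (RtoC (theta + 1))) by (unfold half_plane; simpl; lra).
  destruct (ex_series_C_terms_bounded _ (H _ Ht)) as [B HB].
  exists (theta + 3).
  assert (E : ex_series (fun n => exp (- ((1 + 1) * ln (INR (S n)))))).
  { apply (ex_series_incr_1 (V := R_NormedModule)). apply (zeta_tail_bounds 1). lra. }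
  apply ex_series_bound with (fun n => B * exp (- ((1 + 1) * ln (INR (S n))))).
  - intros n. split; [apply mult_exp_nonneg, Cmod_ge_0|].
    specialize (HB n). rewrite Cmod_dirichlet_term in HB. simpl Re in HB.
    replace (- ((theta + 3) * ln (INR (S n)))) with
      (- ((theta + 1) * ln (INR (S n))) + - ((1 + 1) * ln (INR (S n)))) by ring.
    rewrite exp_plus, <- Rmult_assoc. apply Rmult_le_compat_r; [apply exp_nonneg | exact HB].
  - now apply ex_series_scal_R.
Qed.

(** * Dirichlet convolution and the Volterra operator *)

(** Sums run from 1 to N, like Dirichlet coefficients. The ring is arbitrary because the same
    identities serve the coefficients and their moduli. *)
Fixpoint psum {K : Ring} (f : nat -> K) (N : nat) : K :=
  match N with O => zero | S k => plus (psum f k) (f (S k)) end.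

(** Dirichlet convolution. Running over all d <= n with a divisibility test makes it an ordinary
    finite sum. *)
Definition dconv {K : Ring} (x y : nat -> K) (n : nat) : K :=
  psum (fun d => if Nat.eqb (n mod d) 0 then mult (x d) (y (n / d)%nat) else zero) n.

Lemma psum_ext {K : Ring} (f g : nat -> K) (N : nat) :
  (forall d, (1 <= d <= N)%nat -> f d = g d) -> psum f N = psum g N.
Proof.
  induction N as [|N IH]; intros H; [reflexivity|]. simpl. rewrite IH, H; auto; try lia.
  intros d Hd. apply H. lia.
Qed.

Lemma psum_plus {K : Ring} (f g : nat -> K) (N : nat) :
  psum (fun d => plus (f d) (g d)) N = plus (psum f N) (psum g N).
Proof.
  induction N as [|N IH]; simpl; [now rewrite plus_zero_r|]. rewrite IH.
  rewrite <- !plus_assoc. f_equal. rewrite !plus_assoc. f_equal. apply plus_comm.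
Qed.

Lemma psum_mult_r {K : Ring} (f : nat -> K) (k : K) (N : nat) :
  psum (fun d => mult (f d) k) N = mult (psum f N) k.
Proof.
  induction N as [|N IH]; simpl; [now rewrite mult_zero_l|]. now rewrite IH, mult_distr_r.
Qed.

Lemma div_succ (N d : nat) : (1 <= d)%nat ->
  (S N / d)%nat = if Nat.eqb (S N mod d) 0 then S (N / d) else (N / d)%nat.
Proof.
  intros Hd.
  pose proof (Nat.div_mod N d ltac:(lia)) as E1. pose proof (Nat.mod_upper_bound N d ltac:(lia)) as U1.
  pose proof (Nat.div_mod (S N) d ltac:(lia)) as E2. pose proof (Nat.mod_upper_bound (S N) d ltac:(lia)) as U2.
  destruct (Nat.eqb_spec (S N mod d) 0) as [E|E].
  - rewrite E in E2. nia.
  - nia.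
Qed.

(** Counts the pairs (d, e) with d e <= N by their first member. In the induction the quotient N / d
    increases exactly for the divisors d of N + 1. *)
Lemma psum_dconv {K : Ring} (x y : nat -> K) (N : nat) :
  psum (dconv x y) N = psum (fun d => mult (x d) (psum y (N / d))) N.
Proof.
  induction N as [|N IH]; [reflexivity|].
  change (psum (dconv x y) (S N)) with (plus (psum (dconv x y) N) (dconv x y (S N))).
  rewrite IH. unfold dconv.
  (* The added summand d = N + 1 is zero, since N / (N + 1) = 0 makes its inner sum empty. *)
  replace (psum (fun d => mult (x d) (psum y (N / d))) N)
    with (psum (fun d => mult (x d) (psum y (N / d))) (S N)).
  2:{ change (plus (psum (fun d => mult (x d) (psum y (N / d))) N) (mult (x (S N)) (psum y (N / S N)))
        = psum (fun d => mult (x d) (psum y (N / d))) N).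
      rewrite (Nat.div_small N (S N)) by lia. change (psum y 0) with (zero : K).
      now rewrite mult_zero_r, plus_zero_r. }
  rewrite <- psum_plus. apply psum_ext. intros d Hd.
  rewrite (div_succ N d) by lia.
  destruct (Nat.eqb (S N mod d) 0).
  - simpl psum. now rewrite mult_distr_l.
  - now rewrite plus_zero_r.
Qed.

Notation psumC := (psum (K := C_Ring)).
Notation psumR := (psum (K := R_Ring)).

Lemma psum_le (f g : nat -> R) (N : nat) : (forall d, (1 <= d <= N)%nat -> f d <= g d) ->
  psumR f N <= psumR g N.
Proof.
  induction N as [|N IH]; intros H; simpl; [apply Rle_refl|].
  apply Rplus_le_compat; [apply IH; intros; apply H; lia | apply H; lia].
Qed.

Lemma psum_skip (f : nat -> R) (D N : nat) : (D <= N)%nat ->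
  psumR (fun d => if Nat.leb d D then 0 else f d) N
   = psumR f N - psumR f D.
Proof.
  induction N as [|N IH]; intros H.
  - replace D with O by lia. simpl. unfold zero; simpl. ring.
  - destruct (Nat.eq_dec D (S N)) as [->|Hne].
    + rewrite (psum_ext _ (fun _ => 0)).
      * rewrite Rminus_diag. generalize (S N). intros n. induction n as [|n IHn]; [reflexivity|].
        simpl. rewrite IHn. unfold plus; simpl. ring.
      * intros d Hd. now rewrite (proj2 (Nat.leb_le d (S N))) by lia.
    + change (psumR (fun d => if Nat.leb d D then 0 else f d) N
        + (if Nat.leb (S N) D then 0 else f (S N))
        = psumR f N + f (S N) - psumR f D).
      rewrite IH, (proj2 (Nat.leb_gt (S N) D)) by lia. ring.
Qed.

Lemma Cmod_psum_le (f : nat -> C) (g : nat -> R) (N : nat) :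
  (forall d, (1 <= d <= N)%nat -> Cmod (f d) <= g d) ->
  Cmod (psumC f N) <= psumR g N.
Proof.
  induction N as [|N IH]; intros H; simpl.
  - change (Cmod 0 <= 0). rewrite Cmod_0. lra.
  - eapply Rle_trans; [apply (Cmod_triangle (psumC f N) (f (S N)))|].
    apply Rplus_le_compat; [apply IH; intros; apply H; lia | apply H; lia].
Qed.

Lemma Cmod_dconv_le (x y : nat -> C) (n : nat) :
  Cmod (dconv (K := C_Ring) x y n) <= dconv (K := R_Ring) (fun d => Cmod (x d)) (fun d => Cmod (y d)) n.
Proof.
  apply Cmod_psum_le. intros d _. destruct (Nat.eqb (n mod d) 0).
  - right. apply Cmod_mult.
  - change (Cmod 0 <= 0). rewrite Cmod_0. lra.
Qed.

Lemma Series_psum (f : nat -> R) (N : nat) : ex_series (fun n => f (S n)) ->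
  ex_series (fun n => f (S (N + n)%nat)) /\
  Series (fun n => f (S n)) = psumR f N + Series (fun n => f (S (N + n)%nat)).
Proof.
  intros H. induction N as [|N [IH1 IH2]].
  - simpl. split; [exact H | unfold zero; simpl; ring].
  - assert (E : forall n, f (S (N + S n)) = f (S (S N + n))) by (intros; f_equal; lia).
    split.
    + apply (ex_series_incr_1 (V := R_NormedModule)) in IH1. now apply (ex_series_ext _ _ E).
    + rewrite IH2, Series_incr_1 by exact IH1. rewrite (Series_ext _ _ E), Nat.add_0_r.
      simpl psum. unfold plus; simpl. ring.
Qed.

Lemma cseries_psum (f : nat -> C) (N : nat) : ex_series (fun n => Cmod (f (S n))) ->
  cseries (fun n => f (S n)) = (psumC f N + cseries (fun n => f (S (N + n)%nat)))%C.
Proof.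
  intros H. induction N as [|N IH].
  - simpl. change (cseries (fun n => f (S n)) = (0 + cseries (fun n => f (S n)))%C). ring.
  - rewrite IH. simpl psum.
    destruct (Series_psum (fun n => Cmod (f n)) N H) as [HN _].
    assert (E : cseries (fun n => f (S (N + n)%nat)) = (f (S N) + cseries (fun n => f (S (S N + n)%nat)))%C).
    { unfold cseries at 1.
      rewrite (Series_incr_1 (fun n => Re (f (S (N + n)%nat)))) by now apply ex_series_Re in HN.
      rewrite (Series_incr_1 (fun n => Im (f (S (N + n)%nat)))) by now apply ex_series_Im in HN.
      rewrite Nat.add_0_r. unfold cseries, Cplus; simpl. unfold Re, Im. f_equal; f_equal; apply Series_ext;
      intros n; now rewrite Nat.add_succ_r. }
    rewrite E. change (plus (psumC f N) (f (S N))) with (psumC f N + f (S N))%C. ring.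
Qed.

Lemma sum_n_psum (f : nat -> R) (n : nat) : sum_n (fun n => f (S n)) n = psumR f (S n).
Proof.
  induction n as [|n IH].
  - rewrite sum_O. symmetry. apply (plus_zero_l (G := R_AbelianGroup)).
  - rewrite sum_Sn, IH. reflexivity.
Qed.

Lemma Series_nonneg (f : nat -> R) : (forall n, 0 <= f n) -> ex_series f -> 0 <= Series f.
Proof.
  intros H E. rewrite <- (Rmult_0_l (Series f)), <- Series_scal_l. apply Series_le; auto.
  intros n. specialize (H n). lra.
Qed.

Lemma psum_mult_sub (x z : nat -> C) (Y : C) (N : nat) :
  psumC (fun d => (x d * (Y - z d))%C) N
    = (psumC x N * Y - psumC (fun d => (x d * z d)%C) N)%C.
Proof.
  induction N as [|N IH].
  - change (RtoC 0 = 0 * Y - 0)%C. ring.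
  - change ((psumC (fun d => (x d * (Y - z d))%C) N + x (S N) * (Y - z (S N)))%C
      = ((psumC x N + x (S N)) * Y
         - (psumC (fun d => (x d * z d)%C) N + x (S N) * z (S N)))%C).
    rewrite IH. ring.
Qed.

Section ConvolutionSeries.
Variables (x y : nat -> C).
Hypotheses (Hx : ex_series (fun n => Cmod (x (S n)))) (Hy : ex_series (fun n => Cmod (y (S n)))).

Let ax := fun d => Cmod (x d).
Let ay := fun d => Cmod (y d).
Let XA := Series (fun n => ax (S n)).
Let YB := Series (fun n => ay (S n)).

Lemma tail_series (f : nat -> C) (N : nat) : ex_series (fun n => Cmod (f (S n))) ->
  0 <= Series (fun n => Cmod (f (S n))) - psumR (fun d => Cmod (f d)) N /\
  Cmod (cseries (fun n => f (S n)) - psumC f N)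
    <= Series (fun n => Cmod (f (S n))) - psumR (fun d => Cmod (f d)) N.
Proof.
  intros H. destruct (Series_psum (fun n => Cmod (f n)) N H) as [HN E].
  set (t := Series (fun n => Cmod (f (S n))) - psumR (fun d => Cmod (f d)) N).
  assert (Et : t = Series (fun n => Cmod (f (S (N + n)%nat)))) by (unfold t; rewrite E; ring).
  rewrite Et. split.
  - apply Series_nonneg; [intros; apply Cmod_ge_0 | exact HN].
  - rewrite (cseries_psum f N H).
    replace (psumC f N + cseries (fun n => f (S (N + n)%nat)) - psumC f N)%C
      with (cseries (fun n => f (S (N + n)%nat))) by ring.
    apply cseries_bound; [intros; apply Rle_refl | exact HN].
Qed.

Lemma tail_lim (f : nat -> R) (eps : R) : (forall n, 0 <= f n) -> ex_series (fun n => f (S n)) -> 0 < eps ->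
  exists N0, forall N, (N0 <= N)%nat -> Series (fun n => f (S n)) - psumR f N <= eps.
Proof.
  intros Hf H Heps.
  pose proof (Series_correct _ H) as L.
  destruct (proj1 (filterlim_locally _ _) L (mkposreal eps Heps)) as [N0 HN0].
  exists (S N0). intros N HN. destruct N as [|N]; [lia|].
  specialize (HN0 N ltac:(lia)). rewrite sum_n_psum in HN0. apply Rabs_def2 in HN0.
  change (psumR f (S N) - Series (fun n => f (S n)) < eps /\
    - eps < psumR f (S N) - Series (fun n => f (S n))) in HN0. lra.
Qed.

Lemma psum_le_Series (f : nat -> C) (N : nat) : ex_series (fun n => Cmod (f (S n))) ->
  psumR (fun d => Cmod (f d)) N <= Series (fun n => Cmod (f (S n))).
Proof. intros H. destruct (tail_series f N H) as [H0 _]. lra. Qed.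

Lemma psum_nonneg (f : nat -> R) (N : nat) : (forall n, 0 <= f n) -> 0 <= psumR f N.
Proof.
  intros H. induction N as [|N IH]; simpl; [apply Rle_refl|].
  apply Rplus_le_le_0_compat; auto.
Qed.

(** [psum_dconv] applied to the moduli bounds all partial sums by the product of the two absolute
    sums. *)
Lemma ex_series_dconv : ex_series (fun n => Cmod (dconv (K := C_Ring) x y (S n))).
Proof.
  assert (B : forall N, psumR (fun n => Cmod (dconv (K := C_Ring) x y n)) N <= XA * YB).
  { intros N. eapply Rle_trans; [apply psum_le; intros n _; apply Cmod_dconv_le|].
    change (psumR (dconv (K := R_Ring) ax ay) N <= XA * YB).
    rewrite psum_dconv.
    apply Rle_trans with (psumR (fun d => mult (ax d) YB) N).
    - apply psum_le. intros d _. apply Rmult_le_compat_l; [apply Cmod_ge_0|]. now apply psum_le_Series.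
    - rewrite psum_mult_r. apply Rmult_le_compat_r; [|now apply psum_le_Series].
      apply Series_nonneg; [intros; apply Cmod_ge_0 | exact Hy]. }
  destruct (ex_finite_lim_seq_incr (sum_n (fun n => Cmod (dconv (K := C_Ring) x y (S n)))) (XA * YB)) as [l Hl].
  - intros n. rewrite sum_Sn. unfold plus; simpl. generalize (Cmod_ge_0 (dconv (K := C_Ring) x y (S (S n)))). lra.
  - intros n. rewrite (sum_n_psum (fun n => Cmod (dconv (K := C_Ring) x y n))). apply B.
  - exists l. exact Hl.
Qed.

(* Partial sums of the convolution are [sum_(d <= N) x_d Y_(N/d)]: for small [d] the inner sum is near its
   limit, and large [d] contribute a tail of [sum |x_d|]. *)
Lemma cseries_dconv :
  cseries (fun n => dconv (K := C_Ring) x y (S n)) = (cseries (fun n => x (S n)) * cseries (fun n => y (S n)))%C.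
Proof.
  set (X := cseries (fun n => x (S n))). set (Y := cseries (fun n => y (S n))).
  set (Dl := cseries (fun n => dconv (K := C_Ring) x y (S n))).
  assert (HXA : 0 <= XA) by (apply Series_nonneg; [intros; apply Cmod_ge_0 | exact Hx]).
  assert (HYB : 0 <= YB) by (apply Series_nonneg; [intros; apply Cmod_ge_0 | exact Hy]).
  assert (KEY : forall e, 0 < e -> Cmod (Dl - X * Y) <= e * (1 + XA + YB + Cmod Y)).
  { intros e He.
    destruct (tail_lim ax e (fun n => Cmod_ge_0 _) Hx He) as [D HD].
    destruct (tail_lim ay e (fun n => Cmod_ge_0 _) Hy He) as [M HM].
    destruct (tail_lim (fun n => Cmod (dconv (K := C_Ring) x y n)) e (fun n => Cmod_ge_0 _) ex_series_dconv He)
      as [Q HQ].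
    (* N is at least D and Q, and N / d >= M for every d <= D. *)
    set (N := (D * M + D + Q)%nat).
    specialize (HQ N ltac:(unfold N; lia)).
    destruct (tail_series _ N ex_series_dconv) as [_ T1]. fold Dl in T1.
    destruct (tail_series x N Hx) as [_ T2]. fold X in T2.
    pose proof (HD N ltac:(unfold N; lia)) as T3. fold XA in T3.
    change (Cmod (X - psumC x N) <= XA - psumR ax N) in T2.
    assert (T4 : Cmod (psumC x N * Y - psumC (dconv (K := C_Ring) x y) N) <= e * XA + e * YB).
    { rewrite psum_dconv.
      replace (psumC x N * Y - psumC (fun d => mult (x d) (psum y (N / d))) N)%C
       with (psumC (fun d => (x d * (Y - psumC y (N / d)))%C) N).
      2:{ apply (psum_mult_sub x (fun d => psumC y (N / d)) Y N). }
      eapply Rle_trans.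
      { apply Cmod_psum_le with (g := fun d => plus (mult (ax d) e) (if Nat.leb d D then 0 else (ax d * YB))).
        intros d Hd. rewrite Cmod_mult. fold (ax d).
        pose proof (Cmod_ge_0 (x d)) as Hxd. fold (ax d) in Hxd.
        destruct (tail_series y (N / d) Hy) as [T5 T6]. fold Y in T6.
        change (Cmod (Y - psumC y (N / d)) <= YB - psumR ay (N / d)) in T6.
        change (ax d * Cmod (Y - psumC y (N / d)) <= ax d * e + (if Nat.leb d D then 0 else ax d * YB)).
        destruct (Nat.leb_spec d D) as [HdD|HdD].
        - rewrite Rplus_0_r. apply Rmult_le_compat_l; [auto|].
          eapply Rle_trans; [apply T6|]. apply HM.
          apply Nat.div_le_lower_bound; [lia|]. unfold N. nia.
        - assert (ax d * Cmod (Y - psumC y (N / d)) <= ax d * YB).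
          { apply Rmult_le_compat_l; [auto|]. eapply Rle_trans; [apply T6|].
            pose proof (psum_nonneg ay (N / d) (fun n => Cmod_ge_0 _)). lra. }
          assert (0 <= ax d * e) by (apply Rmult_le_pos; lra). lra. }
      rewrite psum_plus, psum_mult_r, psum_skip by (unfold N; lia).
      change (psumR ax N * e + (psumR (fun d => mult (ax d) YB) N
        - psumR (fun d => mult (ax d) YB) D) <= e * XA + e * YB).
      rewrite !psum_mult_r.
      change (psumR ax N * e + (psumR ax N * YB - psumR ax D * YB)
         <= e * XA + e * YB).
      pose proof (psum_le_Series x N Hx) as P1. change (psumR ax N <= XA) in P1.
      pose proof (HD D (le_n D)) as P2. fold XA in P2.
      assert (psumR ax N * e <= XA * e) by (apply Rmult_le_compat_r; lra).
      assert ((psumR ax N - psumR ax D) * YB <= e * YB) by (apply Rmult_le_compat_r; lra).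
      lra. }
    replace (Dl - X * Y)%C with
      ((Dl - psumC (dconv (K := C_Ring) x y) N)
       - (psumC x N * Y - psumC (dconv (K := C_Ring) x y) N)
       - (X - psumC x N) * Y)%C by ring.
    eapply Rle_trans; [apply Cmod_triangle_sub|].
    eapply Rle_trans; [apply Rplus_le_compat_r, Cmod_triangle_sub|].
    rewrite Cmod_mult.
    assert (Cmod (X - psumC x N) * Cmod Y <= e * Cmod Y).
    { apply Rmult_le_compat_r; [apply Cmod_ge_0|]. lra. }
    lra. }
  destruct (excluded_middle_informative (Dl = X * Y)%C) as [|Hne]; [assumption|exfalso].
  apply C_sub_neq_0, Cmod_gt_0 in Hne.
  set (W := 1 + XA + YB + Cmod Y) in *.
  assert (HW : 0 < W) by (generalize (Cmod_ge_0 Y); unfold W; lra).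
  specialize (KEY (Cmod (Dl - X * Y) / (2 * W)) ltac:(apply Rdiv_lt_0_compat; lra)).
  replace (Cmod (Dl - X * Y) / (2 * W) * W) with (Cmod (Dl - X * Y) / 2) in KEY by (field; lra). lra.
Qed.

End ConvolutionSeries.

(** * The coefficients of T_g f *)

Definition dirichlet_conv (a b : nat -> C) : nat -> C := dconv (K := C_Ring) a b.

(** The terms of the series at their true index n; [dirichlet_term] is shifted by one, which does
    not suit products of indices. *)
Definition twist (a : nat -> C) (s : C) (n : nat) : C := (a n * Cexp (- (s * ln (INR n))))%C.

(** For n = d q, n^(-s) = d^(-s) q^(-s), so the factor comes out of the sum over divisors. *)
Lemma dconv_twist (a b : nat -> C) (s : C) (n : nat) :
  dconv (K := C_Ring) (twist a s) (twist b s) (S n) = dirichlet_term (dirichlet_conv a b) s n.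
Proof.
  unfold dirichlet_term, dirichlet_conv, dconv.
  rewrite <- (psum_mult_r (K := C_Ring)). apply (psum_ext (K := C_Ring)). intros d Hd.
  destruct (Nat.eqb_spec (S n mod d) 0) as [E|E].
  - assert (Hn : (S n = d * (S n / d))%nat).
    { pose proof (Nat.div_mod (S n) d ltac:(lia)). lia. }
    assert (Hq : (1 <= S n / d)%nat) by nia.
    set (q := (S n / d)%nat) in *. unfold twist.
    replace (Cexp (- (s * ln (INR (S n))))) with (Cexp (- (s * ln (INR d))) * Cexp (- (s * ln (INR q))))%C.
    + change ((a d * Cexp (- (s * ln (INR d))) * (b q * Cexp (- (s * ln (INR q)))))%C =
        ((a d * b q) * (Cexp (- (s * ln (INR d))) * Cexp (- (s * ln (INR q)))))%C). ring.
    + rewrite <- Cexp_plus. f_equal. rewrite Hn, mult_INR, ln_mult, RtoC_plus; [ring | |];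
      apply lt_0_INR; lia.
  - symmetry. apply (mult_zero_l (K := C_Ring)).
Qed.

Lemma abs_conv_dirichlet_conv (a b : nat -> C) (x : R) : abs_conv a x -> abs_conv b x ->
  abs_conv (dirichlet_conv a b) x.
Proof.
  intros Ha Hb.
  apply (ex_series_ext (fun n => Cmod (dconv (K := C_Ring) (twist a (RtoC x)) (twist b (RtoC x)) (S n)))).
  - intros n. rewrite dconv_twist. apply Cmod_dirichlet_term.
  - apply ex_series_dconv; [apply (abs_conv_term a x x) | apply (abs_conv_term b x x)]; auto; simpl; lra.
Qed.

Lemma dirichlet_sum_conv (a b : nat -> C) (x : R) (s : C) : abs_conv a x -> abs_conv b x -> x <= Re s ->
  dirichlet_sum (dirichlet_conv a b) s = (dirichlet_sum a s * dirichlet_sum b s)%C.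
Proof.
  intros Ha Hb Hs. rewrite !dirichlet_sum_cseries.
  rewrite <- (cseries_ext _ _ (dconv_twist a b s)).
  apply (cseries_dconv (twist a s) (twist b s));
  [apply (abs_conv_term a s x) | apply (abs_conv_term b s x)]; auto.
Qed.

(** Integrating f g' term by term divides its coefficients by -ln n. At n = 1 the coefficient of f
    g' is itself 0, so the value given to [/ 0] does not matter. *)
Definition volterra_coef (b a : nat -> C) (n : nat) : C :=
  (- dirichlet_conv a (dlog b) n * RtoC (/ ln (INR n)))%C.

Lemma dlog_1 (a : nat -> C) : dlog a 1%nat = 0.
Proof. unfold dlog. simpl. rewrite ln_1. ring. Qed.

Lemma dirichlet_conv_dlog_1 (a b : nat -> C) : dirichlet_conv a (dlog b) 1%nat = 0.
Proof.
  unfold dirichlet_conv, dconv. simpl. rewrite dlog_1.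
  change (0 + a 1%nat * 0 = 0)%C. ring.
Qed.

Lemma volterra_coef_1 (b a : nat -> C) : volterra_coef b a 1%nat = 0.
Proof. unfold volterra_coef. rewrite dirichlet_conv_dlog_1. ring. Qed.

Lemma dlog_volterra_coef (b a : nat -> C) (n : nat) :
  dlog (volterra_coef b a) (S n) = dirichlet_conv a (dlog b) (S n).
Proof.
  destruct n as [|n]; [now rewrite dlog_1, dirichlet_conv_dlog_1|].
  unfold dlog, volterra_coef.
  pose proof (ln_INR_SS_ge n). pose proof ln_2_pos.
  assert (Hn : RtoC (ln (INR (S (S n)))) <> 0) by (intros K%RtoC_inj; lra).
  rewrite RtoC_inv by lra. fold (dlog b). field. exact Hn.
Qed.

Lemma abs_conv_volterra_coef (b a : nat -> C) (x y : R) : x < y -> abs_conv a x -> abs_conv b x ->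
  abs_conv (volterra_coef b a) y.
Proof.
  intros Hxy Ha Hb.
  apply abs_conv_le with (dirichlet_conv a (dlog b)) (/ ln 2).
  - intros [|n].
    + rewrite volterra_coef_1, Cmod_0. apply Rmult_le_pos; [|apply Cmod_ge_0].
      left. apply Rinv_0_lt_compat, ln_2_pos.
    + unfold volterra_coef. rewrite Cmod_mult, Cmod_opp, Cmod_R, Rmult_comm.
      pose proof (ln_INR_SS_ge n). pose proof ln_2_pos.
      apply Rmult_le_compat_r; [apply Cmod_ge_0|].
      rewrite Rabs_pos_eq by (left; apply Rinv_0_lt_compat; lra).
      apply Rinv_le_contravar; lra.
  - apply abs_conv_dirichlet_conv; [apply abs_conv_mono with x; auto; lra | now apply abs_conv_dlog with x].
Qed.

Lemma dirichlet_sum_ext (a b : nat -> C) (s : C) : (forall n, a (S n) = b (S n)) ->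
  dirichlet_sum a s = dirichlet_sum b s.
Proof.
  intros H. rewrite !dirichlet_sum_cseries. apply cseries_ext. intros n. unfold dirichlet_term. now rewrite H.
Qed.

Lemma C_derive_volterra_series (b a : nat -> C) (x : R) (s : C) : abs_conv a x -> abs_conv b x -> x < Re s ->
  C_derive (dirichlet_sum (volterra_coef b a)) s
    = (dirichlet_sum a s * C_derive (dirichlet_sum b) s)%C.
Proof.
  intros Ha Hb Hs.
  (* The logarithms in [dlog] cost a little absolute convergence, hence a point y strictly between x
     and Re s. *)
  set (y := (x + Re s) / 2).
  assert (Hxy : x < y < Re s) by (unfold y; lra). clearbody y.
  rewrite (C_derive_dirichlet_sum _ y); [|apply abs_conv_volterra_coef with x; auto; lra | lra].
  rewrite (dirichlet_sum_ext _ _ s (dlog_volterra_coef b a)).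
  rewrite (C_derive_dirichlet_sum b x) by auto.
  apply dirichlet_sum_conv with y;
    [apply abs_conv_mono with x; auto; lra | apply abs_conv_dlog with x; auto; lra | lra].
Qed.

(** The integral from s to s + X is F(s + X) - F(s), and F tends to 0 at the right end. *)
Lemma integral_right_primitive (F h : C -> C) (theta K : R) (s : C) : theta < Re s ->
  (forall w, theta < Re w -> cderiv F w (h w)) -> (forall w, theta < Re w -> ccont h w) ->
  (forall w, theta < Re w -> Cmod (F w) <= K * half_exp (Re w)) ->
  integral_right h s = (- F s)%C.
Proof.
  intros Hs HF Hh HK. unfold integral_right.
  apply (is_RInt_gen_unique (V := C_R_CompleteNormedModule)).
  assert (E : forall X, 0 <= X -> is_RInt (V := C_R_NormedModule) (fun x : R => h (s + x)%C) 0 X (F (s + X) - F s)%C).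
  { intros X HX.
    apply (is_RInt_ext (V := C_R_NormedModule) (fun t : R => h (s + RtoC t * 1)%C)).
    { intros t _. now rewrite Cmult_1_r. }
    replace (F (s + X) - F s)%C with (minus (F (s + RtoC X * 1)%C) (F (s + RtoC 0 * 1)%C) : C_R_NormedModule).
    2:{ change (F (s + RtoC X * 1) - F (s + RtoC 0 * 1) = F (s + X) - F s)%C. f_equal; [|f_equal]; f_equal; ring. }
    assert (R0 : forall t, 0 <= t -> theta < Re (s + RtoC t * 1)).
    { intros t Ht. replace (Re (s + t * 1)) with (Re s + t) by (destruct s; simpl; ring). lra. }
    apply (is_RInt_derive (V := C_R_CompleteNormedModule) (fun t : R => F (s + RtoC t * 1)%C)
       (fun t : R => h (s + RtoC t * 1)%C)); rewrite Rmin_left, Rmax_right by lra; intros t Ht.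
    - replace (h (s + t * 1)%C) with (h (s + t * 1)%C * 1)%C by ring. apply cderiv_line.
      apply HF, R0. lra.
    - apply ccurve_line. apply Hh, R0. lra. }
  intros P [eps HP].
  assert (Hexp : exists N, forall X, N < X -> K * half_exp (Re (s + X)) < eps).
  { pose proof ln_2_pos as Hl.
    destruct (Rle_lt_dec K 0) as [HK0|HK0].
    - exists 0. intros X _. pose proof (exp_pos (- (Re (s + X) * ln 2))). pose proof (cond_pos eps). nra.
    - exists (- ln (eps / K) / ln 2 - Re s). intros X HX.
      replace (Re (s + X)) with (Re s + X) by (destruct s; simpl; ring).
      assert (Hek : 0 < eps / K) by (apply Rdiv_lt_0_compat; [apply cond_pos | auto]).
      assert (exp (- ((Re s + X) * ln 2)) < eps / K).
      { rewrite <- (exp_ln (eps / K)) by auto. apply exp_increasing.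
        assert (H : - ln (eps / K) / ln 2 < Re s + X) by lra.
        apply Rmult_lt_compat_r with (r := ln 2) in H; [|auto].
        replace (- ln (eps / K) / ln 2 * ln 2) with (- ln (eps / K)) in H by (field; lra). lra. }
      apply Rmult_lt_compat_l with (r := K) in H; [|auto].
      replace (K * (eps / K)) with (pos eps) in H by (field; lra). exact H. }
  destruct Hexp as [N HN].
  exists (fun x => x = 0) (fun X => Rmax 0 N < X).
  - reflexivity.
  - exists (Rmax 0 N). auto.
  - intros x X -> HX. exists (F (s + X) - F s)%C.
    assert (0 < X /\ N < X) by (generalize (Rmax_l 0 N) (Rmax_r 0 N); lra).
    split; [apply E; lra|]. apply HP.
    apply C_NormedModule_mixin_compat1.
    change (Cmod (F (s + X) - F s - - F s)%C < eps).
    replace (F (s + X) - F s - - F s)%C with (F (s + X)%C) by ring.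
    eapply Rle_lt_trans; [apply HK | apply HN; lra].
    replace (Re (s + X)) with (Re s + X) by (destruct s; simpl; ring). lra.
Qed.

(** Since its first coefficient is 0, the series is the primitive of f g' that vanishes at infinity;
    the minus sign in T_g cancels the one of the integral. *)
Lemma volterra_dirichlet_sum (b a : nat -> C) (x : R) (s : C) : abs_conv a x -> abs_conv b x -> x < Re s ->
  volterra b a s = dirichlet_sum (volterra_coef b a) s.
Proof.
  intros Ha Hb Hs. set (y := (x + Re s) / 2).
  assert (Hxy : x < y) by (unfold y; lra).
  pose proof (abs_conv_volterra_coef b a x y Hxy Ha Hb) as Hc.
  destruct (dirichlet_sum_decay _ _ Hc (volterra_coef_1 b a)) as [K [_ HK]].
  unfold volterra.
  rewrite (integral_right_primitive (dirichlet_sum (volterra_coef b a)) _ y K); [ring| | | |].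
  - unfold y; lra.
  - intros w Hw. rewrite <- (C_derive_volterra_series b a x) by (auto; lra).
    apply (hol_cderiv y); auto. now apply hol_dirichlet_sum.
  - intros w Hw. apply (hol_ccont y); auto.
    apply (hol_mult y (dirichlet_sum a) (C_derive (dirichlet_sum b))).
    + apply hol_mono with x; [lra | now apply hol_dirichlet_sum].
    + apply hol_C_derive. apply hol_mono with x; [lra | now apply hol_dirichlet_sum].
  - intros w Hw. apply HK. lra.
Qed.

(** * Test functions *)

(* Coefficients [n^(i tau - 1) / ln n]: the derivative of the series is minus the tail of [zeta (s + 1 - i tau)].
   At [n = 1] the junk value [/ 0 = 0] makes the coefficient vanish. *)
Definition test_coef (tau : R) (n : nat) : C :=
  (RtoC (/ ln (INR n)) * Cexp (- ((1, - tau)%R * ln (INR n))))%C.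

Lemma test_coef_1 (tau : R) : test_coef tau 1 = 0.
Proof. unfold test_coef. simpl. rewrite ln_1, Rinv_0. ring. Qed.

Lemma Re_mult_real (z : C) (L : R) : Re (- (z * RtoC L)) = - (Re z * L).
Proof. destruct z. simpl. ring. Qed.

Lemma Cmod_test_term_le (tau x : R) (n : nat) : 0 < x ->
  0 <= Cmod (test_coef tau (S (S n))) * exp (- (x * ln (INR (S (S n))))) <= / ln 2 * zeta_tail x n.
Proof.
  intros Hx. split; [apply mult_exp_nonneg, Cmod_ge_0|].
  unfold test_coef, zeta_tail. rewrite Cmod_mult, Cmod_R, Cmod_Cexp, Re_mult_real.
  pose proof (ln_INR_SS_ge n). pose proof ln_2_pos. set (L := ln (INR (S (S n)))) in *.
  simpl Re. rewrite Rmult_assoc, <- exp_plus.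
  replace (- (1 * L) + - (x * L)) with (- ((1 + x) * L)) by ring.
  apply Rmult_le_compat_r; [apply exp_nonneg|].
  rewrite Rabs_pos_eq by (left; apply Rinv_0_lt_compat; lra). apply Rinv_le_contravar; lra.
Qed.

Lemma Series_test_bound (tau x : R) : 0 < x -> abs_conv (test_coef tau) x /\
  Series (fun n => Cmod (test_coef tau (S n)) * exp (- (x * ln (INR (S n))))) <= / ln 2 * / x.
Proof.
  intros Hx. destruct (zeta_tail_bounds x Hx) as [E [_ U]].
  assert (E1 : ex_series (fun n => / ln 2 * zeta_tail x n)) by now apply ex_series_scal_R.
  assert (E2 : ex_series (fun n => Cmod (test_coef tau (S (S n))) * exp (- (x * ln (INR (S (S n))))))).
  { apply (ex_series_bound _ _ (fun n => Cmod_test_term_le tau x n Hx) E1). }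
  assert (A : abs_conv (test_coef tau) x) by now apply (ex_series_incr_1 (V := R_NormedModule)).
  split; [exact A|].
  rewrite Series_incr_1 by exact A. rewrite test_coef_1, Cmod_0, Rmult_0_l, Rplus_0_l.
  eapply Rle_trans; [apply Series_le; [|exact E1]|].
  - intros n. now apply Cmod_test_term_le.
  - rewrite Series_scal_l. apply Rmult_le_compat_l; [|exact U]. left. apply Rinv_0_lt_compat, ln_2_pos.
Qed.

Lemma abs_conv_test (tau x : R) : 0 < x -> abs_conv (test_coef tau) x.
Proof. intros Hx. now apply Series_test_bound. Qed.

Lemma hol_test (tau : R) : hol 0 (dirichlet_sum (test_coef tau)).
Proof.
  intros s Hs. apply (hol_dirichlet_sum _ (Re s / 2)); [apply abs_conv_test|]; lra.
Qed.

Lemma C_derive_test (tau : R) (s : C) : 0 < Re s ->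
  C_derive (dirichlet_sum (test_coef tau)) s = dirichlet_sum (dlog (test_coef tau)) s.
Proof. intros Hs. apply C_derive_dirichlet_sum with (Re s / 2); [apply abs_conv_test|]; lra. Qed.

Lemma dirichlet_term_dlog_test_0 (tau : R) (s : C) : dirichlet_term (dlog (test_coef tau)) s 0 = 0.
Proof. unfold dirichlet_term. rewrite dlog_1. ring. Qed.

Lemma dirichlet_term_dlog_test (tau : R) (s : C) (n : nat) :
  dirichlet_term (dlog (test_coef tau)) s (S n) = (- Cexp (- (((1, - tau)%R + s) * ln (INR (S (S n))))))%C.
Proof.
  rewrite dirichlet_term_dlog. unfold dirichlet_term, test_coef.
  pose proof (ln_INR_SS_ge n). pose proof ln_2_pos. set (L := ln (INR (S (S n)))) in *.
  replace (- (((1, - tau)%R + s) * L))%C with (- ((1, - tau)%R * L) + - (s * L))%C by ring.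
  rewrite Cexp_plus, RtoC_inv by lra. field. intros K%RtoC_inj; lra.
Qed.

(** Differentiation cancels the 1 / ln n, and n^(i tau) has modulus 1, so the moduli sum to zeta(1 +
    Re s) - 1 for every tau. *)
Lemma test_derivative_bound (tau : R) (s : C) : 0 < Re s ->
  Cmod (C_derive (dirichlet_sum (test_coef tau)) s) <= / Re s.
Proof.
  intros Hs. rewrite C_derive_test by auto.
  destruct (zeta_tail_bounds (Re s) Hs) as [E [_ U]].
  pose (b := fun n => match n with O => 0 | S m => zeta_tail (Re s) m end).
  assert (Eb : ex_series b) by now apply (ex_series_incr_1 (V := R_NormedModule)).
  eapply Rle_trans; [apply (cseries_bound _ b); [|exact Eb]|].
  - intros [|n]; [rewrite dirichlet_term_dlog_test_0, Cmod_0; apply Rle_refl|].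
    rewrite dirichlet_term_dlog_test, Cmod_opp, Cmod_Cexp, Re_mult_real. right. simpl. unfold zeta_tail.
    reflexivity.
  - rewrite Series_incr_1 by exact Eb. change (0 + Series (zeta_tail (Re s)) <= / Re s). lra.
Qed.

Lemma ln_2_le_1 : ln 2 <= 1.
Proof. pose proof (exp_ineq1_le (ln 2)) as H. rewrite exp_ln in H by lra. lra. Qed.

Lemma Rinv_ln_2_le : / ln 2 <= 2.
Proof.
  pose proof ln_lt_2. apply Rle_trans with (/ / 2); [apply Rinv_le_contravar; lra | right; field].
Qed.

Lemma test_bound_1 (tau : R) (s : C) : Re s = 1 -> Cmod (dirichlet_sum (test_coef tau) s) <= 2.
Proof.
  intros Hs. destruct (Series_test_bound tau 1 Rlt_0_1) as [A B].
  eapply Rle_trans; [apply (dirichlet_sum_bound _ s 1 A); lra|].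
  pose proof Rinv_ln_2_le. lra.
Qed.

(** At height tau the oscillation cancels and every term is real and nonpositive. The sum is at most
    -2^(-t)/t, and 2^(-t) >= 1 - t. *)
Lemma Re_C_derive_test (tau t : R) : 0 < t ->
  Re (C_derive (dirichlet_sum (test_coef tau)) (t, tau)) <= 1 - / t.
Proof.
  intros Ht. rewrite C_derive_test by auto.
  destruct (zeta_tail_bounds t Ht) as [E [L _]].
  assert (Eq : forall n, - zeta_tail t n = Re (dirichlet_term (dlog (test_coef tau)) (t, tau) (S n))).
  { intros n. rewrite dirichlet_term_dlog_test. unfold zeta_tail. generalize (ln (INR (S (S n)))). intros l.
    replace (- (((1, - tau)%R + (t, tau)) * l))%C with (RtoC (- ((1 + t) * l))).
    - unfold Cexp; simpl. rewrite cos_0. ring.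
    - unfold Cplus, Copp, Cmult, RtoC; simpl. f_equal; ring. }
  assert (En : ex_series (fun n => Re (dirichlet_term (dlog (test_coef tau)) (t, tau) n))).
  { apply (ex_series_incr_1 (V := R_NormedModule)). apply (ex_series_ext _ _ Eq).
    now apply (ex_series_opp (V := R_NormedModule)). }
  change (Series (fun n => Re (dirichlet_term (dlog (test_coef tau)) (t, tau) n)) <= 1 - / t).
  rewrite Series_incr_1 by exact En. rewrite dirichlet_term_dlog_test_0, <- (Series_ext _ _ Eq), Series_opp.
  change (0 + - Series (zeta_tail t) <= 1 - / t).
  assert (/ t - 1 <= exp (- (t * ln 2)) / t); [|lra].
  replace (/ t - 1) with ((1 - t) / t) by (field; lra).
  apply Rmult_le_compat_r; [left; now apply Rinv_0_lt_compat|].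
  pose proof (exp_ineq1_le (- (t * ln 2))). pose proof ln_2_le_1. nra.
Qed.

Lemma ln_1_div (x : R) : 0 < x -> ln (1 / x) = - ln x.
Proof. intros Hx. unfold Rdiv. now rewrite Rmult_1_l, ln_Rinv. Qed.

(** Integrates [Re_C_derive_test] from [sg] to 1. Of the 3, one unit is the integral of the 1 there,
    and two come from the bound 2 on the line Re s = 1. *)
Lemma test_lower_bound (tau sg : R) : 0 < sg <= 1 ->
  ln (1 / sg) - 3 <= Cmod (dirichlet_sum (test_coef tau) (sg, tau)).
Proof.
  intros [Hs Hs1].
  set (F := dirichlet_sum (test_coef tau)).
  pose (G := fun t : R => Re (F (t, tau)) + (ln t - t)).
  assert (HG : forall t, sg <= t <= 1 -> is_derive G t (Re (C_derive F (t, tau) * 1) + (/ t - 1))).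
  { intros t Ht. apply (is_derive_plus (V := R_NormedModule)).
    - apply (is_derive_ext (fun t : R => Re (F ((0, tau) + RtoC t * 1)%C))); [intros u; now rewrite horizontal_line|].
      apply is_derive_Re. apply cderiv_line. rewrite horizontal_line.
      apply (hol_cderiv 0); [apply hol_test | simpl; lra].
    - auto_derive; [lra | field; lra]. }
  assert (N : G 1 <= G sg).
  { apply (nonincreasing_of_derivative G _ sg 1 Hs1 HG). intros t Ht. rewrite Cmult_1_r.
    pose proof (Re_C_derive_test tau t ltac:(lra)) as K. fold F in K. lra. }
  unfold G in N. rewrite ln_1 in N.
  pose proof (test_bound_1 tau (1, tau) eq_refl) as B. fold F in B.
  pose proof (re_le_Cmod (F (1, tau))) as R1. pose proof (re_le_Cmod (F (sg, tau))) as R2.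
  pose proof (Rle_abs (Re (F (sg, tau)))). pose proof (Rabs_maj2 (Re (F (1, tau)))).
  rewrite ln_1_div by auto.
  lra.
Qed.

(** * Growth of Bloch Dirichlet series *)

Lemma le_of_exp_decay (v c d X0 : R) :
  (forall X, X0 <= X -> v <= c + d * half_exp X) -> v <= c.
Proof.
  intros H. destruct (INR_unbounded X0) as [N HN].
  apply (is_lim_seq_le_loc (fun _ => v) (fun n => c + d * (/ 2) ^ n) v c).
  - exists N. intros n Hn. apply le_INR in Hn.
    rewrite <- Rpower_pow by lra. unfold Rpower. rewrite ln_Rinv, Ropp_mult_distr_r_reverse by lra.
    apply H. lra.
  - apply is_lim_seq_const.
  - replace (Finite c) with (Finite (c + d * 0)) by (f_equal; ring).
    apply is_lim_seq_plus'; [apply is_lim_seq_const|].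
    apply is_lim_seq_mult'; [apply is_lim_seq_const|].
    apply is_lim_seq_geom. rewrite Rabs_pos_eq; lra.
Qed.

Lemma exp_decay_increment theta f (K a b y : R) : theta < a -> a <= b -> 0 <= K -> hol theta f ->
  (forall t, a <= t <= b -> Cmod (C_derive f (t, y)) <= K * half_exp t) ->
  Cmod (f (b, y) - f (a, y)) <= 2 * K * half_exp a.
Proof.
  intros Ha Hab HK Hf Hle.
  pose proof ln_2_pos as Hl. pose proof Rinv_ln_2_le as Hi.
  eapply Rle_trans.
  { apply (hol_increment_horizontal theta f (fun t => - (K / ln 2) * half_exp t)
      (fun t => K * half_exp t) a b y); auto.
    intros t _. auto_derive; [auto | field; lra]. }
  pose proof (exp_pos (- (a * ln 2))). pose proof (exp_pos (- (b * ln 2))).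
  assert (0 <= K / ln 2 <= 2 * K).
  { split; [apply Rdiv_le_0_compat; auto|]. unfold Rdiv. rewrite (Rmult_comm 2). now apply Rmult_le_compat_l. }
  nra.
Qed.

(** A real-valued consequence of having norm N, with each summand bounded separately; it keeps
    extended reals out of the analysis. *)
Definition bloch_bound (F : C -> C) (N : R) : Prop :=
  (forall s, 0 < Re s -> Re s * Cmod (C_derive F s) <= N) /\ Cmod (F 1) <= N.

Lemma bloch_bound_nonneg F N : bloch_bound F N -> 0 <= N.
Proof. intros [_ H]. generalize (Cmod_ge_0 (F 1)). lra. Qed.

Lemma extension_derivative (a : nat -> C) (F : C -> C) (theta x : R) (s : C) :
  hol 0 F -> abs_conv a x -> (forall s, theta < Re s -> F s = dirichlet_sum a s) ->
  0 < Re s -> theta < Re s -> x < Re s -> C_derive F s = C_derive (dirichlet_sum a) s.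
Proof.
  intros HF Ha E H0 Ht Hx.
  apply (C_derive_ext (Rmax 0 theta)); [now apply Rmax_lub_lt | |].
  - apply hol_mono with 0; [apply Rmax_l | exact HF].
  - intros w Hw. apply E. generalize (Rmax_r 0 theta). lra.
Qed.

(** The constants y and K depend on the series and not only on the norm. They serve as the
    boundedness hypothesis of Phragmén-Lindelöf, and directly only for the fixed g. *)
Lemma extension_derivative_decay (a : nat -> C) (F : C -> C) (theta x : R) :
  hol 0 F -> abs_conv a x -> (forall s, theta < Re s -> F s = dirichlet_sum a s) ->
  exists y K, 1 <= y /\ 0 <= K /\ forall s, y <= Re s -> Cmod (C_derive F s) <= K * half_exp (Re s).
Proof.
  intros HF Ha E.
  destruct (dirichlet_sum_decay (dlog a) (x + 1)) as [K [HK0 HK]];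
    [apply abs_conv_dlog with x; auto; lra | apply dlog_1 |].
  exists (Rmax 1 (Rmax theta x + 1)), K. split; [apply Rmax_l | split; [exact HK0|]].
  intros s Hs.
  generalize (Rmax_l 1 (Rmax theta x + 1)) (Rmax_r 1 (Rmax theta x + 1)) (Rmax_l theta x) (Rmax_r theta x).
  intros.
  rewrite (extension_derivative a F theta x) by (auto; lra).
  rewrite (C_derive_dirichlet_sum a x) by (auto; lra). apply HK. lra.
Qed.

(* Phragmén–Lindelöf for [F' s 2^s]: bounded on [Re s >= 1], and at most [2 N] on the line. *)
Lemma bloch_derivative_decay (a : nat -> C) (F : C -> C) (theta x N : R) :
  hol 0 F -> abs_conv a x -> (forall s, theta < Re s -> F s = dirichlet_sum a s) -> bloch_bound F N ->
  forall s, 1 <= Re s -> Cmod (C_derive F s) <= 2 * N * half_exp (Re s).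
Proof.
  intros HF Ha E HN s Hs.
  pose proof (bloch_bound_nonneg _ _ HN) as HN0. destruct HN as [HN _].
  destruct (extension_derivative_decay a F theta x HF Ha E) as [y [K [Hy [HK0 HK]]]].
  pose proof ln_2_pos as Hl.
  assert (M : forall w : C, Cmod (Cexp (w * ln 2)) = exp (Re w * ln 2)).
  { intros w. rewrite Cmod_Cexp. f_equal. generalize (ln 2). intros l. destruct w. simpl. ring. }
  assert (Inv : forall t, half_exp t * exp (t * ln 2) = 1).
  { intros t. rewrite <- exp_plus. replace (- (t * ln 2) + t * ln 2) with 0 by ring. apply exp_0. }
  assert (D1 : forall w, 1 <= Re w -> Cmod (C_derive F w) <= N).
  { intros w Hw. specialize (HN w ltac:(lra)). pose proof (Cmod_ge_0 (C_derive F w)). nra. }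
  assert (B : Cmod (C_derive F s * Cexp (s * ln 2)) <= 2 * N).
  { apply (phragmen_lindelof (fun w => C_derive F w * Cexp (w * ln 2))%C (K + N * exp (y * ln 2))); [| lra | | | exact Hs].
    - apply (hol_mult 0 (C_derive F) (fun w => Cexp (w * ln 2))%C); [now apply hol_C_derive|].
      intros w _. eexists. apply (cderiv_comp (fun w => w * ln 2)%C); [|apply cderiv_Cexp].
      apply (cderiv_mult (fun w => w) (fun _ => RtoC (ln 2))); [apply cderiv_id | apply cderiv_const].
    - intros w Hw. rewrite Cmod_mult, M.
      pose proof (exp_pos (Re w * ln 2)). pose proof (exp_pos (y * ln 2)).
      assert (0 <= N * exp (y * ln 2)) by (apply Rmult_le_pos; lra).
      destruct (Rle_lt_dec y (Re w)) as [Hyw|Hyw].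
      + specialize (HK w Hyw).
        apply Rle_trans with (K * half_exp (Re w) * exp (Re w * ln 2)); [apply Rmult_le_compat_r; lra|].
        rewrite Rmult_assoc, Inv. lra.
      + apply Rle_trans with (N * exp (y * ln 2)); [|lra].
        apply Rmult_le_compat; [apply Cmod_ge_0 | lra | now apply D1|].
        apply exp_le_mono. apply Rmult_le_compat_r; lra.
    - intros w Hw. rewrite Cmod_mult, M, Hw, Rmult_1_l, exp_ln, Rmult_comm by lra.
      apply Rmult_le_compat_l; [lra|]. apply D1. lra. }
  rewrite Cmod_mult, M in B.
  pose proof (exp_pos (- (Re s * ln 2))).
  apply Rmult_le_compat_r with (r := half_exp (Re s)) in B; [|lra].
  rewrite Rmult_assoc, (Rmult_comm (exp (Re s * ln 2))), Inv in B. lra.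
Qed.

(** Joins s to 1 by going right to real part X, down to the real axis, and back. Each horizontal
    piece costs at most 2 N and the vertical one tends to 0 as X grows; |F(1)| <= N makes 5 N. *)
Lemma bloch_growth_right (a : nat -> C) (F : C -> C) (theta x N : R) :
  hol 0 F -> abs_conv a x -> (forall s, theta < Re s -> F s = dirichlet_sum a s) -> bloch_bound F N ->
  forall s, 1 <= Re s -> Cmod (F s) <= 5 * N.
Proof.
  intros HF Ha E HN s Hs.
  pose proof (bloch_derivative_decay a F theta x N HF Ha E HN) as D.
  pose proof (bloch_bound_nonneg _ _ HN) as HN0. destruct HN as [_ HN1].
  destruct s as [sg t]. simpl in Hs.
  pose proof ln_2_pos as Hl.
  assert (I : forall u y X, 1 <= u -> u <= X -> Cmod (F (X, y) - F (u, y)) <= 2 * N).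
  { intros u y X Hu HX.
    eapply Rle_trans; [apply (exp_decay_increment 0 F (2 * N)); auto; try lra|].
    - intros v Hv. apply (D (v, y)). simpl; lra.
    - assert (half_exp u <= / 2).
      { rewrite <- (exp_ln (/ 2)) by lra. apply exp_le_mono. rewrite ln_Rinv by lra. nra. }
      nra. }
  assert (V : forall X, sg <= X -> Cmod (F (X, t) - F (X, 0)) <= 2 * N * half_exp X * Rabs t).
  { intros X HX.
    replace (Rabs t) with (Cmod ((X, t) - (X, 0))).
    - apply (hol_increment_segment 0 F (X, 0) (X, t)); simpl; auto; try lra.
      intros w Hw. rewrite Rmin_left in Hw by lra.
      eapply Rle_trans; [apply D; lra|]. apply Rmult_le_compat_l; [lra|]. apply exp_le_mono. nra.
    - replace ((X, t) - (X, 0))%C with (RtoC t * Ci)%C.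
      + rewrite Cmod_mult, Cmod_Ci, Cmod_R. ring.
      + unfold Cminus, Cplus, Copp, Cmult, RtoC, Ci; simpl. f_equal; ring. }
  assert (Z : Cmod (F (sg, t) - F (1, 0)) <= 4 * N).
  { apply (le_of_exp_decay _ _ (2 * N * Rabs t) sg). intros X HX.
    replace (F (sg, t) - F (1, 0))%C with
      ((F (X, t) - F (X, 0)) - (F (X, t) - F (sg, t)) + (F (X, 0) - F (1, 0)))%C by ring.
    eapply Rle_trans; [apply Cmod_triangle|].
    eapply Rle_trans; [apply Rplus_le_compat_r, Cmod_triangle_sub|].
    pose proof (I sg t X ltac:(lra) ltac:(lra)). pose proof (I 1 0 X ltac:(lra) ltac:(lra)).
    specialize (V X HX). lra. }
  change (F 1) with (F (1, 0)) in HN1.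
  pose proof (Cmod_sub_rev (F (sg, t)) (F (1, 0))). lra.
Qed.

Lemma bloch_growth_left (a : nat -> C) (F : C -> C) (theta x N : R) :
  hol 0 F -> abs_conv a x -> (forall s, theta < Re s -> F s = dirichlet_sum a s) -> bloch_bound F N ->
  forall s, 0 < Re s <= 1 -> Cmod (F s) <= 5 * N * (1 + ln (1 / Re s)).
Proof.
  intros HF Ha E HN s Hs.
  pose proof (bloch_growth_right a F theta x N HF Ha E HN) as B.
  pose proof (bloch_bound_nonneg _ _ HN) as HN0. destruct HN as [HN _].
  destruct s as [sg t]. simpl in *.
  assert (I : Cmod (F (1, t) - F (sg, t)) <= N * ln 1 - N * ln sg).
  { apply (hol_increment_horizontal 0 F (fun u => N * ln u) (fun u => N / u)); auto; try lra.
    - intros u Hu. auto_derive; [lra | field; lra].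
    - intros u Hu. specialize (HN (u, t) ltac:(simpl; lra)). simpl in HN.
      apply Rmult_le_reg_l with u; [lra|]. replace (u * (N / u)) with N by (field; lra). exact HN. }
  specialize (B (1, t) ltac:(simpl; lra)).
  pose proof (Cmod_sub_rev (F (sg, t)) (F (1, t))) as T. rewrite Cmod_sub_sym in T.
  rewrite ln_1 in I.
  rewrite ln_1_div by lra.
  assert (ln sg <= 0) by (rewrite <- ln_1; apply ln_le_mono; lra).
  nra.
Qed.

Lemma log_weight_ge (sg : R) : 0 < sg <= 1 -> sg <= log_weight sg.
Proof.
  intros H. unfold log_weight.
  assert (0 <= ln (1 / sg)).
  { rewrite ln_1_div by lra.
    assert (ln sg <= 0) by (rewrite <- ln_1; apply ln_le_mono; lra). lra. }
  nra.
Qed.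

(** Carries the control of G' across Re s = 1: G is bounded on Re s >= 1/2, hence G' on Re s >= 1,
    and beyond some y the series gives the decay. *)
Lemma weighted_derivative_decay (b : nat -> C) (G : C -> C) (theta x K1 K : R) :
  hol 0 G -> abs_conv b x -> (forall s, theta < Re s -> G s = dirichlet_sum b s) ->
  (forall s, 0 < Re s <= 1 -> log_weight (Re s) * Cmod (C_derive G s) <= K1) ->
  (forall s, 1 < Re s -> Cmod (G s) <= K) ->
  exists K3, 0 <= K3 /\ forall s, 1 <= Re s -> Cmod (C_derive G s) <= K3 * half_exp (Re s).
Proof.
  intros HG Hb E H1 H2.
  destruct (extension_derivative_decay b G theta x HG Hb E) as [y [K' [Hy [HK0 HK]]]].
  pose proof ln_2_pos as Hl.
  (* Here the weight is at least Re s >= 1/2. *)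
  assert (D : forall s, 1 / 2 <= Re s <= 1 -> Cmod (C_derive G s) <= 2 * K1).
  { intros s Hs. specialize (H1 s ltac:(lra)). pose proof (log_weight_ge (Re s) ltac:(lra)).
    pose proof (Cmod_ge_0 (C_derive G s)). nra. }
  assert (HK1 : 0 <= K1).
  { specialize (D 1 ltac:(simpl; lra)). pose proof (Cmod_ge_0 (C_derive G 1)). lra. }
  (* The supremum is over the open half-plane; continuity adds its boundary line. *)
  assert (G1 : forall s, Re s = 1 -> Cmod (G s) <= K).
  { intros s Hs. apply le_epsilon. intros eps Heps.
    destruct (hol_ccont 0 G s HG ltac:(lra) eps Heps) as [del [Hdel Hd]].
    assert (Hr : Re (s + RtoC (del / 2)) = Re s + del / 2) by (destruct s; simpl; ring).
    specialize (H2 (s + RtoC (del / 2))%C ltac:(lra)).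
    specialize (Hd (s + RtoC (del / 2))%C).
    replace (s + RtoC (del / 2) - s)%C with (RtoC (del / 2)) in Hd by ring.
    rewrite Cmod_R, Rabs_pos_eq in Hd by lra. specialize (Hd ltac:(lra)).
    pose proof (Cmod_sub_rev (G s) (G (s + RtoC (del / 2))%C)) as T. rewrite Cmod_sub_sym in T. lra. }
  assert (G2 : forall s, 1 / 2 <= Re s -> Cmod (G s) <= K + K1).
  { intros s Hs. destruct (Rlt_le_dec 1 (Re s)) as [Hs1|Hs1]; [specialize (H2 s Hs1); lra|].
    destruct s as [sg t]. simpl in *.
    assert (I : Cmod (G (1, t) - G (sg, t)) <= 2 * K1 * 1 - 2 * K1 * sg).
    { apply (hol_increment_horizontal 0 G (fun u => 2 * K1 * u) (fun _ => 2 * K1)); auto; try lra.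
      - intros u _. auto_derive; [auto | ring].
      - intros u Hu. apply D. simpl; lra. }
    specialize (G1 (1, t) eq_refl).
    pose proof (Cmod_sub_rev (G (sg, t)) (G (1, t))) as T. rewrite Cmod_sub_sym in T. nra. }
  (* Cauchy's estimate with radius 1/4, which keeps the square in Re w >= 3/4. *)
  set (K2 := 8 * (K + K1) / (1 / 4)).
  assert (D2 : forall s, 1 <= Re s -> Cmod (C_derive G s) <= K2).
  { intros s Hs. apply cauchy_estimate; [lra | apply (hol_rect 0); [lra | exact HG]|].
    intros w [Hw _]. apply G2. lra. }
  assert (HK2 : 0 <= K2) by (eapply Rle_trans; [apply Cmod_ge_0 | apply (D2 1); simpl; lra]).
  (* Between 1 and y the bound K2 is at most K2 2^(y - Re s). *)
  exists (K2 * exp (y * ln 2) + K').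
  pose proof (exp_pos (y * ln 2)).
  assert (HP : 0 <= K2 * exp (y * ln 2)) by (apply Rmult_le_pos; lra).
  split; [lra|].
  intros s Hs. pose proof (exp_pos (- (Re s * ln 2))) as Hp.
  destruct (Rle_lt_dec y (Re s)) as [Hys|Hys].
  - eapply Rle_trans; [now apply HK|]. apply Rmult_le_compat_r; lra.
  - eapply Rle_trans; [now apply D2|].
    apply Rle_trans with (K2 * exp (y * ln 2) * half_exp (Re s)); [|apply Rmult_le_compat_r; lra].
    rewrite Rmult_assoc, <- exp_plus. rewrite <- (Rmult_1_r K2) at 1. apply Rmult_le_compat_l; [auto|].
    rewrite <- exp_0 at 1. apply exp_le_mono. nra.
Qed.

(** A primitive of F G' has the same derivative as the series of T_g f far to the right; subtracting
    the constant k makes the two agree there. *)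
Lemma volterra_extension (b a : nat -> C) (G F : C -> C) (x theta theta' : R) :
  hol 0 G -> hol 0 F -> abs_conv a x -> abs_conv b x ->
  (forall s, theta < Re s -> F s = dirichlet_sum a s) ->
  (forall s, theta' < Re s -> G s = dirichlet_sum b s) ->
  exists H y, hol 0 H /\
    (forall s, 0 < Re s -> C_derive H s = (F s * C_derive G s)%C) /\
    (forall s, y < Re s -> H s = dirichlet_sum (volterra_coef b a) s).
Proof.
  intros HG HF Ha Hb EF EG.
  destruct (half_plane_primitive 0 (fun s => F s * C_derive G s)%C) as [P HP].
  { apply hol_mult; [exact HF | now apply hol_C_derive]. }
  destruct (common_upper_bound 0 (x + 1) theta theta') as [y Hy].
  set (S := dirichlet_sum (volterra_coef b a)).
  assert (HS : hol y S).
  { apply hol_mono with (x + 1); [lra|]. apply hol_dirichlet_sum. apply abs_conv_volterra_coef with x; auto. lra. }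
  set (k := (P (RtoC (y + 1)) - S (RtoC (y + 1)))%C).
  assert (HP0 : hol 0 P) by (intros s Hs; eexists; now apply HP).
  exists (fun s => P s - k)%C, y. repeat split.
  - apply (hol_minus 0 P (fun _ => k)); [exact HP0 | apply hol_const].
  - intros s Hs. apply cderiv_C_derive.
    replace (F s * C_derive G s)%C with (F s * C_derive G s - 0)%C by ring.
    apply cderiv_minus; [now apply HP | apply cderiv_const].
  - intros s Hs.
    assert (HD : hol y (fun s => P s - S s)%C).
    { apply hol_minus; [apply hol_mono with 0; [lra | exact HP0] | exact HS]. }
    assert (E0 : (P s - S s)%C = k).
    { apply (hol_zero_derivative_const y (fun s => P s - S s)%C (RtoC (y + 1)) s); auto; [simpl; lra|].
      intros w Hw. apply cderiv_C_derive.
      replace (RtoC 0) with (F w * C_derive G w - C_derive S w)%C.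
      - apply cderiv_minus; [apply HP; lra | now apply (hol_cderiv y)].
      - unfold S. rewrite (C_derive_volterra_series b a x) by (auto; lra).
        rewrite EF, (extension_derivative b G theta' x) by (auto; lra). ring. }
    rewrite <- E0. ring.
Qed.

(** In the strip the growth 5 N (1 + log(1/Re s)) of F is absorbed by the weight. For Re s > 1, Re s
    2^(-Re s) <= 1 / ln 2 <= 2 turns 5 into 10. The value at 1 is an integral from infinity, as H
    has no constant term: twice 5 N K3 times 2^(-1). *)
Lemma volterra_bloch_bound (b a : nat -> C) (G F H : C -> C) (x theta N K1 K3 y : R) :
  hol 0 F -> hol 0 H -> abs_conv a x -> abs_conv b x -> (forall s, theta < Re s -> F s = dirichlet_sum a s) ->
  bloch_bound F N -> 0 <= K3 ->
  (forall s, 0 < Re s <= 1 -> log_weight (Re s) * Cmod (C_derive G s) <= K1) ->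
  (forall s, 1 <= Re s -> Cmod (C_derive G s) <= K3 * half_exp (Re s)) ->
  (forall s, 0 < Re s -> C_derive H s = (F s * C_derive G s)%C) ->
  (forall s, y < Re s -> H s = dirichlet_sum (volterra_coef b a) s) ->
  (forall s, 0 < Re s -> Re s * Cmod (C_derive H s) <= (5 * Rabs K1 + 10 * K3) * N) /\
  Cmod (H 1) <= 5 * K3 * N.
Proof.
  intros HF HH Ha Hb EF HN HK3 H1 H2 HD EH.
  pose proof (bloch_bound_nonneg _ _ HN) as HN0.
  pose proof (bloch_growth_right a F theta x N HF Ha EF HN) as BR.
  pose proof (bloch_growth_left a F theta x N HF Ha EF HN) as BL.
  pose proof ln_2_pos as Hl. pose proof Rinv_ln_2_le as Hi.
  pose proof (Rle_abs K1) as HK1. pose proof (Rabs_pos K1) as HK1'.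
  assert (DR : forall s, 1 <= Re s -> Cmod (C_derive H s) <= 5 * N * K3 * half_exp (Re s)).
  { intros s Hs. rewrite HD, Cmod_mult by lra. rewrite (Rmult_assoc (5 * N)).
    apply Rmult_le_compat; auto using Cmod_ge_0. }
  split.
  - intros s Hs. assert (0 <= K3 * N) by (apply Rmult_le_pos; lra).
    assert (0 <= Rabs K1 * N) by (apply Rmult_le_pos; lra).
    destruct (Rle_lt_dec (Re s) 1) as [Hs1|Hs1].
    + specialize (BL s ltac:(lra)). specialize (H1 s ltac:(lra)). unfold log_weight in H1.
      rewrite HD, Cmod_mult by lra.
      pose proof (Cmod_ge_0 (C_derive G s)) as Hg.
      apply Rle_trans with (5 * N * (Re s * (1 + ln (1 / Re s)) * Cmod (C_derive G s))).
      * replace (5 * N * (Re s * (1 + ln (1 / Re s)) * Cmod (C_derive G s)))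
          with (Re s * (5 * N * (1 + ln (1 / Re s)) * Cmod (C_derive G s))) by ring.
        apply Rmult_le_compat_l; [lra|]. now apply Rmult_le_compat_r.
      * apply Rle_trans with (5 * N * Rabs K1); [apply Rmult_le_compat_l; lra | lra].
    + specialize (DR s ltac:(lra)).
      apply Rle_trans with (Re s * (5 * N * K3 * half_exp (Re s))); [apply Rmult_le_compat_l; lra|].
      pose proof (mult_exp_neg_le (Re s) (ln 2) Hl) as Q. rewrite (Rmult_comm (ln 2)) in Q.
      replace (Re s * (5 * N * K3 * half_exp (Re s)))
        with (5 * (K3 * N) * (Re s * half_exp (Re s))) by ring.
      apply Rle_trans with (5 * (K3 * N) * 2); [apply Rmult_le_compat_l; lra | lra].
  - destruct (dirichlet_sum_decay (volterra_coef b a) (x + 1)) as [K [HK0 HK]].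
    { apply abs_conv_volterra_coef with x; auto. lra. } { apply volterra_coef_1. }
    apply (le_of_exp_decay _ _ K (Rmax 1 (Rmax (y + 1) (x + 1)))). intros X HX.
    generalize (Rmax_l 1 (Rmax (y + 1) (x + 1))) (Rmax_r 1 (Rmax (y + 1) (x + 1)))
      (Rmax_l (y + 1) (x + 1)) (Rmax_r (y + 1) (x + 1)). intros.
    assert (HX1 : Cmod (H (X, 0)) <= K * half_exp X).
    { rewrite EH by (simpl; lra). apply (HK (X, 0)). simpl; lra. }
    assert (I : Cmod (H (X, 0) - H (1, 0)) <= 2 * (5 * N * K3) * half_exp 1).
    { apply (exp_decay_increment 0 H (5 * N * K3)); auto; try lra.
      - repeat apply Rmult_le_pos; lra.
      - intros t Ht. apply (DR (t, 0)). simpl; lra. }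
    rewrite Rmult_1_l, exp_Ropp, exp_ln in I by lra.
    change (H 1) with (H (1, 0)).
    pose proof (Cmod_sub_rev (H (1, 0)) (H (X, 0))) as T. rewrite Cmod_sub_sym in T. lra.
Qed.

Lemma ccont_log_weight (z : C) : 0 < Re z -> ccont (fun z => RtoC (log_weight (Re z))) z.
Proof.
  intros Hz eps Heps.
  assert (D : continuous log_weight (Re z)).
  { apply (ex_derive_continuous (K := R_AbsRing) (V := R_NormedModule)).
    unfold log_weight. auto_derive. repeat split; try lra.
    unfold Rdiv. rewrite Rmult_1_l. now apply Rinv_0_lt_compat. }
  destruct (proj1 (filterlim_locally _ _) D (mkposreal eps Heps)) as [del Hd].
  exists del. split; [apply cond_pos|]. intros w Hw.
  rewrite <- RtoC_minus, Cmod_R. left. apply Hd.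
  exact (Rle_lt_trans _ _ _ (re_le_Cmod (w - z)) Hw).
Qed.

(** Prepares the passage from essential to pointwise bounds. The square extends only to the left of
    [sg], so it stays in the strip even for [sg] = 1. *)
Lemma weighted_derivative_gt_near (F : C -> C) (r sg t : R) : hol 0 F -> 0 < sg <= 1 ->
  r < log_weight sg * Cmod (C_derive F (sg, t)) ->
  exists del, 0 < del /\ forall x y, sg - del <= x <= sg -> t <= y <= t + del ->
    0 < x <= 1 /\ r < log_weight x * Cmod (C_derive F (x, y)).
Proof.
  intros HF Hs Hr.
  assert (P : forall u z, 0 < u <= 1 -> Cmod (RtoC (log_weight u) * C_derive F z) = log_weight u * Cmod (C_derive F z)).
  { intros u z Hu. rewrite Cmod_mult, Cmod_R, Rabs_pos_eq; [reflexivity|].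
    pose proof (log_weight_ge u Hu). lra. }
  assert (Q : ccont (fun z => RtoC (log_weight (Re z)) * C_derive F z)%C (sg, t)).
  { apply (ccont_mult (fun z => RtoC (log_weight (Re z)))); [apply ccont_log_weight; simpl; lra|].
    apply (hol_ccont 0); [now apply hol_C_derive | simpl; lra]. }
  set (v := log_weight sg * Cmod (C_derive F (sg, t))) in *.
  destruct (Q ((v - r) / 2)) as [del [Hdel Hd]]; [lra|].
  (* The bound sg/2 keeps x positive; del/3 in each coordinate keeps the distance below del. *)
  exists (Rmin (del / 3) (sg / 2)). split; [apply Rmin_glb_lt; lra|].
  intros x y Hx Hy. generalize (Rmin_l (del / 3) (sg / 2)) (Rmin_r (del / 3) (sg / 2)). intros.
  assert (Hx1 : 0 < x <= 1) by lra. split; [exact Hx1|].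
  specialize (Hd (x, y)). simpl Re in Hd.
  pose proof (Cmod_sub_rev (RtoC (log_weight sg) * C_derive F (sg, t)) (RtoC (log_weight x) * C_derive F (x, y))) as T.
  rewrite Cmod_sub_sym, !P in T by auto. fold v in T.
  assert (Cmod ((x, y) - (sg, t)) < del).
  { eapply Rle_lt_trans; [apply Cmod_le_abs_sum|]. simpl.
    assert (Rabs (x + - sg) <= del / 3) by (apply Rabs_le; lra).
    assert (Rabs (y + - t) <= del / 3) by (apply Rabs_le; lra). lra. }
  specialize (Hd H1). lra.
Qed.

(** * Norms in the extended reals *)

Section ExtendedReals.
Import boot.ssreflect boot.ssrbool ssralg order boolp classical_sets functions reals.
Import constructive_ereal ereal measure lebesgue_measure measurable_realfun lebesgue_integral ess_sup_inf.
Import interval Rstruct Rstruct_topology Order.POrderTheory.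

Lemma lee_Rle (x y : R) : (x%:E <= y%:E)%E <-> x <= y.
Proof. rewrite lee_fin. split; move/RleP => //. Qed.

Lemma bloch_norm_le (F : C -> C) (A B N : R) :
  (forall s, 0 < Re s -> Re s * Cmod (C_derive F s) <= A) -> Cmod (F 1%C) <= B -> A + B <= N ->
  (bloch_norm F <= N%:E)%E.
Proof.
  intros HA HB HN.
  apply: (le_trans (y := (A%:E + B%:E)%E)); [|now apply/lee_Rle].
  unfold bloch_norm. refine (@leeD (R : realType) _ _ _ _ _ _); [|now apply/lee_Rle].
  refine (@ge_ereal_sup (R : realType) _ _ _). intros _ [s Hs <-]. apply/lee_Rle. now apply HA.
Qed.

(** The point s = 1 shows that the supremum is not -oo and is nonnegative, so each summand is at
    most the norm. *)
Lemma bloch_norm_fin (F : C -> C) : (bloch_norm F < +oo)%E ->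
  exists N, bloch_norm F = N%:E /\ bloch_bound F N.
Proof.
  unfold bloch_norm.
  assert (G : forall s, 0 < Re s -> ((weighted_derivative (fun sigma => sigma) F s)%:E <=
    ereal_sup [set (weighted_derivative (fun sigma => sigma) F s)%:E | s in half_plane 0])%E).
  { intros s Hs. refine (@ereal_sup_ubound (R : realType) _ _ _). exists s; [exact Hs | reflexivity]. }
  destruct (ereal_sup [set (weighted_derivative (fun sigma => sigma) F s)%:E | s in half_plane 0]) as [r| |].
  - intros _. exists (r + Cmod (F 1%C)). split; [reflexivity|].
    assert (G' : forall s, 0 < Re s -> Re s * Cmod (C_derive F s) <= r).
    { intros s Hs. apply/lee_Rle. now apply G. }
    pose proof (Cmod_ge_0 (F 1%C)) as H1.
    assert (Hr : 0 <= r).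
    { specialize (G' 1%C ltac:(simpl; lra)). simpl in G'.
      pose proof (Cmod_ge_0 (C_derive F 1%C)). simpl in *. lra. }
    split; [|lra]. intros s Hs. specialize (G' s Hs). lra.
  - intros H. discriminate H.
  - specialize (G 1%C ltac:(simpl; lra)). discriminate G.
Qed.

Lemma bloch_norm_lt (F : C -> C) (N : R) : (bloch_norm F <= N%:E)%E -> (bloch_norm F < +oo)%E.
Proof. move=> H. apply: (le_lt_trans H). exact: ltry. Qed.

Definition segment (a b : R) : set (measurableTypeR R) := [set` interval.Interval (interval.BLeft a) (interval.BRight b)]%classic.

Lemma segmentP (a b x : R) : segment a b x <-> a <= x <= b.
Proof.
  rewrite /segment /= interval.in_itv /=. split.
  - by move=> /andP [/RleP H1 /RleP H2].
  - move=> [H1 H2]. by apply/andP; split; apply/RleP.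
Qed.

Lemma measurable_segment (a b : R) : measurable (segment a b).
Proof. exact: measurable_itv. Qed.

Lemma segment_measure_pos (a b : R) : a < b ->
  ((GRing.zero%:E : \bar (R : realType)) < @lebesgue_measure (R : realType) (segment a b))%E.
Proof.
  move=> Hab. rewrite /segment lebesgue_measure_itv /=.
  have Hl : (a%:E < b%:E)%E by rewrite lte_fin; apply/RltP.
  rewrite Hl.
  have H : ((GRing.zero : R)%:E < (b - a)%:E)%E.
  { rewrite lte_fin. apply/RltP. change (0 < b - a). lra. }
  exact: H.
Qed.

Definition square (a b c d : R) : set (measurableTypeR R * measurableTypeR R) :=
  (segment a b `*` segment c d)%classic.

Lemma measurable_square (a b c d : R) : measurable (square a b c d).
Proof. apply: measurableX; exact: measurable_segment. Qed.

Lemma square_measure_pos (a b c d : R) : a < b -> c < d -> ((GRing.zero%:E : \bar (R : realType)) < lebesgue_C (square a b c d))%E.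
Proof.
  move=> Hab Hcd. 
  have -> : lebesgue_C (square a b c d) = (@lebesgue_measure (R : realType) (segment a b)
    * @lebesgue_measure (R : realType) (segment c d))%E
    by apply: product_measure1E; exact: measurable_segment.
  by apply: mule_gt0; apply: segment_measure_pos.
Qed.

(** Otherwise the square would lie in the null set where the bound fails, but its measure is
    positive. *)
Lemma ess_sup_le_somewhere (f : C -> \bar R) (r : R) (a b c d : R) : a < b -> c < d ->
  (ess_sup lebesgue_C f <= r%:E)%E ->
  exists x y, a <= x <= b /\ c <= y <= d /\ (f (x, y) <= r%:E)%E.
Proof.
  move=> Hab Hcd /ess_supP [A [mA A0 sub]].
  destruct (excluded_middle_informative
    (exists x y, a <= x <= b /\ c <= y <= d /\ (f (x, y) <= r%:E)%E)) as [|Hn]; [assumption|exfalso].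
  assert (S : (square a b c d `<=` A)%classic).
  { intros [x y] [Hx%segmentP Hy%segmentP]. apply sub. intros Hf. apply Hn. now exists x, y. }
  have P := square_measure_pos a b c d Hab Hcd.
  have Q : (lebesgue_C (square a b c d) <= lebesgue_C A)%E.
  { apply: le_measure S; rewrite inE //. exact: measurable_square. }
  rewrite A0 in Q.
  have := lt_le_trans P Q. by rewrite ltxx.
Qed.

Lemma bloch_norm_mul_le (F H : C -> C) (M N N' : R) : bloch_norm F = N%:E -> bloch_norm H = N'%:E ->
  (bloch_norm H <= M%:E * bloch_norm F)%E <-> N' <= M * N.
Proof.
  move=> -> ->. rewrite -EFinM. exact: lee_Rle.
Qed.

Lemma log_weight_restrictE (F : C -> C) (s : C) :
  (((fun s : C => (weighted_derivative log_weight F s)%:E) \_ unit_strip) s : \bar (R : realType)) =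
  if excluded_middle_informative (0 < Re s <= 1) then (weighted_derivative log_weight F s)%:E else GRing.zero%:E.
Proof.
  rewrite patchE. destruct (excluded_middle_informative (0 < Re s <= 1)) as [H|H].
  - by rewrite mem_set.
  - by rewrite memNset.
Qed.

Lemma bloch_weight_norm_fin (F : C -> C) : hol 0 F -> (bloch_weight_norm log_weight F < +oo)%E ->
  exists K1 K, (forall s, 0 < Re s <= 1 -> log_weight (Re s) * Cmod (C_derive F s) <= K1) /\
    (forall s, 1 < Re s -> Cmod (F s) <= K).
Proof.
  intros HF. unfold bloch_weight_norm.
  set (f := ((fun s : C => (weighted_derivative log_weight F s)%:E) \_ unit_strip)).
  set (S := [set (Cmod (F s))%:E | s in half_plane 1]%classic).
  assert (HS : forall s, 1 < Re s -> ((Cmod (F s))%:E <= ereal_sup S)%E).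
  { intros s Hs. refine (@ereal_sup_ubound (R : realType) _ _ _). exists s; [exact Hs | reflexivity]. }
  assert (Hf : forall r, (ess_sup lebesgue_C f <= r%:E)%E ->
    forall s, 0 < Re s <= 1 -> log_weight (Re s) * Cmod (C_derive F s) <= r).
  { intros r Hr [sg t] Hs. simpl in Hs. apply Rnot_lt_le. intros Hlt.
    destruct (weighted_derivative_gt_near F r sg t HF Hs Hlt) as [del [Hdel Hd]].
    destruct (ess_sup_le_somewhere f r (sg - del) sg t (t + del)) as [x [y [Hx [Hy Hxy]]]]; [lra | lra | exact Hr |].
    destruct (Hd x y Hx Hy) as [H1 H2].
    unfold f in Hxy. rewrite log_weight_restrictE in Hxy. simpl Re in Hxy.
    destruct (excluded_middle_informative (0 < x <= 1)) as [Hp|Hn]; [|contradiction].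
    apply lee_Rle in Hxy. unfold weighted_derivative in Hxy. simpl Re in Hxy. lra. }
  (* Excludes the value -oo, with which finiteness of the sum would say nothing about the other
     summand. *)
  assert (Hnonneg : ~ (ess_sup lebesgue_C f <= (-1)%:E)%E).
  { intros Hr. specialize (Hf (-1) Hr 1%C ltac:(simpl; lra)).
    pose proof (Cmod_ge_0 (C_derive F 1%C)). pose proof (log_weight_ge 1 ltac:(lra)). simpl Re in Hf. nra. }
  destruct (ess_sup lebesgue_C f) as [r| |]; [ | | exfalso; apply Hnonneg; exact: leNye].
  - destruct (ereal_sup S) as [k| |].
    + intros _. exists r, k. split.
      * apply Hf. by apply/lee_Rle; apply Rle_refl.
      * intros s Hs. apply lee_Rle. now apply HS.
    + intros H. discriminate H.
    + specialize (HS 2%C ltac:(simpl; lra)). discriminate HS.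
  - destruct (ereal_sup S) as [k| |]; intros H; try discriminate H.
    specialize (HS 2%C ltac:(simpl; lra)). discriminate HS.
Qed.

Lemma bloch_weight_norm_lt (F : C -> C) (K1 K : R) : 0 <= K1 ->
  (forall s, 0 < Re s <= 1 -> log_weight (Re s) * Cmod (C_derive F s) <= K1) ->
  (forall s, 1 < Re s -> Cmod (F s) <= K) -> (bloch_weight_norm log_weight F < +oo)%E.
Proof.
  intros HK1 H1 H2.
  apply: (le_lt_trans (y := (K1%:E + K%:E)%E)); [|exact: ltry].
  unfold bloch_weight_norm.
  refine (@leeD (R : realType) _ _ _ _ _ _).
  - apply/ess_supP. apply: aeW. move=> s. rewrite log_weight_restrictE.
    destruct (excluded_middle_informative (0 < Re s <= 1)) as [H|H].
    + apply/lee_Rle. now apply H1.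
    (* Off the strip the function is 0, which is where 0 <= K1 enters. *)
    + by apply/(lee_Rle 0 K1).
  - refine (@ge_ereal_sup (R : realType) _ _ _). intros _ [s Hs <-]. apply/lee_Rle. now apply H2.
Qed.

End ExtendedReals.

(** * The theorem *)

Lemma holomorphic_on_hol (F : C -> C) : holomorphic_on (half_plane 0) F <-> hol 0 F.
Proof.
  split; intros H s Hs; destruct (H s Hs) as [l Hl]; exists l; now apply is_derive_cderiv.
Qed.

(** The constant function 1, whose image under T_g is g up to a constant. *)
Definition unit_coef (n : nat) : C := if Nat.eqb n 1 then RtoC 1 else RtoC 0.

Lemma abs_conv_unit (x : R) : abs_conv unit_coef x.
Proof.
  apply (ex_series_incr_1 (V := R_NormedModule)).
  apply (ex_series_bound _ (zeta_tail 1)); [|apply zeta_tail_bounds; lra].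
  intros n. unfold unit_coef. simpl Nat.eqb. cbv iota. rewrite Cmod_0, Rmult_0_l.
  split; [apply Rle_refl | left; apply exp_pos].
Qed.

Lemma dirichlet_sum_unit (s : C) : dirichlet_sum unit_coef s = 1.
Proof.
  pose proof (abs_conv_term unit_coef s (Re s) (abs_conv_unit _) (Rle_refl _)) as H.
  change (cseries (fun n => twist unit_coef s (S n)) = 1).
  rewrite (cseries_psum (twist unit_coef s) 1 H).
  rewrite (cseries_ext _ (fun n => 0 * dirichlet_term unit_coef s n)%C).
  - rewrite cseries_scal by exact H.
    change (psumC (twist unit_coef s) 1) with (0 + twist unit_coef s 1)%C.
    unfold twist, unit_coef. simpl. rewrite ln_1.
    replace (- (s * 0))%C with (RtoC 0) by ring. rewrite Cexp_0. ring.
  - intros n. unfold twist, unit_coef. simpl Nat.eqb. cbv iota. ring.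
Qed.

Lemma bloch_dirichlet_of_bounds (a : nat -> C) (F : C -> C) (x theta A B : R) : abs_conv a x -> hol 0 F ->
  (forall s, theta < Re s -> F s = dirichlet_sum a s) ->
  (forall s, 0 < Re s -> Re s * Cmod (C_derive F s) <= A) -> Cmod (F 1) <= B ->
  bloch_dirichlet a F.
Proof.
  intros Ha HF E HA HB. repeat split.
  - now apply abs_conv_in_D with x.
  - now apply holomorphic_on_hol.
  - now exists theta.
  - now apply holomorphic_on_hol.
  - apply (bloch_norm_lt F (A + B)). exact (bloch_norm_le F A B _ HA HB (Rle_refl _)).
Qed.

(** Here H is whatever extension boundedness provides. Its derivative agrees far to the right with
    that of the extension from [volterra_extension], hence on all of C_+. *)
Lemma volterra_image_derivative (b a c : nat -> C) (G F H : C -> C) (x theta theta' theta'' theta3 : R) :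
  hol 0 G -> hol 0 F -> hol 0 H -> abs_conv a x -> abs_conv b x ->
  (forall s, theta < Re s -> F s = dirichlet_sum a s) ->
  (forall s, theta' < Re s -> G s = dirichlet_sum b s) ->
  (forall s, theta'' < Re s -> H s = dirichlet_sum c s) ->
  (forall s, theta3 < Re s -> dirichlet_sum c s = volterra b a s) ->
  forall s, 0 < Re s -> C_derive H s = (F s * C_derive G s)%C.
Proof.
  intros HG HF HH Ha Hb EF EG EH EV.
  destruct (volterra_extension b a G F x theta theta' HG HF Ha Hb EF EG) as [H0 [y [HH0 [D0 E0]]]].
  assert (Z : forall s, 0 < Re s -> (C_derive H s - C_derive H0 s)%C = 0).
  { destruct (common_upper_bound theta'' theta3 x y) as [m Hm].
    apply (identity_far_right (Rmax 0 m) (fun s => C_derive H s - C_derive H0 s)%C).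
    - apply (hol_minus 0 (C_derive H) (C_derive H0)); now apply hol_C_derive.
    - intros s Hs.
      rewrite (C_derive_ext (Rmax 0 m) H H0 s Hs); [ring | |].
      + apply hol_mono with 0; [apply Rmax_l | exact HH].
      + intros w Hw. generalize (Rmax_r 0 m). intros.
        rewrite EH, EV, (volterra_dirichlet_sum b a x), E0 by (auto; lra). reflexivity. }
  intros s Hs. rewrite <- D0 by auto.
  replace (C_derive H s) with ((C_derive H s - C_derive H0 s) + C_derive H0 s)%C by ring.
  rewrite Z by auto. ring.
Qed.

Lemma abs_conv_common (a b : nat -> C) : in_D a -> in_D b -> exists x, abs_conv a x /\ abs_conv b x.
Proof.
  intros [x Hx]%in_D_abs_conv [y Hy]%in_D_abs_conv. exists (Rmax x y).
  split; [apply abs_conv_mono with x | apply abs_conv_mono with y]; auto; [apply Rmax_l | apply Rmax_r].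
Qed.

Lemma volterra_bounded_of_weight (g : nat -> C) (G : C -> C) : in_D g -> analytic_extension g G ->
  in_bloch_weight log_weight G -> volterra_bounded g.
Proof.
  intros hg [HG%holomorphic_on_hol [theta' EG]] [_ HW].
  destruct (bloch_weight_norm_fin G HG HW) as [K1 [K [H1 H2]]].
  destruct (in_D_abs_conv g hg) as [xg Hxg].
  destruct (weighted_derivative_decay g G theta' xg K1 K HG Hxg EG H1 H2) as [K3 [HK3 H3]].
  (* The sum of the two constants of [volterra_bloch_bound]; it depends on g alone. *)
  exists (5 * Rabs K1 + 15 * K3). intros a F [Da [[HF%holomorphic_on_hol [theta EF]] [_ HN]]].
  destruct (bloch_norm_fin F HN) as [N [EN BN]].
  destruct (abs_conv_common a g Da hg) as [x [Ha Hg]].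
  destruct (volterra_extension g a G F x theta theta' HG HF Ha Hg EF EG) as [H [y [HH [DH EH]]]].
  destruct (volterra_bloch_bound g a G F H x theta N K1 K3 y HF HH Ha Hg EF BN HK3 H1 H3 DH EH) as [B1 B2].
  exists (volterra_coef g a), H. split; [|split].
  - apply (bloch_dirichlet_of_bounds _ H (x + 1) y ((5 * Rabs K1 + 10 * K3) * N) (5 * K3 * N)); auto.
    apply abs_conv_volterra_coef with x; auto; lra.
  - exists x. intros s Hs. symmetry. now apply volterra_dirichlet_sum with x.
  - pose proof (bloch_norm_le H _ _ _ B1 B2 (Rle_refl _)) as HL.
    destruct (bloch_norm_fin H (bloch_norm_lt H _ HL)) as [N' [EN' _]].
    apply (bloch_norm_mul_le F H _ N N' EN EN').
    rewrite EN' in HL. apply lee_Rle in HL. lra.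
Qed.

Lemma weight_of_volterra_bounded (g : nat -> C) : in_D g -> volterra_bounded g ->
  exists G, analytic_extension g G /\ in_bloch_weight log_weight G.
Proof.
  intros hg [M HM]. destruct (in_D_abs_conv g hg) as [x Hg].
  destruct (HM unit_coef (fun _ => RtoC 1)) as [c1 [H1 [[_ [[HH1%holomorphic_on_hol [t1 E1]] [_ BH1]]] [[t1' V1] _]]]].
  { apply (bloch_dirichlet_of_bounds _ _ 0 0 0 1); [apply abs_conv_unit | apply hol_const | | |].
    - intros s _. symmetry. apply dirichlet_sum_unit.
    - intros s _. rewrite (cderiv_C_derive _ _ _ (cderiv_const 1 s)), Cmod_0. lra.
    - rewrite Cmod_1. lra. }
  destruct (bloch_norm_fin H1 BH1) as [N1 [_ [BN1 _]]].
  destruct (common_upper_bound 0 x t1 t1') as [m Hm].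
  set (g0 := dirichlet_sum g).
  assert (Hg0 : hol m g0) by (apply hol_mono with x; [lra | now apply hol_dirichlet_sum]).
  assert (EH1 : forall s, m < Re s -> H1 s = dirichlet_sum (volterra_coef g unit_coef) s).
  { intros s Hs. rewrite E1 by (change (t1 < Re s); lra). rewrite V1 by (change (t1' < Re s); lra).
    apply volterra_dirichlet_sum with x; [apply abs_conv_unit | auto | lra]. }
  (* T_g 1 and g have the same derivative far to the right; removing their constant difference turns
     the extension of T_g 1 into one of g. *)
  set (k := (H1 (RtoC (m + 1)) - g0 (RtoC (m + 1)))%C).
  set (G := fun s => (H1 s - k)%C).
  assert (HG : hol 0 G) by (apply hol_minus; [exact HH1 | apply hol_const]).
  assert (DG : forall s, 0 < Re s -> C_derive G s = C_derive H1 s).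
  { intros s Hs. apply cderiv_C_derive. replace (C_derive H1 s) with (C_derive H1 s - 0)%C by ring.
    apply cderiv_minus; [now apply (hol_cderiv 0) | apply cderiv_const]. }
  assert (EG : forall s, m < Re s -> G s = dirichlet_sum g s).
  { intros s Hs.
    assert (Hd : (H1 s - g0 s)%C = k).
    { apply (hol_zero_derivative_const m (fun s => H1 s - g0 s)%C (RtoC (m + 1)) s); auto; [simpl; lra | |].
      - apply hol_minus; [apply hol_mono with 0; [lra | exact HH1] | exact Hg0].
      - intros w Hw. apply cderiv_C_derive.
        replace (RtoC 0) with (C_derive H1 w - C_derive g0 w)%C.
        + apply cderiv_minus; [apply (hol_cderiv 0); [auto | lra] | now apply (hol_cderiv m)].
        + rewrite (C_derive_ext m H1 _ w Hw) with (2 := EH1) by (apply hol_mono with 0; [lra | exact HH1]).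
          rewrite (C_derive_volterra_series g unit_coef x) by (try apply abs_conv_unit; auto; lra).
          rewrite dirichlet_sum_unit. unfold g0. ring. }
    unfold G. rewrite <- Hd. unfold g0. ring. }
  assert (BG : bloch_bound G (Rabs N1 + Cmod (G 1))).
  { pose proof (Rle_abs N1). pose proof (Rabs_pos N1). pose proof (Cmod_ge_0 (G 1)). split; [|lra].
    intros s Hs. rewrite DG by auto. specialize (BN1 s Hs). lra. }
  exists G. split.
  { split; [now apply holomorphic_on_hol | exists m; exact EG]. }
  split; [now apply holomorphic_on_hol|].
  (* For each point the test function is the one whose [tau] is the imaginary part of that point.
     All of them have norm at most 1 + 2 = 3, so one constant serves every height. *)
  assert (T : forall s, 0 < Re s <= 1 -> Re s * ((ln (1 / Re s) - 3) * Cmod (C_derive G s)) <= 3 * Rabs M).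
  { intros [sg tau] Hs. simpl in Hs.
    set (F := dirichlet_sum (test_coef tau)).
    assert (P1 : forall s, 0 < Re s -> Re s * Cmod (C_derive F s) <= 1).
    { intros s Hs'. pose proof (test_derivative_bound tau s Hs') as B.
      apply Rmult_le_compat_l with (r := Re s) in B; [|lra]. rewrite Rinv_r in B by lra. exact B. }
    assert (P2 : Cmod (F 1) <= 2) by (apply test_bound_1; reflexivity).
    assert (BF : bloch_dirichlet (test_coef tau) F).
    { apply (bloch_dirichlet_of_bounds _ F 1 0 1 2); auto; [apply abs_conv_test; lra | apply hol_test]. }
    destruct (HM _ _ BF) as [c [H [[_ [[HH%holomorphic_on_hol [t E]] [_ BH]]] [[t' V] HL]]]].
    pose proof (bloch_norm_le F _ _ _ P1 P2 (Rle_refl _)) as LF.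
    destruct (bloch_norm_fin F (bloch_norm_lt F _ LF)) as [N [EN BN]].
    rewrite EN in LF. apply lee_Rle in LF.
    destruct (bloch_norm_fin H BH) as [N' [EN' [BN' _]]].
    apply (bloch_norm_mul_le F H M N N' EN EN') in HL.
    pose proof (bloch_bound_nonneg _ _ BN) as HN0.
    assert (M * N <= 3 * Rabs M).
    { pose proof (Rle_abs M). pose proof (Rabs_pos M). nra. }
    specialize (BN' (sg, tau) ltac:(simpl; lra)).
    rewrite (volterra_image_derivative g (test_coef tau) c G F H (Rmax 1 x) 0 m t t') in BN';
      [ | auto | apply hol_test | auto | apply abs_conv_test | | | exact EG | exact E | exact V | simpl; lra].
    2:{ generalize (Rmax_l 1 x). lra. }
    2:{ apply abs_conv_mono with x; [apply Rmax_r | exact Hg]. }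
    2:{ reflexivity. }
    rewrite Cmod_mult in BN'. pose proof (test_lower_bound tau sg Hs) as L. fold F in L.
    simpl Re in *.
    apply Rle_trans with (sg * (Cmod (F (sg, tau)) * Cmod (C_derive G (sg, tau)))); [|lra].
    apply Rmult_le_compat_l; [lra|]. apply Rmult_le_compat_r; [apply Cmod_ge_0 | exact L]. }
  (* The weight factor 1 + log splits as (log - 3) + 4: the first part is [T], the second the Bloch
     bound inherited from T_g 1. The bound on Re s > 1 is [bloch_growth_right] for G itself. *)
  apply (bloch_weight_norm_lt G (3 * Rabs M + 4 * Rabs N1) (5 * (Rabs N1 + Cmod (G 1)))).
  - pose proof (Rabs_pos M). pose proof (Rabs_pos N1). lra.
  - intros s Hs. specialize (T s Hs). specialize (BN1 s ltac:(lra)). rewrite <- DG in BN1 by lra.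
    pose proof (Rle_abs N1). unfold log_weight. lra.
  - intros s Hs. apply (bloch_growth_right g G m x _ HG Hg EG BG). lra.
Qed.

Theorem theorem4p2 (g : nat -> C) (hg : in_D g) :
  volterra_bounded g <->
  exists G : C -> C, analytic_extension g G /\ in_bloch_weight log_weight G.
Proof.
  split.
  - now apply weight_of_volterra_bounded.
  - intros [G [H1 H2]]. now apply (volterra_bounded_of_weight g G).
Qed.
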